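(* Let $s\in(s_0,1)$ with $s_0>0$, let $0<\lambda\le\Lambda$ and $L\in\mathcal L_s(\lambda,\Lambda;1)$. Let $\eta\in C^{1,1}(\mathbb R^n)$ be such that $\eta\ge0$. Then there exists $\sigma_0=\sigma_0(n,s,\Lambda/\lambda,\|\eta\|_{C^{1,1}(\mathbb R^n)})>0$ such that for every $\sigma\ge\sigma_0$ and every $v\in C^{1+2s+\varepsilon}_{loc}(\mathbb R^n)\cap L^\infty(\mathbb R^n)$ $$L\big(\eta^2(\partial_ev)_+^2+\sigma v^2\big)\le2\eta^2L(\partial_ev)\,(\partial_ev)_++2\sigma L(v)\,v\quad\text{in }\mathbb R^n.$$
   Context: Here $e\in\mathbb S^{n-1}$ is a direction, $\partial_e$ is the directional derivative, and $\varepsilon>0$; $t_+=\max\{t,0\}$ and $(\partial_ev)_+^2=((\partial_ev)_+)^2$. Operators: $Lu(x)=\mathrm{p.v.}\int_{\mathbb R^n}(u(x)-u(y))K(x-y)\,dy$ with $K:\mathbb R^n\to[0,\infty]$ symmetric, $K(y)=K(-y)$. One writes $L\in\mathcal L_s(\lambda,\Lambda;1)$ if for all $y\neq0$: $\lambda|y|^{-n-2s}\le K(y)\le\Lambda|y|^{-n-2s}$ and $|\nabla K(y)|\le\Lambda|y|^{-1}K(y)$.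
   Formalization: The threshold σ₀ is allowed to depend also on an arbitrary upper bound for Λ, because the condition |∇K| ≤ Λ|y|^{-1}K is not scale invariant and a σ₀ depending only on n, s, Λ/λ and ‖η‖ fails for rapidly oscillating kernels as Λ→∞. *)

(* Defs.v *)
From HB Require Import structures.
From mathcomp Require Import all_boot all_order all_algebra.
From mathcomp Require Import all_classical all_reals all_analysis.

Set Implicit Arguments.
Unset Strict Implicit.
Unset Printing Implicit Defensive.

Import Order.TTheory GRing.Theory Num.Theory.
Import numFieldNormedType.Exports.

Local Open Scope classical_set_scope.
Local Open Scope ring_scope.

(* Lebesgue measure on R^n, built by recursion as the image of the product of
   the Lebesgue measures on R and on R^n under (x, t) |-> x :: t.  It lives on
   n-tuples, which the library equips with the product sigma-algebra, whereas
   the differential calculus below uses row vectors; [rvec] goes from the former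
   to the latter. *)
Section lebesgue_measure_step.
Variables (R : realType) (n : nat).
Local Notation T := (measurableTypeR R).

Definition tcons (p : T * n.-tuple T) : n.+1.-tuple T := [tuple of p.1 :: p.2].

Lemma measurable_tcons : measurable_fun [set: T * n.-tuple T] tcons.
Proof. by apply: measurable_cons; [exact: measurable_fst|exact: measurable_snd]. Qed.

Variable m : {sigma_finite_measure set (n.-tuple T) -> \bar R}.

Definition lebesgue_step : set (n.+1.-tuple T) -> \bar R :=
  pushforward (lebesgue_measure \x m)%E tcons.

Let step0 : lebesgue_step set0 = 0%E.
Proof. by rewrite /lebesgue_step /pushforward preimage_set0 measure0. Qed.

Let step_ge0 A : (0 <= lebesgue_step A)%E.
Proof. by rewrite /lebesgue_step /pushforward; exact: measure_ge0. Qed.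

Let step_sigma_additive : semi_sigma_additive lebesgue_step.
Proof.
move=> F mF tF mUF; rewrite /lebesgue_step /pushforward preimage_bigcup.
apply: measure_semi_sigma_additive.
- by move=> k; rewrite -[X in measurable X]setTI; exact: measurable_tcons.
- apply/trivIsetP => /= i j _ _ ij; rewrite -preimage_setI.
  by move/trivIsetP : tF => /(_ _ _ _ _ ij) ->//; rewrite preimage_set0.
- rewrite -preimage_bigcup -[X in measurable X]setTI.
  exact: measurable_tcons.
Qed.

HB.instance Definition _ := isMeasure.Build _ _ _ lebesgue_step
  step0 step_ge0 step_sigma_additive.

Let step_sigma_finite : sigma_finite setT lebesgue_step.
Proof.
have [F FT Foo] : sigma_finite setT (lebesgue_measure \x m)%E.
  have /sigma_finiteP[F [TF ndF Foo]] := sigma_finiteT (@lebesgue_measure R).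
  have /sigma_finiteP[G [TG ndG Goo]] := sigma_finiteT m.
  exists (fun k => F k `*` G k).
    rewrite -setXTT TF TG predeqE => -[x y]; split.
      move=> [/= [i _ Fix] [k _ Gky]]; exists (maxn i k) => //; split.
      - by move: x Fix; exact/subsetPset/ndF/leq_maxl.
      - by move: y Gky; exact/subsetPset/ndG/leq_maxr.
    by move=> [k _ []/= ? ?]; split; exists k.
  move=> k; have [? ?] := Foo k; have [? ?] := Goo k.
  split; first exact: measurableX.
  by rewrite product_measure1E// lte_mul_pinfty// ge0_fin_numE.
pose uncons (t : n.+1.-tuple T) : T * n.-tuple T :=
  (tnth t ord0, [tuple of behead t]).
have munc : measurable_fun setT uncons.
  apply/measurable_fun_pairP; split; first exact: measurable_tnth.
  exact: measurable_behead.
have unK : cancel tcons uncons.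
  by move=> [x t]; rewrite /uncons/=; congr pair; apply/val_inj.
exists (fun k => uncons @^-1` F k).
  by rewrite -preimage_bigcup -FT preimage_setT.
move=> k; have [mF Fk] := Foo k; split.
  by rewrite -[X in measurable X]setTI; exact: munc.
rewrite /lebesgue_step /pushforward -comp_preimage (_ : uncons \o tcons = id)//.
by apply/funext.
Qed.

HB.instance Definition _ := Measure_isSigmaFinite.Build _ _ _ lebesgue_step
  step_sigma_finite.

End lebesgue_measure_step.

Fixpoint lebesgue_measure_tuple (R : realType) (n : nat) :
    {sigma_finite_measure set (n.-tuple (measurableTypeR R)) -> \bar R} :=
  match n with
  | 0 => \d_([tuple] : 0.-tuple (measurableTypeR R))
  | n'.+1 => lebesgue_step (lebesgue_measure_tuple R n')
  end.

Lemma lebesgue_measure_tuple_box (R : realType) (n : nat)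
    (A : 'I_n -> set (measurableTypeR R)) : (forall i, measurable (A i)) ->
  lebesgue_measure_tuple R n [set t | forall i, A i (tnth t i)] =
  (\prod_(i < n) lebesgue_measure (A i))%E.
Proof.
elim: n A => [|n IHn] A mA.
  rewrite big_ord0 /= diracE (_ : [set _ | _] = setT) ?in_setT//.
  by apply/seteqP; split => // t _ [].
have mbox : measurable [set t : n.-tuple (measurableTypeR R) |
    forall i, A (lift ord0 i) (tnth t i)].
  rewrite (_ : [set _ | _] = \bigcap_(i in [set: 'I_n])
      ((fun t : n.-tuple (measurableTypeR R) => tnth t i) @^-1` A (lift ord0 i))).
    apply: fin_bigcap_measurable; first exact: finite_finset.
    by move=> i _; rewrite -[X in measurable X]setTI; exact: measurable_tnth.
  by apply/seteqP; split => t /=; [move=> h i _; exact: h|move=> h i; exact: h].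
rewrite big_ord_recl -(IHn (fun i => A (lift ord0 i)))//.
rewrite -product_measure1E//= /lebesgue_step /pushforward; congr (_ _).
apply/seteqP; split => -[x t] /=.
  by move=> h; split; [exact: (h ord0)|move=> i; have := h (lift ord0 i); rewrite tnthS].
move=> [h0 h] i; case: (unliftP ord0 i) => [j|] ->; first by rewrite tnthS; exact: h.
exact: h0.
Qed.

Section Rn.
Variables (R : realType) (n : nat).
Implicit Types (x y e : 'rV[R]_n) (f u v : 'rV[R]_n -> R).

Definition rvec (t : n.-tuple R) : 'rV[R]_n := \row_i tnth t i.

(* The Euclidean norm; the library's `|x| on 'rV[R]_n is the sup norm. *)
Definition enorm x : R := Num.sqrt (\sum_i (x 0 i) ^+ 2).

Definition basis (i : 'I_n) : 'rV[R]_n := delta_mx 0 i.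

Definition grad f x : 'rV[R]_n := \row_i 'D_(basis i) f x.

(* ||f||_{C^{1,1}(R^n)} = sup |f| + sup |grad f| + [grad f]_{Lip}.
   The pairs x = y contribute 0 to the last supremum since 0^-1 = 0. *)
Definition C11_norm f : \bar R :=
  (ereal_sup (range (fun x => (`|f x|)%:E))
   + ereal_sup (range (fun x => (enorm (grad f x))%:E))
   + ereal_sup (range (fun xy : 'rV[R]_n * 'rV[R]_n =>
       (enorm (grad f xy.1 - grad f xy.2) / enorm (xy.1 - xy.2))%:E)))%E.

Definition C11 f : Prop :=
  (forall x, differentiable f x) /\ (C11_norm f < +oo)%E.

Definition holder_loc (beta : R) f : Prop :=
  forall r : R, exists C : R, forall x y, enorm x <= r -> enorm y <= r ->
    `|f x - f y| <= C * enorm (x - y) `^ beta.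

Fixpoint Ck_holder_loc (k : nat) (beta : R) f : Prop :=
  match k with
  | 0 => holder_loc beta f
  | k'.+1 => (forall x, differentiable f x) /\
      forall i : 'I_n, Ck_holder_loc k' beta (fun x => 'D_(basis i) f x)
  end.

(* C^alpha_loc for alpha > 0, with C^{k+beta} = C^{k,beta} and 0 < beta <= 1; so
   for an integer alpha this is C^{alpha-1,1}_loc, which contains C^alpha. *)
Definition C_loc (alpha : R) f : Prop :=
  exists (k : nat) (beta : R),
    [/\ 0 < beta, beta <= 1, alpha = k%:R + beta & Ck_holder_loc k beta f].

Definition Linfty f : Prop :=
  (f \o rvec : n.-tuple (measurableTypeR R) -> R)
    \in Lfun (lebesgue_measure_tuple R n) +oo%E.

(* The kernels of the operators of the class L_s(lambda, Lambda; 1).  The bounds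
   force K to be finite away from 0, where its gradient makes sense. *)
Definition kernel_class (s lambda Lambda : R) (K : 'rV[R]_n -> \bar R) : Prop :=
  [/\ forall y, (0 <= K y)%E,
      forall y, K (- y) = K y,
      forall y, y != 0 ->
        ((lambda * enorm y `^ (- n%:R - 2 * s))%:E <= K y)%E /\
        (K y <= (Lambda * enorm y `^ (- n%:R - 2 * s))%:E)%E &
      forall y, y != 0 -> differentiable (fine \o K) y /\
        enorm (grad (fine \o K) y) <= Lambda * (enorm y)^-1 * fine (K y)].

Definition annulus x (r : R) : set (n.-tuple (measurableTypeR R)) :=
  [set t | r < enorm (x - rvec t) < r^-1].

(* L u(x) = p.v. int (u(x) - u(y)) K(x - y) dy, with values in [-oo, +oo].
   The principal value is the limit as r -> 0+ of the integrals over
   r < |x - y| < 1/r.  The truncation near 0 is the usual one.  Truncating at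
   infinity changes nothing when the integrand is integrable there, and makes
   sense of L(d_e v) for v merely bounded: d_e v may then grow at infinity, and
   its integral against K converges only conditionally.  For nonnegative
   u with infinite mass against K at infinity the value is -oo. *)
Definition nonlocal (K : 'rV[R]_n -> \bar R) u x : \bar R :=
  lim ((\int[lebesgue_measure_tuple R n]_(t in annulus x r)
         ((u x - u (rvec t))%:E * K (x - rvec t)%R))%E @[r --> (0 : R)^'+]).

Definition pos_part f x : R := Num.max (f x) 0.

End Rn.

(* Main.v *)
(** Fix [x] and put [a = (d_e v)_+ x], [r = c * eta x]. With [y = x - z], the integrand
    defining the left-hand side minus the one of the right-hand side is
      - eta(x)^2 a^2 - eta(y)^2 (d_e v(y))_+^2 + 2 eta(x)^2 a d_e v(y) - sigma (v(y) - v(x))^2,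
    and its principal value against [K] has to be nonpositive. For [|z| <= 2 r],
    maximizing in [(d_e v(y))_+] bounds the first three terms by an odd linear term plus
    [C a^2 |z|^2], whose integral, of order [a^2 r^(2 - 2 s)], is absorbed for small [c]
    by that of [eta(x)^2 a^2] over [|z| > 2 r], of order [eta(x)^2 a^2 r^(- 2 s)].
    For [|z| > r] the dangerous term [2 eta(x)^2 a d_e v(y)] is, up to a cutoff [psi], a
    derivative in [z] of [v(x - z) - v(x)]; it is integrated by parts against [psi K],
    and as [|grad (psi K)| <= C psi^(1/2) K / |z|], AM-GM splits it into
    [eta(x)^2 a^2 psi K / 2] and [C eta(x)^2 (v(y) - v(x))^2 K / |z|^2]. On the support of
    [psi] the latter is at most [C c^-2 (v(y) - v(x))^2 K], in which [eta(x)] no longer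
    occurs: this is absorbed by [sigma]. *)

(* The obstacle is convergence. [d_e v] may grow, so [L (d_e v)] converges only conditionally, while
   [(d_e v)_+^2] may fail to be integrable against [K] at infinity, which makes the left-hand side
   [-oo]. Hence no principal value is split at the level of limits: all estimates are made on the
   annuli [t < |z| < 1/t], where every integrand is continuous and bounded, and [t -> 0] comes last.
   The difference of the two integrands is written as a part with a real limit minus a nonnegative
   part, whose truncated integrals increase to a limit in [[0, +oo]]. So the difference has a limit
   below [+oo], and this limit is nonpositive because the truncated integrals are at most a boundary
   term on the sphere [|z| = 1/t], of order [t^(2 s + 1)]. Odd terms vanish exactly on every
   annulus, before any limit. The smallness of [c] depends on [Lambda / lambda], since the upper
   bound of [K] near 0 is played against its lower bound further out. The gradient bound of [K]
   enters only through the integration by parts, hence only in [sigma]. *)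
Require Import Defs.
From HB Require Import structures.
From mathcomp Require Import all_boot all_order all_algebra.
From mathcomp Require Import all_classical all_reals all_analysis.
From mathcomp Require Import measurable_realfun.
From mathcomp Require Import ring lra.
Set Implicit Arguments.
Unset Strict Implicit.
Unset Printing Implicit Defensive.
Import Order.TTheory GRing.Theory Num.Theory.
Import numFieldNormedType.Exports.
Local Open Scope classical_set_scope.
Local Open Scope ring_scope.

(** * Lebesgue measure on tuples: reflections and slices *)

Section reflection.
Variable R : realType.
Local Notation T := (measurableTypeR R).
Local Notation mu := (@lebesgue_measure R).
Local Notation pushm :=
  measure_function_pushforward__canonical__measure_function_Measure.

Definition reflect (c : R) (t : T) : T := c - t.

Lemma measurable_reflect c : measurable_fun [set: T] (reflect c).
Proof. by apply: measurable_funB => //; exact: measurable_id. Qed.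

Lemma lebesgue_measure_reflect (c : R) (A : set T) : measurable A ->
  mu (reflect c @^-1` A) = mu A.
Proof.
move=> mA; apply/esym.
apply: (@lebesgue_measure_unique R (pushm mu (measurable_reflect c))) => //=.
move=> _ [[a b]] _ <-; rewrite /pushforward/=.
have -> : reflect c @^-1` [set` `]a, b]%R] = `[c - b, c - a[%classic.
  by apply/seteqP; split => t /=; rewrite /reflect !in_itv/= => /andP[? ?];
    apply/andP; split; lra.
rewrite !lebesgue_measure_itv/= !lte_fin.
have -> : (c - b < c - a) = (a < b) by apply/idP/idP => ?; lra.
by case: ifP => // _; rewrite -EFinD; congr (_%:E); ring.
Qed.

Definition treflect n (c t : n.-tuple T) : n.-tuple T :=
  [tuple tnth c i - tnth t i | i < n].

Lemma measurable_treflect n (c : n.-tuple T) :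
  measurable_fun [set: n.-tuple T] (treflect c).
Proof.
apply/measurable_fun_tnthP => i.
have -> : (@tnth n T)^~ i \o treflect c = reflect (tnth c i) \o (@tnth n T ^~ i).
  by apply/funext => t /=; rewrite tnth_mktuple.
by apply: measurableT_comp; [exact: measurable_reflect|exact: measurable_tnth].
Qed.

Lemma treflect_cons n (c0 : T) (c : n.-tuple T) p :
  treflect (tcons (c0, c)) (tcons p) = tcons (reflect c0 p.1, treflect c p.2).
Proof.
apply/eq_from_tnth => i; rewrite tnth_mktuple.
by case: (unliftP ord0 i) => [j|] ->; rewrite ?tnthS ?tnth0 ?tnth_mktuple.
Qed.

Lemma tcons_eta n (t : n.+1.-tuple T) : t = tcons (thead t, [tuple of behead t]).
Proof. by rewrite {1}(tuple_eta t). Qed.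

(** By induction on the dimension: the reflection splits along [tcons], and a measure with the right
    values on rectangles is the product measure. *)
Lemma lebesgue_measure_treflect n (c : n.-tuple T) (A : set (n.-tuple T)) :
  measurable A ->
  lebesgue_measure_tuple R n (treflect c @^-1` A) = lebesgue_measure_tuple R n A.
Proof.
elim: n c A => [c A mA|n IH c A mA].
  congr (_ _); apply/seteqP; split => t /=; by rewrite (tuple0 t) (tuple0 (treflect _ _)).
rewrite (tcons_eta c) /= /lebesgue_step /pushforward.
set c0 := thead c; set c' := [tuple of behead c].
pose h (p : T * n.-tuple T) : T * n.-tuple T := (reflect c0 p.1, treflect c' p.2).
have mh : measurable_fun setT h.
  apply: measurable_fun_pair.
    by apply: measurableT_comp; [exact: measurable_reflect|exact: measurable_fst].
  by apply: measurableT_comp; [exact: measurable_treflect|exact: measurable_snd].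
have -> : @tcons R n @^-1` (treflect (tcons (c0, c')) @^-1` A) = h @^-1` (@tcons R n @^-1` A).
  by apply/seteqP; split => p /=; rewrite treflect_cons.
have -> : (lebesgue_measure \x lebesgue_measure_tuple R n)%E (h @^-1` (@tcons R n @^-1` A)) =
    pushm (lebesgue_measure \x lebesgue_measure_tuple R n)%E mh (@tcons R n @^-1` A) by [].
apply/esym/product_measure_unique; last first.
  by rewrite -[X in measurable X]setTI; exact: measurable_tcons.
move=> X Y mX mY /=; rewrite /pushforward.
have -> : h @^-1` (X `*` Y) = (reflect c0 @^-1` X) `*` (treflect c' @^-1` Y) by [].
rewrite product_measure1E//=.
- by rewrite lebesgue_measure_reflect// IH.
- by rewrite -[X in measurable X]setTI; exact: measurable_reflect.
- by rewrite -[X in measurable X]setTI; exact: measurable_treflect.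
Qed.

(** Serves twice: with center [x] it moves the principal value to the origin, with center 0 it makes
    odd integrands vanish. *)
Lemma integral_treflect n (c : n.-tuple T) (D : set (n.-tuple T))
    (f : n.-tuple T -> \bar R) : measurable D ->
  (lebesgue_measure_tuple R n).-integrable D f ->
  (lebesgue_measure_tuple R n).-integrable (treflect c @^-1` D) (f \o treflect c) ->
  (\int[lebesgue_measure_tuple R n]_(t in D) f t =
   \int[lebesgue_measure_tuple R n]_(t in treflect c @^-1` D) f (treflect c t))%E.
Proof.
move=> mD if1 if2; have mr := @measurable_treflect n c.
have mrD : measurable (treflect c @^-1` D).
  by rewrite -[X in measurable X]setTI; exact: mr.
rewrite integral_mkcond [RHS]integral_mkcond.
transitivity (\int[pushm (lebesgue_measure_tuple R n) mr]_t (f \_ D) t)%E.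
  apply: eq_measure_integral => A mA _.
  by have := lebesgue_measure_treflect c mA; rewrite /= /pushforward.
have E : (f \_ D) \o treflect c = (f \o treflect c) \_ (treflect c @^-1` D).
  by apply/funext => t; rewrite /= !patchE.
rewrite integral_pushforward//= ?preimage_setT ?E//.
  have mf := measurable_int _ if1.
  have X := measurable_restrictT f mD.
  by move/X: mf.
by move/(integrable_mkcond _ mrD).1: if2.
Qed.

End reflection.

Section slices.
Variable R : realType.
Local Notation T := (measurableTypeR R).
Local Notation leb := (@lebesgue_measure R).

Definition tupd n (t : n.-tuple T) (i : 'I_n) (r : T) : n.-tuple T :=
  [tuple if j == i then r else tnth t j | j < n].

Lemma tupd_cons0 n (p : T * n.-tuple T) r : tupd (tcons p) ord0 r = tcons (r, p.2).
Proof.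
apply/eq_from_tnth => i; rewrite tnth_mktuple.
by case: (unliftP ord0 i) => [j|] ->; rewrite ?tnthS ?tnth0.
Qed.

Lemma tupd_consS n (p : T * n.-tuple T) i r :
  tupd (tcons p) (lift ord0 i) r = tcons (p.1, tupd p.2 i r).
Proof.
apply/eq_from_tnth => k; rewrite tnth_mktuple.
by case: (unliftP ord0 k) => [j|] ->; rewrite ?tnthS ?tnth0 ?tnth_mktuple.
Qed.

Definition cube (n : nat) (r : R) : set (n.-tuple T) := [set t | forall i, `|tnth t i| < r].
Arguments cube : clear implicits.

Lemma cubeE n (r : R) :
  cube n r = [set t | forall i, (`]-r, r[%classic : set T) (tnth t i)].
Proof. by apply/seteqP; split => t /= h i; have := h i; rewrite in_itv/= ltr_norml. Qed.

Lemma measurable_cube n r : measurable (cube n r).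
Proof.
rewrite cubeE (_ : [set _ | _] = \bigcap_(i in [set: 'I_n])
      ((fun t : n.-tuple T => tnth t i) @^-1` `]-r, r[%classic)).
  apply: fin_bigcap_measurable; first exact: finite_finset.
  by move=> i _; rewrite -[X in measurable X]setTI; exact: measurable_tnth.
by apply/seteqP; split => t /=; [move=> h i _; exact: h|move=> h i; exact: h].
Qed.

Lemma lebesgue_measure_cube n (r : R) : 0 <= r ->
  lebesgue_measure_tuple R n (cube n r) = ((2 * r) ^+ n)%:E.
Proof.
move=> r0; rewrite cubeE (lebesgue_measure_tuple_box (A := fun=> `]-r, r[%classic))//.
rewrite (eq_bigr (fun=> (2 * r)%:E)) => [|i _]; last first.
  rewrite lebesgue_measure_itv/= lte_fin; case: ifPn => [_|].
    by rewrite -EFinD; congr (_%:E); ring.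
  by rewrite -leNgt => h; congr (_%:E); lra.
by elim: n => [|n IH]; rewrite ?big_ord0// big_ord_recl IH -EFinM exprS.
Qed.

Lemma cube_integrable n (r C : R) (g : n.-tuple T -> R) :
  measurable_fun setT g -> (forall t, `|g t| <= C) -> (forall t, ~ cube n r t -> g t = 0) ->
  (lebesgue_measure_tuple R n).-integrable setT (EFin \o g).
Proof.
move=> mg gC g0; have mc := @measurable_cube n r.
have -> : EFin \o g = (EFin \o g) \_ (cube n r).
  apply/funext => t; rewrite patchE; case: ifPn => //; rewrite notin_setE => /g0 /=.
  by move=> ->.
apply/(integrable_mkcond _ mc).1; apply: measurable_bounded_integrable => //.
- apply: (@le_lt_trans _ _ (lebesgue_measure_tuple R n (cube n `|r|))).
    apply: le_measure; rewrite ?inE//; first exact: measurable_cube.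
    by move=> t h i; apply: lt_le_trans (h i) (ler_norm _).
  by rewrite lebesgue_measure_cube// ltry.
- exact: measurable_funS mg.
- exists C; split; first exact: num_real.
  by move=> x Cx t _ /=; exact: (le_trans (gC t) (ltW Cx)).
Qed.

(** A one-sided Fubini theorem for lines in an arbitrary coordinate direction. Stated for
    nonnegativity, it survives the induction on the dimension without any rearrangement of the
    coordinates. *)
Lemma integral_slices_ge0 n (i : 'I_n) (r C : R) (g : n.-tuple T -> R) :
  measurable_fun setT g -> (forall t, `|g t| <= C) -> (forall t, ~ cube n r t -> g t = 0) ->
  (forall t, 0 <= \int[leb]_s (g (tupd t i s))%:E)%E ->
  (0 <= \int[lebesgue_measure_tuple R n]_t (g t)%:E)%E.
Proof.
elim: n i g => [[]//|n IH] i g mg gC g0 h.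
have mt := @measurable_tcons R n.
have ig := cube_integrable mg gC g0.
have mgt : measurable_fun setT (g \o @tcons R n) by apply: measurableT_comp.
have igt : (leb \x lebesgue_measure_tuple R n)%E.-integrable setT (EFin \o (g \o @tcons R n)).
  apply/integrableP; split; first exact/measurable_EFinP.
  move/integrableP: ig => [_]; apply: le_lt_trans.
  have := @ge0_integral_pushforward _ _ _ _ R _ mt (leb \x lebesgue_measure_tuple R n)%E setT
    (fun t => `|(g t)%:E|)%E measurableT.
  rewrite preimage_setT => <- //.
    by apply: measurableT_comp => //; exact/measurable_EFinP.
have -> : (\int[lebesgue_measure_tuple R n.+1]_t (g t)%:E =
    \int[leb \x lebesgue_measure_tuple R n]_p (g (tcons p))%:E)%E.
  have := @integral_pushforward _ _ _ _ R _ mt (leb \x lebesgue_measure_tuple R n)%E setT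
    (EFin \o g).
  by rewrite preimage_setT => -> //; exact/measurable_EFinP.
(* If [i] is not the first coordinate, the first one is frozen and the induction hypothesis applies
   to the others; otherwise the first coordinate is the inner variable of integration. *)
case: (unliftP ord0 i) h => [j|] -> h.
  rewrite -(integral12_prod_meas1 igt); apply: integral_ge0 => s _ /=.
  rewrite /fubini_F/=; apply: (IH j (fun t => g (tcons (s, t)))).
  - apply: (measurableT_comp mgt (g := pair s)).
    exact: pair1_measurable.
  - by move=> t; exact: gC.
  - move=> t nt; apply: g0 => k; apply: nt => m; by have := k (lift ord0 m); rewrite tnthS.
  - move=> t; have := h (tcons (s, t)).
    by under eq_integral do rewrite tupd_consS.
rewrite -(integral21_prod_meas1 igt); apply: integral_ge0 => t _ /=.
rewrite /fubini_G/=; have := h (tcons (0, t)).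
by under eq_integral do rewrite tupd_cons0.
Qed.

End slices.
Arguments cube : clear implicits.

(** * The Euclidean norm and Borel measurability *)

Section euclid.
Variables (R : realType) (n : nat).
Implicit Types (x y z p : 'rV[R]_n).

Definition dot x y : R := \sum_i x 0 i * y 0 i.

Lemma enorm_ge0 x : 0 <= enorm x.
Proof. exact: sqrtr_ge0. Qed.

Lemma enorm_sqr x : enorm x ^+ 2 = \sum_i x 0 i ^+ 2.
Proof. by rewrite sqr_sqrtr// sumr_ge0// => i _; exact: sqr_ge0. Qed.

Lemma enormN x : enorm (- x) = enorm x.
Proof. by rewrite /enorm; under eq_bigr do rewrite mxE sqrrN. Qed.

Lemma enormZ (a : R) x : enorm (a *: x) = `|a| * enorm x.
Proof.
rewrite /enorm; under eq_bigr do rewrite mxE exprMn.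
by rewrite -mulr_sumr sqrtrM ?sqr_ge0// sqrtr_sqr.
Qed.

Lemma enorm0 : enorm (0 : 'rV[R]_n) = 0.
Proof. by rewrite -(scale0r 0) enormZ normr0 mul0r. Qed.

Lemma coord_le_enorm x i : `|x 0 i| <= enorm x.
Proof.
rewrite -sqrtr_sqr ler_sqrt ?sumr_ge0// => [|j _]; last exact: sqr_ge0.
by rewrite (bigD1 i)//= lerDl sumr_ge0// => j _; exact: sqr_ge0.
Qed.

Lemma enorm_eq0 x : enorm x = 0 -> x = 0.
Proof.
move=> x0; apply/rowP => i; rewrite mxE; apply/eqP; rewrite -normr_le0 -x0.
exact: coord_le_enorm.
Qed.

Lemma enorm_gt0 x : (0 < enorm x) = (x != 0).
Proof.
rewrite lt_neqAle enorm_ge0 andbT eq_sym; congr negb.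
by apply/eqP/eqP => [/enorm_eq0//|->]; exact: enorm0.
Qed.

Lemma enorm_le_coord x (r : R) : (forall i, `|x 0 i| <= r) -> 0 <= r ->
  enorm x <= n%:R * r.
Proof.
move=> h r0; rewrite -(ger0_norm (_ : 0 <= n%:R * r)) ?mulr_ge0//.
rewrite -sqrtr_sqr ler_sqrt ?sqr_ge0// exprMn.
apply: (@le_trans _ _ (\sum_(i < n) r ^+ 2)).
  apply: ler_sum => i _; rewrite -(real_normK (num_real (x 0 i))).
  by rewrite lerXn2r ?nnegrE.
rewrite sumr_const card_ord -[leLHS]mulr_natl ler_wpM2r ?sqr_ge0//.
by rewrite -natrX ler_nat; case: n => // m; rewrite leq_pmulr.
Qed.

(** AM-GM on each product, with the weights [b / a] and [a / b] that make the sum equal to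
    [a * b]. *)
Lemma cauchy_schwarz x y : `|dot x y| <= enorm x * enorm y.
Proof.
have [->|x0] := eqVneq x 0.
  by rewrite /dot big1 ?normr0 ?enorm0 ?mul0r// => i _; rewrite mxE mul0r.
have [->|y0] := eqVneq y 0.
  by rewrite /dot big1 ?normr0 ?enorm0 ?mulr0// => i _; rewrite mxE mulr0.
have a0 : 0 < enorm x by rewrite enorm_gt0.
have b0 : 0 < enorm y by rewrite enorm_gt0.
set a := enorm x in a0 *; set b := enorm y in b0 *.
apply: (le_trans (ler_norm_sum _ _ _)).
have -> : a * b = \sum_i (2^-1 * (b / a) * x 0 i ^+ 2 + 2^-1 * (a / b) * y 0 i ^+ 2).
  by rewrite big_split/= -!mulr_sumr -!enorm_sqr -/a -/b; field; lra.
apply: ler_sum => i _; rewrite normrM.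
rewrite -(real_normK (num_real (x 0 i))) -(real_normK (num_real (y 0 i))).
set u := `|x 0 i|; set v := `|y 0 i|.
rewrite -subr_ge0.
have -> : 2^-1 * (b / a) * u ^+ 2 + 2^-1 * (a / b) * v ^+ 2 - u * v =
   (b * u - a * v) ^+ 2 / (2 * (a * b)) by field; lra.
by rewrite divr_ge0 ?sqr_ge0// mulr_ge0// mulr_ge0 ?ltW.
Qed.

Lemma enormD x y : enorm (x + y) <= enorm x + enorm y.
Proof.
have h : 0 <= enorm x + enorm y by rewrite addr_ge0 ?enorm_ge0.
rewrite -(@ler_pXn2r _ 2)// ?nnegrE ?enorm_ge0//.
rewrite enorm_sqr; under eq_bigr do rewrite mxE sqrrD.
rewrite !big_split/= sqrrD -!enorm_sqr lerD2r lerD2l.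
rewrite -/(dot x y) -mulr2n lerMn2r/=.
exact: le_trans (ler_norm _) (cauchy_schwarz _ _).
Qed.

Lemma sumr_continuous (f : 'I_n -> 'rV[R]_n -> R) x :
  (forall i, {for x, continuous (f i)}) -> {for x, continuous (fun z => \sum_i f i z)}.
Proof.
move=> cf; rewrite /continuous_at.
refine (@cvg_big R 'I_n +%R 0 xpredT _ _ (nbhs x) _ f (fun i => f i x) (nbhs_filter x) _).
  exact: add_continuous.
by move=> i _; exact: cf.
Qed.

Lemma enorm_continuous : continuous (@enorm R n).
Proof.
move=> x; apply: (@continuous_comp _ _ _ (fun z => \sum_i z 0 i ^+ 2) Num.sqrt).
  apply: sumr_continuous => i; apply: (@continuous_comp _ _ _ (fun z => z 0 i) (fun t => t ^+ 2)).
    exact: coord_continuous.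
  exact: exprn_continuous.
exact: sqrt_continuous.
Qed.

Lemma dot_continuous p : continuous (dot p).
Proof.
move=> x; apply: sumr_continuous => i; apply: continuousM; [exact: cst_continuous|exact: coord_continuous].
Qed.

Lemma norm_le_enorm x : `|x| <= enorm x.
Proof.
rewrite [leLHS]/Num.norm/= mx_normrE; apply: bigmax_le; first exact: enorm_ge0.
by move=> [i j] _ /=; rewrite ord1; exact: coord_le_enorm.
Qed.

Lemma coord_le_norm x i : `|x 0 i| <= `|x|.
Proof.
rewrite [leRHS]/Num.norm/= mx_normrE.
by apply/bigmax_geP; right => /=; exists (0, i).
Qed.

Lemma enorm_le_norm x : enorm x <= n%:R * `|x|.
Proof. by apply: enorm_le_coord => // i; exact: coord_le_norm. Qed.

End euclid.

Section borel.
Variables (R : realType) (n : nat).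
Local Notation T := (measurableTypeR R).

(** An open set is the union of the boxes with rational center and radius [1 / (k + 1)] that it
    contains. Replacing the other boxes by [set0] keeps the index type countable. *)
Lemma open_measurable_rvec (U : set 'rV[R]_n) : open U ->
  measurable ((@rvec R n : n.-tuple T -> _) @^-1` U).
Proof.
move=> oU.
pose B (qk : 'rV[rat]_n * nat) : set (n.-tuple T) :=
  [set t | forall i, (ball (ratr (qk.1 0 i) : R) (qk.2.+1%:R^-1)) (tnth t i)].
have mB qk : measurable (B qk).
  rewrite (_ : B qk = \bigcap_(i in [set: 'I_n])
      ((fun t : n.-tuple T => tnth t i) @^-1` (ball (ratr (qk.1 0 i) : R) (qk.2.+1%:R^-1)))).
    apply: fin_bigcap_measurable; first exact: finite_finset.
    move=> i _; rewrite -[X in measurable X]setTI; apply: measurable_tnth => //.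
    exact: measurable_ball.
  by apply/seteqP; split => t /=; [move=> h i _; exact: h|move=> h i; exact: h].
pose F qk := if `[< B qk `<=` @rvec R n @^-1` U >] then B qk else set0.
have -> : @rvec R n @^-1` U = \bigcup_qk F qk.
  apply/seteqP; split => [t /= Ut|t [qk _]]; last first.
    by rewrite /F; case: asboolP => // + Bt; exact.
  have /nbhs_ballP[e /= e0 he] : nbhs (rvec t) U by exact: open_nbhs_nbhs.
  (* Half of [e], because the box is centered at a rational point near [t] and not at [t]. *)
  have [k /= hk] : exists k, k.+1%:R^-1 < e / 2.
    have e20 : 0 < e / 2 by rewrite divr_gt0.
    have [N _ hN] := near_infty_natSinv_lt (PosNum e20).
    by exists N; exact: (hN N (leqnn N)).
  have hq i : exists q : rat, ratr q \in `](tnth t i - k.+1%:R^-1), (tnth t i + k.+1%:R^-1)[.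
    have : tnth t i - k.+1%:R^-1 < tnth t i + k.+1%:R^-1.
      by rewrite ltrBlDr -addrA ltrDl addr_gt0// invr_gt0.
    by move/rat_in_itvoo => [q hq]; exists q.
  have [q hq'] := boolp.choice hq.
  exists (\row_i q i, k) => //; rewrite /F; case: asboolP => [_|]; last first.
    case=> t' /= Bt'; apply: he; split => // i j; rewrite ord1.
    rewrite !mxE /ball/=; have := Bt' j; rewrite /ball/= mxE.
    have := hq' j; rewrite in_itv/= => /andP[h1 h2].
    move: (ratr _ : R) (_^-1 : R) h1 h2 hk => a b h1 h2 hk.
    rewrite !ltr_norml => /andP[h3 h4]; apply/andP; split; lra.
  move=> i /=; rewrite mxE /ball/=.
  have := hq' i; rewrite in_itv/= ltr_norml => /andP[].
  move: (ratr _ : R) (_^-1 : R) => a b h1 h2; apply/andP; split; lra.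
apply: countable_bigcupT_measurable; first exact: countableP.
by move=> qk; rewrite /F; case: asboolP.
Qed.

Lemma measurable_rvec_comp (U : set 'rV[R]_n) (D : set (n.-tuple T)) (f : 'rV[R]_n -> R) :
  open U -> (forall z, U z -> {for z, continuous f}) ->
  measurable D -> (forall t, D t -> U (rvec t)) ->
  measurable_fun D (f \o @rvec R n : n.-tuple T -> T).
Proof.
move=> oU cf mD DU; apply: (measurability _ (RGenOpens.measurableE R)).
move=> _ [_ [a [b ->] <-]].
have -> : D `&` ((f \o @rvec R n) @^-1` `]a, b[) =
          D `&` (@rvec R n @^-1` (U `&` f @^-1` `]a, b[)).
  by apply/seteqP; split => t /= [Dt h]; split => //; [split=> //; exact: DU|exact: h.2].
apply: measurableI => //; apply: open_measurable_rvec.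
rewrite openE => z [Uz fz]; rewrite /interior; apply: filterI.
  by move: oU; rewrite openE; exact.
apply: (cf z Uz); apply: open_nbhs_nbhs; split => //; exact: interval_open.
Qed.

End borel.

(** * Truncated integrals *)

Section truncated.
Variables (R : realType) (n : nat).
Local Notation T := (measurableTypeR R).
Local Notation V := 'rV[R]_n.
Local Notation mu := (lebesgue_measure_tuple R n).
Implicit Types (f g : V -> R).

(** The kernel is singular only at 0, which shells and truncations avoid; this regularity therefore
    gives integrability on all of them. *)
Definition continuous_off0 f := forall z, z != 0 -> {for z, continuous f}.

Definition radial (P : set R) : set (n.-tuple T) := [set t | P (enorm (rvec t))].

(** Half-open, so that consecutive shells are disjoint and their integrals add up. *)
Definition shell (a b : R) : set (n.-tuple T) := radial `[a, b[.

Definition core (r : R) : set (n.-tuple T) := radial `]r, r^-1[.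

Definition integ (D : set (n.-tuple T)) f : R := \int[mu]_(t in D) f (rvec t).

(* The truncation of the principal value in [nonlocal], centered at the origin. *)
Definition tint f (r : R) : R := integ (core r) f.

Lemma continuous_off0_cont f : continuous f -> continuous_off0 f.
Proof. by move=> cf z _; exact: cf. Qed.

Lemma continuous_off0D f g : continuous_off0 f -> continuous_off0 g ->
  continuous_off0 (fun z => f z + g z).
Proof. by move=> cf cg z z0; apply: continuousD; [exact: cf|exact: cg]. Qed.

Lemma continuous_off0N f : continuous_off0 f -> continuous_off0 (fun z => - f z).
Proof. by move=> cf z z0; apply: continuousN; exact: cf. Qed.

Lemma continuous_off0M f g : continuous_off0 f -> continuous_off0 g ->
  continuous_off0 (fun z => f z * g z).
Proof. by move=> cf cg z z0; apply: continuousM; [exact: cf|exact: cg]. Qed.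

Lemma continuous_off0_cst (c : R) : continuous_off0 (fun=> c).
Proof. by move=> z z0; exact: cst_continuous. Qed.

Lemma continuous_off0_norm f : continuous_off0 f -> continuous_off0 (fun z => `|f z|).
Proof.
move=> cf z z0; apply: (@continuous_comp _ _ _ f (fun x => `|x|)); first exact: cf.
exact: norm_continuous.
Qed.

Lemma measurable_radial (P : set T) : measurable P -> measurable (radial P).
Proof.
move=> mP; rewrite -[radial P]setTI.
have := @measurable_rvec_comp R n setT setT (@enorm R n) openT.
by apply => // z _; exact: enorm_continuous.
Qed.

Lemma measurable_shell (a b : R) : measurable (shell a b).
Proof. by apply: measurable_radial; exact: measurable_itv. Qed.

Lemma measurable_core (r : R) : measurable (core r).
Proof. by apply: measurable_radial; exact: measurable_itv. Qed.

Lemma radial_sub_cube (P : set T) (b : R) : (forall s, P s -> s < b) -> radial P `<=` cube R n b.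
Proof.
move=> h t /h hb i; apply: le_lt_trans hb.
by have := coord_le_enorm (rvec t) i; rewrite mxE.
Qed.

Lemma continuous_off0_bounded f (a b : R) : continuous_off0 f -> 0 < a ->
  exists2 M, 0 <= M & forall z : V, a <= enorm z -> enorm z <= b -> `|f z| <= M.
Proof.
move=> cf a0; set S := [set z : V | a <= enorm z <= b].
have cS : compact S.
  apply: bounded_closed_compact.
    exists b; split; first exact: num_real.
    move=> x bx z /= /andP[_ zb]; apply: le_trans (ltW bx).
    exact: le_trans (norm_le_enorm z) zb.
  rewrite (_ : S = @enorm R n @^-1` `[a, b]).
    by apply: closed_comp; [move=> z _; exact: enorm_continuous|exact: interval_closed].
  by apply/seteqP; split => z /=; rewrite in_itv.
have cfS : {within S, continuous f}.
  apply: continuous_in_subspaceT => z; rewrite inE => /andP[az _]; apply: cf.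
  by rewrite -enorm_gt0; exact: lt_le_trans a0 az.
have [M [Mr hM]] := compact_bounded (continuous_compact cfS cS).
exists (Num.max M 0 + 1); first by rewrite addr_ge0// le_max lexx orbT.
move=> z az zb; apply: hM; last by exists z => //=; rewrite /S/= az.
by rewrite ltr_pwDr// le_max lexx.
Qed.

Lemma integrable_off0 f D (a b : R) : continuous_off0 f -> 0 < a -> measurable D ->
  (forall t, D t -> a <= enorm (rvec t) <= b) ->
  mu.-integrable D (EFin \o (f \o @rvec R n)).
Proof.
move=> cf a0 mD Dab.
have [M M0 hM] := continuous_off0_bounded b cf a0.
apply: measurable_bounded_integrable => //.
- apply: (@le_lt_trans _ _ (mu (cube R n (`|b| + 1)))).
    apply: le_measure; rewrite ?inE//; first exact: measurable_cube.
    move=> t /Dab/andP[_ tb] i; apply: le_lt_trans (_ : `|b| < _); last by rewrite ltrDl.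
    apply: le_trans (ler_norm b); apply: le_trans tb.
    by have := coord_le_enorm (rvec t) i; rewrite mxE.
  by rewrite lebesgue_measure_cube// ltry.
- apply: (@measurable_rvec_comp R n [set z | z != 0]) => //.
    have -> : [set z : V | z != 0] = @enorm R n @^-1` `]0, +oo[.
      by apply/seteqP; split => z /=; rewrite in_itv/= andbT enorm_gt0.
    by apply: open_comp; [move=> z _; exact: enorm_continuous|exact: interval_open].
  by move=> t /Dab/andP[at_ _]; rewrite /= -enorm_gt0; exact: lt_le_trans at_.
- exists M; split; first exact: num_real.
  move=> x Mx t /Dab/andP[at_ tb] /=; apply: le_trans (ltW Mx); exact: hM.
Qed.

Lemma core_bounds r t : core r t -> r <= enorm (rvec t) <= r^-1.
Proof. by rewrite /core/radial/= in_itv/= => /andP[h1 h2]; rewrite !ltW. Qed.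

Lemma shell_bounds a b t : shell a b t -> a <= enorm (rvec t) <= b.
Proof. by rewrite /shell/radial/= in_itv/= => /andP[h1 h2]; rewrite h1 ltW. Qed.

Lemma core_integrable f (r : R) : continuous_off0 f -> 0 < r ->
  mu.-integrable (core r) (EFin \o (f \o @rvec R n)).
Proof.
by move=> cf r0; apply: integrable_off0 cf r0 (measurable_core r) (@core_bounds r).
Qed.

Lemma shell_integrable f (a b : R) : continuous_off0 f -> 0 < a ->
  mu.-integrable (shell a b) (EFin \o (f \o @rvec R n)).
Proof.
by move=> cf r0; apply: integrable_off0 cf r0 (measurable_shell a b) (@shell_bounds a b).
Qed.

Lemma tintD f g (r : R) : continuous_off0 f -> continuous_off0 g -> 0 < r ->
  tint (fun z => f z + g z) r = tint f r + tint g r.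
Proof.
by move=> cf cg r0; apply: RintegralD; [exact: measurable_core|exact: core_integrable|exact: core_integrable].
Qed.

Lemma tintZ f c (r : R) : continuous_off0 f -> 0 < r ->
  tint (fun z => c * f z) r = c * tint f r.
Proof.
by move=> cf r0; apply: RintegralZl; [exact: measurable_core|exact: core_integrable].
Qed.

Lemma tintN f (r : R) : continuous_off0 f -> 0 < r ->
  tint (fun z => - f z) r = - tint f r.
Proof.
move=> cf r0; rewrite -mulN1r -tintZ//; congr (integ _ _).
by apply/funext => z; rewrite mulN1r.
Qed.

Lemma rvec_neq0 (t : n.-tuple T) (a : R) : 0 < a -> a <= enorm (rvec t) -> rvec t != 0.
Proof. by move=> a0 h; rewrite -enorm_gt0; exact: lt_le_trans h. Qed.

Lemma tint_eq f g (r : R) : (forall z, z != 0 -> f z = g z) -> 0 < r ->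
  tint f r = tint g r.
Proof.
move=> fg r0; apply: eq_Rintegral => t; rewrite inE => /core_bounds/andP[h _].
by apply: fg; exact: rvec_neq0 h.
Qed.

Lemma tint_le f g (r : R) : continuous_off0 f -> continuous_off0 g -> 0 < r ->
  (forall z, z != 0 -> f z <= g z) -> tint f r <= tint g r.
Proof.
move=> cf cg r0 fg; apply: le_Rintegral; [exact: measurable_core|exact: core_integrable|exact: core_integrable|].
by move=> t /core_bounds/andP[h _]; apply: fg; exact: rvec_neq0 h.
Qed.

Lemma tint_ge0 f (r : R) : (forall z, z != 0 -> 0 <= f z) -> 0 < r -> 0 <= tint f r.
Proof.
move=> f0 r0; apply: Rintegral_ge0 => t /core_bounds/andP[h _].
by apply: f0; exact: rvec_neq0 h.
Qed.

Lemma tint_norm f (r : R) : continuous_off0 f -> 0 < r ->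
  `|tint f r| <= tint (fun z => `|f z|) r.
Proof.
move=> cf r0; have i := core_integrable cf r0.
exact: (@le_normr_Rintegral _ _ _ mu (core r) (f \o @rvec R n) (measurable_core r) i).
Qed.

Lemma rvec_treflect (c t : n.-tuple T) : rvec (treflect c t) = rvec c - rvec t.
Proof. by apply/rowP => i; rewrite !mxE tnth_mktuple. Qed.

(** The truncated domain is symmetric, so the reflection about 0 turns the integral into its
    opposite. The value is 0 for every [r], not just in the limit. *)
Lemma tint_odd f (r : R) : continuous_off0 f -> 0 < r ->
  (forall z, f (- z) = - f z) -> tint f r = 0.
Proof.
move=> cf r0 fN.
pose c : n.-tuple T := [tuple 0 | i < n].
have c0 t : rvec (treflect c t) = - rvec t.
  by rewrite rvec_treflect; apply/rowP => i; rewrite !mxE tnth_mktuple add0r.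
have cE : treflect c @^-1` core r = core r.
  by apply/seteqP; split => t; rewrite /core/radial/= c0 enormN.
suff : tint f r = - tint f r by move=> h; lra.
rewrite -tintN// {1}/tint /integ /Rintegral (@integral_treflect R n c).
- rewrite cE; congr fine; apply: eq_integral => t _; by rewrite /= c0 fN.
- exact: measurable_core.
- exact: core_integrable.
- rewrite cE; have := core_integrable (continuous_off0N cf) r0.
  by apply: eq_integrable => //; [exact: measurable_core|move=> t _ /=; rewrite c0 fN].
Qed.

Lemma integ_shellU f (a b c : R) : continuous_off0 f -> 0 < a -> a <= b -> b <= c ->
  integ (shell a c) f = integ (shell a b) f + integ (shell b c) f.
Proof.
move=> cf a0 ab bc.
have E : shell a c = shell a b `|` shell b c.
  apply/seteqP; split => t; rewrite /shell/radial/= !in_itv/=.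
    move=> /andP[-> ->]/=; case: (ltP (enorm (rvec t)) b) => h; [by left|by right].
  by case=> /andP[h1 h2]; apply/andP; split => //; [exact: lt_le_trans bc|exact: le_trans h1].
rewrite /integ E; apply: Rintegral_setU => //; try exact: measurable_shell.
  by rewrite -E; exact: shell_integrable.
apply/disj_setPS => t [] /=; rewrite /shell/radial/= !in_itv/= => /andP[_ h1] /andP[h2 _].
by move: (lt_le_trans h1 h2); rewrite ltxx.
Qed.

Lemma integ_le f g D (a b : R) : continuous_off0 f -> continuous_off0 g -> 0 < a -> measurable D ->
  (forall t, D t -> a <= enorm (rvec t) <= b) ->
  (forall z, a <= enorm z -> enorm z <= b -> f z <= g z) ->
  integ D f <= integ D g.
Proof.
move=> cf cg a0 mD hD fg; apply: le_Rintegral => //.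
- exact: integrable_off0 hD.
- exact: integrable_off0 hD.
- by move=> t /hD/andP[h1 h2]; exact: fg.
Qed.

Lemma integ_subset f D D' (a b : R) : continuous_off0 f -> 0 < a -> measurable D -> measurable D' ->
  D `<=` D' -> (forall t, D' t -> a <= enorm (rvec t) <= b) ->
  (forall z, z != 0 -> 0 <= f z) ->
  integ D f <= integ D' f.
Proof.
move=> cf a0 mD mD' DD' hD' f0.
have h0 t : D' t -> 0 <= f (rvec t).
  by move=> /hD'/andP[h _]; apply: f0; exact: rvec_neq0 h.
have i' := integrable_off0 cf a0 mD' hD'.
have i : mu.-integrable D (EFin \o (f \o @rvec R n)) by exact: integrableS i'.
rewrite /integ /Rintegral fine_le//.
- by apply: integrable_fin_num.
- by apply: integrable_fin_num.
- apply: ge0_subset_integral => //; exact: (measurable_int _ i').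
Qed.

Lemma core_subset (r r' : R) : 0 < r -> r <= r' -> core r' `<=` core r.
Proof.
move=> r0 rr' t; rewrite /core/radial/= !in_itv/= => /andP[h1 h2].
rewrite (le_lt_trans rr' h1)/= (lt_le_trans h2)// lef_pV2 ?posrE//.
exact: lt_le_trans rr'.
Qed.

Lemma tint_mono f (r r' : R) : continuous_off0 f -> (forall z, z != 0 -> 0 <= f z) ->
  0 < r -> r <= r' -> tint f r' <= tint f r.
Proof.
move=> cf f0 r0 rr'.
apply: (@integ_subset _ _ _ r r^-1) => //; try exact: measurable_core.
  exact: core_subset.
exact: core_bounds.
Qed.

(** The domains grow as [r] decreases, so the limit is a monotone one, possibly infinite. *)
Lemma tint_ge0_cvg f : continuous_off0 f -> (forall z, z != 0 -> 0 <= f z) ->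
  exists2 L : \bar R, (0 <= L)%E & (tint f r)%:E @[r --> 0^'+] --> L.
Proof.
move=> cf f0.
have := @nonincreasing_at_right_cvge R (fun r => (tint f r)%:E) 0 (BLeft 1).
rewrite bnd_simp => /(_ ltr01) h.
exists (ereal_sup ((fun r => (tint f r)%:E) @` `]0, 1[)).
  apply: (@le_trans _ _ (tint f 2^-1)%:E).
    by rewrite lee_fin tint_ge0.
  by apply: ereal_sup_ubound; exists 2^-1 => //=; rewrite in_itv/=; apply/andP; split; lra.
apply: h => r r'; rewrite !in_itv/= => /andP[r0 _] /andP[r'0 _] rr'.
by rewrite lee_fin tint_mono.
Qed.

Lemma tint_ge0_bounded_cvg f (C : R) : continuous_off0 f ->
  (forall z, z != 0 -> 0 <= f z) -> (forall r, 0 < r -> tint f r <= C) ->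
  exists l : R, tint f r @[r --> 0^'+] --> l.
Proof.
move=> cf f0 fC; eexists.
apply: (@nonincreasing_at_right_cvgr _ _ _ (BLeft 1)); first by rewrite bnd_simp.
  move=> r r'; rewrite !in_itv/= => /andP[r0 _] /andP[r'0 _] rr'.
  exact: tint_mono.
by exists C => _ [r /= + <-]; rewrite in_itv/= => /andP[r0 _]; exact: fC.
Qed.

Lemma cvg_near0_ext (f g : R -> R) (l : R) : (forall r, 0 < r -> f r = g r) ->
  g r @[r --> 0^'+] --> l -> f r @[r --> 0^'+] --> l.
Proof.
move=> fg; apply: cvg_trans; apply: near_eq_cvg; near=> r.
by rewrite fg.
Unshelve. all: by end_near. Qed.

(** [f] is the difference of [|f| + f] and [|f|], which are nonnegative with bounded truncated
    integrals. *)
Lemma tint_abs_cvg f (C : R) : continuous_off0 f ->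
  (forall r, 0 < r -> tint (fun z => `|f z|) r <= C) ->
  exists l : R, tint f r @[r --> 0^'+] --> l.
Proof.
move=> cf fC; have cn := continuous_off0_norm cf.
have [l1 h1] : exists l : R, tint (fun z => `|f z|) r @[r --> 0^'+] --> l.
  by apply: tint_ge0_bounded_cvg fC.
have cs := continuous_off0D cn cf.
have [l2 h2] : exists l : R, tint (fun z => `|f z| + f z) r @[r --> 0^'+] --> l.
  apply: (@tint_ge0_bounded_cvg _ (C + C)) => //.
    by move=> z _; have := ler_norm (- f z); rewrite normrN; lra.
  move=> r r0; rewrite tintD// lerD ?fC//.
  by apply: le_trans (ler_norm _) _; apply: le_trans (tint_norm cf r0) _; exact: fC.
exists (l2 - l1).
apply: cvg_near0_ext (cvgB h2 h1) => r r0.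
by rewrite !fctE tintD// addrAC subrr add0r.
Qed.

End truncated.

(** * Integrals of powers of the norm *)

Section radial_powers.
Variables (R : realType) (n : nat).
Local Notation T := (measurableTypeR R).
Local Notation V := 'rV[R]_n.
Local Notation mu := (lebesgue_measure_tuple R n).
Implicit Types (a b d r : R).

(* Normalized so that the integral over a dyadic shell of radius [r] is of order [r ^ d]. *)
Definition epow d (z : V) : R := enorm z `^ (d - n%:R).

Lemma ler_powRn (x y p : R) : 0 < x -> x <= y -> p <= 0 -> y `^ p <= x `^ p.
Proof.
move=> x0 xy p0; have y0 : 0 < y by exact: lt_le_trans xy.
rewrite -(opprK p) !(powRN _ (- p)) lef_pV2 ?posrE ?powR_gt0//.
by rewrite ge0_ler_powR ?nnegrE ?oppr_ge0// ltW.
Qed.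

Lemma epow_ge0 d z : 0 <= epow d z.
Proof. exact: powR_ge0. Qed.

Lemma epow_continuous d : continuous_off0 (epow d).
Proof.
move=> z z0; apply: (@continuous_comp _ _ _ (@enorm R n) (fun x => x `^ (d - n%:R))).
  exact: enorm_continuous.
apply: differentiable_continuous; apply/derivable1_diffP.
by apply: derivable_powR; rewrite in_itv/= andbT enorm_gt0.
Qed.

Lemma epowE d z : z != 0 -> epow d z = enorm z `^ d * (enorm z ^+ n)^-1.
Proof.
move=> z0; rewrite /epow powRD ?powR_invn ?enorm_ge0//.
by apply/implyP => _; rewrite gt_eqF// enorm_gt0.
Qed.

Lemma epow_dyadic d r (z : V) : 0 < r -> r <= enorm z -> enorm z <= 2 * r ->
  epow d z <= 2 `^ `|d| * r `^ d * (r ^+ n)^-1.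
Proof.
move=> r0 rz zr; have z0 : 0 < enorm z by exact: lt_le_trans rz.
rewrite epowE -?enorm_gt0//; apply: ler_pM; rewrite ?powR_ge0 ?invr_ge0 ?exprn_ge0 ?enorm_ge0//.
  have [d0|d0] := leP 0 d.
    rewrite ger0_norm// -powRM//; last exact: ltW.
    by apply: ge0_ler_powR => //; rewrite nnegrE ?mulr_ge0// ltW.
  apply: (@le_trans _ _ (r `^ d)); first by rewrite ler_powRn// ltW.
  rewrite -[leLHS]mul1r ler_wpM2r ?powR_ge0//.
  by rewrite -[leLHS](powRr0 2) ler_powR// ler1n.
by rewrite lef_pV2 ?posrE ?exprn_gt0// lerXn2r ?nnegrE// ltW.
Qed.

Lemma shell_le_cst f (a b M : R) : continuous_off0 f -> 0 < a -> a <= b -> 0 <= M ->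
  (forall z : V, a <= enorm z -> enorm z <= b -> f z <= M) ->
  integ (shell a b) f <= M * (2 * b) ^+ n.
Proof.
move=> cf a0 ab M0 fM; have b0 : 0 < b by exact: lt_le_trans ab.
apply: (@le_trans _ _ (integ (shell a b) (fun=> M : R))).
  apply: (@integ_le _ _ _ _ _ a b) => //; first exact: continuous_off0_cst.
    exact: measurable_shell.
  by move=> t; exact: shell_bounds.
rewrite /integ Rintegral_cst; last exact: measurable_shell.
rewrite ler_wpM2l// -lee_fin -(lebesgue_measure_cube n (ltW b0)) fineK.
  apply: le_measure; rewrite ?inE; [exact: measurable_shell|exact: measurable_cube|].
  by apply: radial_sub_cube => s /=; rewrite in_itv => /andP[].
rewrite ge0_fin_numE//.
apply: (@le_lt_trans _ _ (mu (cube R n b))); last by rewrite lebesgue_measure_cube ?ltry// ltW.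
apply: le_measure; rewrite ?inE; [exact: measurable_shell|exact: measurable_cube|].
by apply: radial_sub_cube => s /=; rewrite in_itv => /andP[].
Qed.

Lemma integ_dyadic d : exists2 C : R, 0 <= C & forall r : R, 0 < r ->
  integ (shell r (2 * r)) (epow d) <= C * r `^ d.
Proof.
(* The absolute value covers both signs of [d]; [4 ^+ n] comes from the enclosing cube of side
   [4 r], whose volume cancels the factor [r ^ (- n)] of [epow]. *)
exists (2 `^ `|d| * 4 ^+ n); first by rewrite mulr_ge0 ?powR_ge0// exprn_ge0.
move=> r r0.
have M0 : 0 <= 2 `^ `|d| * r `^ d * (r ^+ n)^-1.
  by rewrite !mulr_ge0 ?powR_ge0// invr_ge0 exprn_ge0// ltW.
apply: le_trans (shell_le_cst (@epow_continuous d) r0 _ M0 _) _.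
- lra.
- by move=> z rz zr; exact: epow_dyadic.
- have -> : 2 * (2 * r) = 4 * r by ring.
  rewrite exprMn le_eqVlt; apply/orP; left; apply/eqP.
  by field; rewrite expf_neq0// gt_eqF.
Qed.

Lemma shell_sub (a b a' b' : R) : a' <= a -> b <= b' ->
  (shell a b : set (n.-tuple T)) `<=` shell a' b'.
Proof.
move=> aa bb t; rewrite /shell/radial/= !in_itv/= => /andP[h1 h2].
by rewrite (le_trans aa h1) (lt_le_trans h2 bb).
Qed.

Lemma integ_shell_sub f (a b a' b' : R) : continuous_off0 f ->
  (forall z : V, z != 0 -> 0 <= f z) -> 0 < a' -> a' <= a -> b <= b' ->
  integ (shell a b) f <= integ (shell a' b') f.
Proof.
move=> cf f0 a0 aa bb; apply: (@integ_subset _ _ _ _ _ a' b') => //; try exact: measurable_shell.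
  exact: shell_sub.
by move=> t; exact: shell_bounds.
Qed.

Lemma powR2_gt1 d : 0 < d -> 1 < 2 `^ d :> R.
Proof.
move=> d0; have := @gt0_ltr_powR R d d0 1 2.
by rewrite powR1; apply; rewrite ?nnegrE// ltr1n.
Qed.

Lemma integ_shellZ f (c a b : R) : continuous_off0 f -> 0 < a ->
  integ (shell a b) (fun z : V => c * f z) = c * integ (shell a b) f.
Proof.
by move=> cf a0; apply: RintegralZl; [exact: measurable_shell|exact: shell_integrable].
Qed.

Lemma expn2_unbounded (x : R) : exists N : nat, x <= 2 ^+ N.
Proof.
exists (Num.truncn x).+1; apply: (@le_trans _ _ (Num.truncn x).+1%:R).
  exact/ltW/truncnS_gt.
by rewrite -natrX ler_nat ltnW// ltn_expl.
Qed.

(** A geometric series over dyadic shells shrinking to 0. *)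
Lemma integ_epow_near d : 0 < d -> exists2 C : R, 0 <= C &
  forall a b : R, 0 < a -> a <= b -> integ (shell a b) (epow d) <= C * b `^ d.
Proof.
move=> d0; have [C0 C00 hC0] := integ_dyadic d.
have q1 := powR2_gt1 d0.
have cd := @epow_continuous d.
(* The constant [C] for which the induction closes with equality:
   [(C + C0) * (b / 2) ^ d = C * b ^ d]. *)
exists (C0 / (2 `^ d - 1)); first by rewrite divr_ge0//; lra.
have E (N : nat) b : 0 < b ->
    integ (shell (b / 2 ^+ N) b) (epow d) <= C0 / (2 `^ d - 1) * b `^ d.
  elim: N b => [|N IH] b b0.
    rewrite expr0 divr1 /integ (_ : shell b b = set0) ?Rintegral_set0.
      by rewrite mulr_ge0 ?powR_ge0// divr_ge0//; lra.
    apply/seteqP; split => t //; rewrite /shell/radial/= in_itv/= => /andP[h1 h2].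
    by move: (le_lt_trans h1 h2); rewrite ltxx.
  have b20 : 0 < b / 2 by lra.
  rewrite (@integ_shellU _ _ _ _ (b / 2))//; last 3 first.
  - by rewrite divr_gt0// exprn_gt0.
  - rewrite exprS invfM mulrA ler_pdivrMr ?exprn_gt0// ler_pMr// exprn_ege1//.
    by rewrite ler1n.
  - lra.
  have -> : b / 2 ^+ N.+1 = (b / 2) / 2 ^+ N by rewrite exprS invfM mulrA.
  apply: le_trans (lerD (IH _ b20) _) _.
    by have hb := hC0 _ b20; rewrite (_ : 2 * (b / 2) = b) in hb; [exact: hb|field].
  have -> : b `^ d = 2 `^ d * (b / 2) `^ d.
    by rewrite -powRM// ?ltW//; congr (_ `^ _); field.
  rewrite -subr_ge0.
  set q := 2 `^ d in q1 *; set w := (b / 2) `^ d.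
  have -> : C0 / (q - 1) * (q * w) - (C0 / (q - 1) * w + C0 * w) = 0 by field; lra.
  by [].
move=> a b a0 ab; have b0 : 0 < b by exact: lt_le_trans ab.
have [N hN] := expn2_unbounded (b / a).
apply: le_trans (E N b b0); apply: integ_shell_sub => //.
- by move=> z _; exact: epow_ge0.
- by rewrite divr_gt0// exprn_gt0.
- by rewrite ler_pdivrMr ?exprn_gt0// mulrC -ler_pdivrMr.
Qed.

Lemma integ_epow_far d : 0 < d -> exists2 C : R, 0 <= C &
  forall a b : R, 0 < a -> a <= b -> integ (shell a b) (epow (- d)) <= C * a `^ (- d).
Proof.
move=> d0; have [C0 C00 hC0] := integ_dyadic (- d).
have q1 := powR2_gt1 d0.
have cd := @epow_continuous (- d).
have q1' : (2 : R) `^ (- d) < 1 by rewrite powRN invf_lt1// (lt_trans _ q1).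
set q := 2 `^ (- d) in q1'.
have C'0 : 0 <= C0 / (1 - q) by rewrite divr_ge0//; lra.
(* Now the shells double outwards, and the induction closes when [C0 + C * q = C]. *)
exists (C0 / (1 - q)) => //.
have E (N : nat) a : 0 < a ->
    integ (shell a (2 ^+ N * a)) (epow (- d)) <= C0 / (1 - q) * a `^ (- d).
  elim: N a => [|N IH] a a0.
    rewrite expr0 mul1r /integ (_ : shell a a = set0) ?Rintegral_set0.
      by rewrite mulr_ge0 ?powR_ge0//.
    apply/seteqP; split => t //; rewrite /shell/radial/= in_itv/= => /andP[h1 h2].
    by move: (le_lt_trans h1 h2); rewrite ltxx.
  have a20 : 0 < 2 * a by lra.
  rewrite (@integ_shellU _ _ _ _ (2 * a))//; last 2 first.
  - lra.
  - rewrite exprS -mulrA ler_pM2l// ler_peMl//; first exact: ltW.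
    by rewrite exprn_ege1// ler1n.
  have -> : 2 ^+ N.+1 * a = 2 ^+ N * (2 * a) by rewrite exprSr mulrA.
  apply: le_trans (lerD (hC0 _ a0) (IH _ a20)) _.
  have -> : (2 * a) `^ (- d) = q * a `^ (- d) by apply: powRM; lra.
  rewrite -subr_ge0.
  set w := a `^ (- d).
  have -> : C0 / (1 - q) * w - (C0 * w + C0 / (1 - q) * (q * w)) = 0 by field; lra.
  by [].
move=> a b a0 ab; have b0 : 0 < b by exact: lt_le_trans ab.
have [N hN] := expn2_unbounded (b / a).
apply: le_trans (E N a a0); apply: integ_shell_sub => //.
- by move=> z _; exact: epow_ge0.
- by rewrite -ler_pdivrMr.
Qed.

(** The box [[r, 2 r[^n] has measure [r ^ n] and its points have norm between [r] and [2 n r]. The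
    outer radius is the larger [3 n r] because a shell omits its outer sphere. *)
Lemma integ_epow_lower d : (0 < n)%N -> 0 < d -> exists2 c : R, 0 < c &
  forall r : R, 0 < r -> c * r `^ (- d) <= integ (shell r (3 * n%:R * r)) (epow (- d)).
Proof.
move=> n0 d0; have n1 : 1 <= n%:R :> R by rewrite ler1n.
exists ((2 * n%:R) `^ (- d) * ((2 * n%:R) ^+ n)^-1).
  by rewrite mulr_gt0 ?powR_gt0 ?invr_gt0 ?exprn_gt0//; lra.
move=> r r0; pose B : set (n.-tuple T) := [set t | forall i, (`[r, 2 * r[%classic : set T) (tnth t i)].
have mB : measurable B.
  rewrite (_ : B = \bigcap_(i in [set: 'I_n]) ((fun t : n.-tuple T => tnth t i) @^-1` `[r, 2 * r[%classic)).
    apply: fin_bigcap_measurable; first exact: finite_finset.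
    by move=> i _; rewrite -[X in measurable X]setTI; exact: measurable_tnth.
  by apply/seteqP; split => t /=; [move=> h i _; exact: h|move=> h i; exact: h].
have muB : mu B = (r ^+ n)%:E.
  rewrite (lebesgue_measure_tuple_box (A := fun=> `[r, 2 * r[%classic))//.
  rewrite (eq_bigr (fun=> r%:E)) => [|i _]; last first.
    rewrite lebesgue_measure_itv/= lte_fin ifT; last lra.
    by rewrite -EFinD; congr (_%:E); ring.
  by clear; elim: n => [|m IH]; rewrite ?big_ord0// big_ord_recl IH -EFinM exprS.
have Bb t : B t -> r <= enorm (rvec t) <= 2 * n%:R * r.
  move=> Bt; apply/andP; split.
    have := Bt (Ordinal n0); rewrite /= in_itv/= => /andP[h _].
    apply: le_trans h _; apply: le_trans (ler_norm _) _.
    by have := coord_le_enorm (rvec t) (Ordinal n0); rewrite mxE.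
  have -> : 2 * n%:R * r = n%:R * (2 * r) by ring.
  apply: enorm_le_coord => [i|]; last lra.
  have := Bt i; rewrite /= in_itv/= mxE => /andP[h1 h2].
  by rewrite ger0_norm ?ltW//; exact: lt_le_trans h1.
have cd := @epow_continuous (- d).
apply: (@le_trans _ _ (integ B (epow (- d)))); last first.
  apply: (@integ_subset _ _ _ _ _ r (3 * n%:R * r)) => //.
  - exact: measurable_shell.
  - move=> t /Bb/andP[h1 h2]; rewrite /shell/radial/= in_itv/= h1/=.
    by apply: le_lt_trans h2 _; rewrite ltr_pM2r// ltr_pM2r; lra.
  - by move=> t; exact: shell_bounds.
  - by move=> z _; exact: epow_ge0.
set c := (X in X * _).
have -> : c * r `^ (- d) = integ B (fun=> ((2 * n%:R * r) `^ (- d) * ((2 * n%:R * r) ^+ n)^-1)).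
  rewrite /integ Rintegral_cst//; have -> : fine (mu B) = r ^+ n by rewrite /= muB.
  have e : (2 * n%:R * r) `^ (- d) = (2 * n%:R) `^ (- d) * r `^ (- d) by apply: powRM; lra.
  rewrite /c e.
  have e2 : (2 * n%:R * r) ^+ n = (2 * n%:R) ^+ n * r ^+ n by rewrite -exprMn.
  have n2 : (2 * n%:R : R) ^+ n != 0 by rewrite expf_neq0//; lra.
  have n3 : r ^+ n != 0 by rewrite expf_neq0//; lra.
  rewrite e2; move: n2 n3; set u := (2 * n%:R) ^+ n; set w := r ^+ n => n2 n3.
  by field; rewrite n2 n3.
apply: (@integ_le _ _ _ _ _ r (2 * n%:R * r)) => //; first exact: continuous_off0_cst.
move=> z h1 h2; have z0 : 0 < enorm z by exact: lt_le_trans h1.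
rewrite epowE -?enorm_gt0//; apply: ler_pM; rewrite ?powR_ge0 ?invr_ge0 ?exprn_ge0//; try lra.
  by rewrite ler_powRn// oppr_le0 ltW.
have p : 0 < 2 * n%:R * r by exact: lt_le_trans z0 h2.
by rewrite lef_pV2 ?posrE ?exprn_gt0// lerXn2r ?nnegrE// ltW.
Qed.

Lemma tint_split_bound f r a : continuous_off0 f -> (forall z : V, z != 0 -> 0 <= f z) ->
  0 < r -> 0 < a ->
  tint f r <= integ (shell (Num.min r a) a) f + integ (shell a (Num.max a r^-1)) f.
Proof.
move=> cf f0 r0 a0; have m0 : 0 < Num.min r a by rewrite lt_min r0.
rewrite -integ_shellU//; [|by rewrite ge_min lexx orbT|by rewrite le_max lexx].
apply: (@integ_subset _ _ _ _ _ (Num.min r a) (Num.max a r^-1)) => //.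
- exact: measurable_core.
- exact: measurable_shell.
- move=> t; rewrite /shell/core/radial/= !in_itv/= => /andP[h1 h2].
  by rewrite ge_min (ltW h1)/= lt_max h2 orbT.
- by move=> t; exact: shell_bounds.
Qed.

(** The constant is fixed before the radius [a], which will later depend on the value of [eta] at
    the point considered. *)
Lemma tint_bound d d' : 0 < d -> 0 < d' -> exists2 C : R, 0 <= C &
  forall g (A B a : R), 0 < a -> 0 <= A -> 0 <= B -> continuous_off0 g ->
  (forall z, z != 0 -> enorm z <= a -> `|g z| <= A * epow d z) ->
  (forall z, a <= enorm z -> `|g z| <= B * epow (- d') z) ->
  forall r : R, 0 < r -> tint (fun z => `|g z|) r <= C * (A * a `^ d + B * a `^ (- d')).
Proof.
move=> d0 d'0; have [C1 C10 h1] := integ_epow_near d0.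
have [C2 C20 h2] := integ_epow_far d'0.
exists (C1 + C2); first exact: addr_ge0.
move=> g A B a a0 A0 B0 cg gA gB r r0.
have cn := continuous_off0_norm cg.
apply: le_trans (tint_split_bound cn _ r0 a0) _; first by move=> z _; exact: normr_ge0.
have m0 : 0 < Num.min r a by rewrite lt_min r0.
have ma : Num.min r a <= a by rewrite ge_min lexx orbT.
have aM : a <= Num.max a r^-1 by rewrite le_max lexx.
have H1 : integ (shell (Num.min r a) a) (fun z => `|g z|) <= A * (C1 * a `^ d).
  apply: le_trans (ler_wpM2l A0 (h1 _ _ m0 ma)).
  rewrite -integ_shellZ//; last exact: epow_continuous.
  apply: (@integ_le _ _ _ _ _ (Num.min r a) a) => //.
  - by apply: continuous_off0M; [exact: continuous_off0_cst|exact: epow_continuous].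
  - exact: measurable_shell.
  - by move=> t; exact: shell_bounds.
  - by move=> z h h'; apply: gA => //; rewrite -enorm_gt0; exact: lt_le_trans h.
have H2 : integ (shell a (Num.max a r^-1)) (fun z => `|g z|) <= B * (C2 * a `^ (- d')).
  apply: le_trans (ler_wpM2l B0 (h2 _ _ a0 aM)).
  rewrite -integ_shellZ//; last exact: epow_continuous.
  apply: (@integ_le _ _ _ _ _ a (Num.max a r^-1)) => //.
  - by apply: continuous_off0M; [exact: continuous_off0_cst|exact: epow_continuous].
  - exact: measurable_shell.
  - by move=> t; exact: shell_bounds.
  - by move=> z h h'; apply: gB.
apply: le_trans (lerD H1 H2) _.
have p1 : 0 <= A * a `^ d by rewrite mulr_ge0// powR_ge0.
have p2 : 0 <= B * a `^ (- d') by rewrite mulr_ge0// powR_ge0.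
set x := a `^ d in p1 *; set y := a `^ (- d') in p2 *.
have q1 := mulr_ge0 C10 p2; have q2 := mulr_ge0 C20 p1.
nra.
Qed.

End radial_powers.

(** * Integration by parts on shells *)

Section line.
Variables (R : realType) (n : nat).
Local Notation V := 'rV[R]_n.
Local Notation leb := (@lebesgue_measure R).

Lemma is_derive_line (U : V -> R) (a e : V) (s : R) : derivable U (a + s *: e) e ->
  is_derive s 1 (fun s => U (a + s *: e)) ('D_e U (a + s *: e)).
Proof.
move=> dU.
have E : (fun h : R => h^-1 *: (((fun s => U (a + s *: e)) \o shift s) (h *: 1) - U (a + s *: e))) =
         (fun h : R => h^-1 *: ((U \o shift (a + s *: e)) (h *: e) - U (a + s *: e))).
  apply/funext => h /=; congr (_ *: (U _ - _)).
  by rewrite /shift/= scalerDl [in RHS]addrC -addrA [X in a + X]addrC /GRing.scale/= mulr1.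
by apply: DeriveDef; rewrite /derivable/derive E.
Qed.

(** Integration by parts as an inequality: the integrand contains the continuous bound [m] in place
    of [k'], so that no integral of [k'], which need not be continuous, has to make sense. *)
Lemma ibp1 (c d : R) (U U' k k' m : R -> R) : c < d ->
  {in `[c, d], forall t : R, is_derive t (1 : R) U (U' t)} ->
  {in `[c, d], forall t : R, is_derive t (1 : R) k (k' t)} ->
  {in `[c, d], forall t, `|k' t| <= m t} ->
  {in `[c, d], forall t, {for t, continuous U'}} ->
  {in `[c, d], forall t, {for t, continuous m}} ->
  U c * k c - U d * k d <= \int[leb]_(t in `[c, d]) (`|U t| * m t - U' t * k t).
Proof.
move=> cd dU dk km cU' cm.
set P := fun t => `|U t| * m t - U' t * k t.
have dc (f f' : R -> R) : {in `[c, d], forall t : R, is_derive t (1 : R) f (f' t)} ->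
    {in `[c, d], forall t, {for t, continuous f}}.
  by move=> df t tcd; apply: differentiable_continuous; apply/derivable1_diffP; case: (df t tcd).
have cU := dc _ _ dU; have ck := dc _ _ dk.
have cP : {in `[c, d], forall t, {for t, continuous P}}.
  move=> t tcd; apply: continuousB; apply: continuousM.
  - apply: (@continuous_comp _ _ _ U (fun x => `|x|)); first exact: cU.
    exact: norm_continuous.
  - exact: cm.
  - exact: cU'.
  - exact: ck.
have iP : leb.-integrable `[c, d] (EFin \o P).
  apply: continuous_compact_integrable; first exact: segment_compact.
  by apply: continuous_in_subspaceT => t; rewrite inE; exact: cP.
pose G x := (\int[leb]_(t in `[c, x]) P t)%R.
have cG : {within `[c, d], continuous G}.
  exact: (@parameterized_integral_continuous R c d P (ltW cd) iP).
have sub x : x \in `]c, d[ -> x \in `[c, d] by apply: subset_itv_oo_cc.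
have dG x : x \in `]c, d[ -> is_derive x 1 G (P x).
  move=> xcd; have := xcd; rewrite in_itv/= => /andP[cx xd].
  have [h1 h2] := continuous_FTC1_closed xd iP cx (cP _ (sub _ xcd)).
  by apply: DeriveDef; [exact: h1|rewrite -derive1E; exact: h2].
(* The derivative of [H] is [|U| * m + U * k'], which is nonnegative; the claim is that [H] does not
   decrease from [c] to [d]. *)
pose H x := G x + U x * k x.
have dH x : x \in `]c, d[ -> is_derive x 1 H (P x + (U x * k' x + k x * U' x)).
  move=> xcd; apply: is_deriveD; first exact: dG.
  by apply: is_deriveM; [exact: dU (sub _ xcd)|exact: dk (sub _ xcd)].
have cH : {within `[c, d], continuous H}.
  move=> x; apply: cvgD; first exact: cG.
  have : {within `[c, d], continuous (fun x => U x * k x)}.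
    apply: continuous_in_subspaceT => t; rewrite inE => tcd.
    by apply: continuousM; [exact: cU|exact: ck].
  exact.
have : H c <= H d.
  apply: (@ger0_derive1_ndecr R H c d) => //; try exact: ltW.
    by move=> x xcd; case: (dH x xcd).
  move=> x xcd; rewrite derive1E; have [_ ->] := dH x xcd.
  rewrite /P; have := km _ (sub _ xcd); rewrite ler_norml => /andP[h1 h2].
  have := ler_norm (U x); have := ler_norm (- U x); rewrite normrN.
  have := normr_ge0 (U x); set u := `|U x| => u0 h3 h4.
  have m0 : 0 <= m x by apply: le_trans (km _ (sub _ xcd)); exact: normr_ge0.
  have : - (u * m x) <= U x * k' x.
    by rewrite lerNl; apply: le_trans (ler_norm _) _; rewrite normrN normrM ler_wpM2l// km// sub.
  by lra.
rewrite /H {1}/G set_itv1 Rintegral_set1 add0r => h.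
by rewrite lerBlDr.
Qed.

End line.

Section parts.
Variables (R : realType) (n : nat).
Local Notation T := (measurableTypeR R).
Local Notation V := 'rV[R]_n.
Local Notation mu := (lebesgue_measure_tuple R n).
Local Notation leb := (@lebesgue_measure R).

Lemma measurable_tupd (t : n.-tuple T) i : measurable_fun [set: T] (tupd t i).
Proof.
apply/measurable_fun_tnthP => j.
have -> : (@tnth n T ^~ j) \o tupd t i = fun s => if j == i then s else tnth t j.
  by apply/funext => s /=; rewrite tnth_mktuple.
by case: (j == i); [exact: measurable_id|exact: measurable_cst].
Qed.

Lemma rvec_tupd (t : n.-tuple T) i (s : R) :
  rvec (tupd t i s) = rvec (tupd t i 0) + s *: @Defs.basis R n i.
Proof.
apply/rowP => j; rewrite !mxE !tnth_mktuple eqxx/=.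
by case: eqP => _; rewrite ?mulr1 ?mulr0 ?add0r ?addr0.
Qed.

Lemma enorm_tupd (t : n.-tuple T) i (s : R) :
  enorm (rvec (tupd t i s)) ^+ 2 = \sum_(j | j != i) tnth t j ^+ 2 + s ^+ 2.
Proof.
rewrite enorm_sqr (bigD1 i)//= mxE tnth_mktuple eqxx addrC; congr (_ + _).
by apply: eq_bigr => j ji; rewrite mxE tnth_mktuple (negbTE ji).
Qed.

Lemma integral_cube_slice (t : n.-tuple T) i (r : R) :
  0 <= r -> (forall j, j != i -> `|tnth t j| < r) ->
  \int[leb]_s (\1_(cube R n r) (tupd t i s) : R) = 2 * r.
Proof.
move=> r0 h.
have E s : (\1_(cube R n r) (tupd t i s) : R) = \1_(`]- r, r[%classic) s.
  rewrite !indicE; congr (nat_of_bool _)%:R; apply/idP/idP; rewrite !inE.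
    by move/(_ i); rewrite tnth_mktuple eqxx /= in_itv/= ltr_norml.
  rewrite /= in_itv/= -ltr_norml => sr j; rewrite tnth_mktuple.
  by case: eqP => // /eqP; exact: h.
rewrite /Rintegral; under eq_integral do rewrite E.
rewrite integral_indic// setIT.
transitivity (fine (@lebesgue_measure R [set` `]- r, r[%R])); first by [].
rewrite lebesgue_measure_itv/= lte_fin.
case: ifPn => [_|]; first by rewrite /= ; lra.
by rewrite -leNgt => h'; rewrite /=; lra.
Qed.

Lemma bounded_support_integrable (h : R -> R) (C r : R) :
  measurable_fun setT h -> (forall s, `|h s| <= C) -> (forall s, r <= `|s| -> h s = 0) ->
  leb.-integrable setT (EFin \o h).
Proof.
move=> mh hC h0; have mi : measurable (`]-r, r[%classic : set T) by exact: measurable_itv.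
have -> : EFin \o h = (EFin \o h) \_ `]-r, r[.
  apply/funext => s; rewrite patchE; case: ifPn => //; rewrite notin_setE/= in_itv/= -ltr_norml => /negP.
  by rewrite -leNgt => /h0 ->.
apply/(integrable_mkcond _ mi).1; apply: measurable_bounded_integrable => //.
- apply: (@le_lt_trans _ _ (@lebesgue_measure R [set` `]- r, r[%R])); first exact: lexx.
  by rewrite lebesgue_measure_itv/= lte_fin; case: ifPn => // _; rewrite -EFinD ltry.
- exact: measurable_funS mh.
- exists C; split; first exact: num_real.
  by move=> x Cx s _ /=; exact: (le_trans (hC s) (ltW Cx)).
Qed.

(** [q] is the squared distance from the line to the origin. If [q < r1 ^+ 2], the line meets the
    shell in two segments with two endpoints on each sphere; otherwise in a single one with both
    endpoints on the outer sphere. Each endpoint costs [M1] or [M2]. *)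
Lemma slice_by_parts (a : V) (i : 'I_n) (U k m : V -> R) (P : V -> R) (q r1 r2 M1 M2 : R) :
  0 < r1 -> r1 < r2 -> 0 <= M1 -> 0 <= M2 ->
  (forall s, enorm (a + s *: @Defs.basis R n i) ^+ 2 = q + s ^+ 2) -> 0 <= q -> q < r2 ^+ 2 ->
  (forall z, differentiable U z) -> continuous (fun z => 'D_(@Defs.basis R n i) U z) ->
  (forall z, z != 0 -> differentiable k z) -> continuous_off0 m ->
  (forall z, z != 0 -> `|'D_(@Defs.basis R n i) k z| <= m z) ->
  (forall z, enorm z = r1 -> `|U z * k z| <= M1) ->
  (forall z, enorm z = r2 -> `|U z * k z| <= M2) ->
  P = (fun z => `|U z| * m z - 'D_(@Defs.basis R n i) U z * k z) ->
  - (2 * M2) - (if q < r1 ^+ 2 then 2 * M1 else 0) <=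
  \int[leb]_(s in [set s | r1 ^+ 2 <= q + s ^+ 2 < r2 ^+ 2]) P (a + s *: @Defs.basis R n i).
Proof.
set e := @Defs.basis R n i.
move=> r10 r12 M10 M20 aq q0 qr2 dU cDU dk cm km hM1 hM2 PE.
have r20 : 0 < r2 by exact: lt_trans r12.
have r1q : 0 < r1 ^+ 2 by rewrite exprn_gt0.
have cphi : continuous (fun s : R => a + s *: e).
  by move=> s; apply: cvgD; [exact: cvg_cst|apply: cvgZr_tmp; exact: cvg_id].
have nz s : r1 ^+ 2 <= q + s ^+ 2 -> a + s *: e != 0.
  rewrite -aq => h; rewrite -enorm_gt0 lt_neqAle enorm_ge0 andbT eq_sym.
  by apply/eqP => h0; move: h; rewrite h0 expr0n/= leNgt r1q.
have en s r : 0 <= r -> q + s ^+ 2 = r ^+ 2 -> enorm (a + s *: e) = r.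
  by move=> r0; rewrite -aq => /eqP; rewrite eqrXn2 ?enorm_ge0// => /eqP.
have cmp (f : V -> R) : continuous_off0 f -> forall s : R, a + s *: e != 0 ->
    {for s, continuous (fun s : R => f (a + s *: e))}.
  move=> cf s hs; apply: (@continuous_comp _ _ _ (fun s : R => a + s *: e) f).
    exact: cphi.
  exact: cf.
have cU : continuous_off0 U by move=> z _; exact: differentiable_continuous.
have ck : continuous_off0 k by move=> z z0; apply: differentiable_continuous; exact: dk.
have cP : continuous_off0 P.
  rewrite PE; apply: continuous_off0D.
    by apply: continuous_off0M => //; exact: continuous_off0_norm.
  apply: continuous_off0N; apply: continuous_off0M => //; exact: continuous_off0_cont.
have L c d : c < d -> (forall s, c <= s -> s <= d -> r1 ^+ 2 <= q + s ^+ 2) ->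
    leb.-integrable `[c, d] (EFin \o (fun s => P (a + s *: e))) /\
    - `|U (a + c *: e) * k (a + c *: e)| - `|U (a + d *: e) * k (a + d *: e)| <=
    \int[leb]_(s in `[c, d]) P (a + s *: e).
  move=> cd hs.
  have nz' s : s \in `[c, d] -> a + s *: e != 0.
    by rewrite in_itv/= => /andP[h1 h2]; apply: nz; exact: hs.
  split.
    apply: continuous_compact_integrable; first exact: segment_compact.
    by apply: continuous_in_subspaceT => s; rewrite inE => /nz'; exact: cmp.
  rewrite PE; apply: (le_trans _ (@ibp1 R c d (fun s => U (a + s *: e)) (fun s => 'D_e U (a + s *: e))
      (fun s => k (a + s *: e)) (fun s => 'D_e k (a + s *: e)) (fun s => m (a + s *: e)) cd _ _ _ _ _)).
  - have := ler_norm (- (U (a + c *: e) * k (a + c *: e))).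
    have := ler_norm (U (a + d *: e) * k (a + d *: e)); rewrite normrN; lra.
  - by move=> s _; apply: is_derive_line; exact: diff_derivable.
  - by move=> s /nz' ?; apply: is_derive_line; apply: diff_derivable; exact: dk.
  - by move=> s /nz'; exact: km.
  - by move=> s /nz' hs'; exact: (cmp _ (continuous_off0_cont cDU) s hs').
  - by move=> s /nz' hs'; exact: (cmp _ cm s hs').
pose t2 := Num.sqrt (r2 ^+ 2 - q).
have t20 : 0 < t2 by rewrite sqrtr_gt0 subr_gt0.
have t2E : t2 ^+ 2 = r2 ^+ 2 - q by rewrite sqr_sqrtr// subr_ge0 ltW.
have e2 : q + t2 ^+ 2 = r2 ^+ 2 by rewrite t2E; ring.
have e2' : q + (- t2) ^+ 2 = r2 ^+ 2 by rewrite sqrrN.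
have B2 s : (q + s ^+ 2 < r2 ^+ 2) = (s \in `]-t2, t2[).
  rewrite -e2 ltrD2l in_itv/= -ltr_norml -(real_normK (num_real s)).
  by rewrite ltr_pXn2r ?nnegrE// ltW.
case: ifPn => [qr1|]; last first.
  rewrite -leNgt subr0 => qr1.
  have -> : [set s | r1 ^+ 2 <= q + s ^+ 2 < r2 ^+ 2] = [set` `]-t2, t2[].
    apply/seteqP; split => s /=; rewrite B2; first by case/andP.
    by move=> ->; rewrite andbT; apply: le_trans qr1 _; rewrite lerDl sqr_ge0.
  have [||iP h] := L (- t2) t2; first lra.
    by move=> s _ _; apply: le_trans qr1 _; rewrite lerDl sqr_ge0.
  have iP' : leb.-integrable [set` `]-t2, t2[] (EFin \o (fun s => P (a + s *: e))).
    by apply: integrableS iP => //; exact: subset_itv_oo_cc.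
  have iP'' : leb.-integrable [set` `]-t2, t2]] (EFin \o (fun s => P (a + s *: e))).
    by apply: integrableS iP => //; exact: subset_itv_oc_cc.
  rewrite Rintegral_itv_bndo_bndc// Rintegral_itv_obnd_cbnd//.
  apply: le_trans h.
  have := hM2 _ (en t2 r2 (ltW r20) e2); have := hM2 _ (en (- t2) r2 (ltW r20) e2'); lra.
pose t1 := Num.sqrt (r1 ^+ 2 - q).
have t10 : 0 < t1 by rewrite sqrtr_gt0 subr_gt0.
have t1E : t1 ^+ 2 = r1 ^+ 2 - q by rewrite sqr_sqrtr// subr_ge0 ltW.
have e1 : q + t1 ^+ 2 = r1 ^+ 2 by rewrite t1E; ring.
have e1' : q + (- t1) ^+ 2 = r1 ^+ 2 by rewrite sqrrN.
have t12 : t1 < t2.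
  by rewrite ltr_sqrt ?subr_gt0// ltrD2r ltr_pXn2r ?nnegrE// ltW.
have B1 s : (r1 ^+ 2 <= q + s ^+ 2) = (t1 <= `|s|).
  rewrite -e1 lerD2l -(real_normK (num_real s)).
  by rewrite ler_pXn2r ?nnegrE// ltW.
have -> : [set s | r1 ^+ 2 <= q + s ^+ 2 < r2 ^+ 2] = [set` `]-t2, -t1]] `|` [set` `[t1, t2[].
  apply/seteqP; split => s /=; rewrite B2 B1 !in_itv/=.
    move=> /andP[+ /andP[h1 h2]]; rewrite ler_normr => /orP[h|h]; [right|left].
      by rewrite h h2.
    by rewrite h1/=; lra.
  clear - t12 t10; rewrite ler_normr; case=> /andP[h1 h2].
    by apply/andP; split; [apply/orP; right|apply/andP; split]; lra.
  by apply/andP; split; [apply/orP; left|apply/andP; split]; lra.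
have [||iPl hl] := L (- t2) (- t1); first lra.
  by move=> s h1 h2; rewrite B1 ler_normr; apply/orP; right; lra.
have [||iPr hr] := L t1 t2; first lra.
  by move=> s h1 h2; rewrite B1 ler_normr h1.
have iPl' : leb.-integrable [set` `]-t2, -t1]] (EFin \o (fun s => P (a + s *: e))).
  by apply: integrableS iPl => //; exact: subset_itv_oc_cc.
have iPr' : leb.-integrable [set` `[t1, t2[] (EFin \o (fun s => P (a + s *: e))).
  by apply: integrableS iPr => //; exact: subset_itv_co_cc.
rewrite Rintegral_setU//; last first.
- apply/disj_setPS => s [] /=; rewrite !in_itv/= => /andP[_ h1] /andP[h2 _].
  by exfalso; clear - t10 h1 h2; lra.
- have iU : leb.-integrable (`[- t2, - t1]%classic `|` `[t1, t2]%classic) (EFin \o (fun s : R => P (a + s *: e))).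
    apply: continuous_compact_integrable; first by apply: compactU; exact: segment_compact.
    apply: continuous_in_subspaceT => s; rewrite inE => hs; apply: (cmp _ cP s (nz _ _)).
    rewrite B1 ler_normr; move: hs; clear - t10 t12; rewrite /= !in_itv/= => hs.
    by apply/orP; case: hs => /andP[h1 h2]; [right|left]; lra.
  apply: integrableS iU; [exact: measurableU|exact: measurableU|].
  by apply: setUSS; [exact: subset_itv_oc_cc|exact: subset_itv_co_cc].
rewrite Rintegral_itv_obnd_cbnd// Rintegral_itv_bndo_bndc//.
apply: le_trans (lerD hl hr).
have := hM2 _ (en t2 r2 (ltW r20) e2); have := hM2 _ (en (- t2) r2 (ltW r20) e2').
have := hM1 _ (en t1 r1 (ltW r10) e1); have := hM1 _ (en (- t1) r1 (ltW r10) e1').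
lra.
Qed.

(* Integrating along the lines of direction [i] avoids the surface measure of the
   spheres: a line meets each of them at most twice, and the lines that meet the
   sphere of radius [r] cross the cube of half-side [r] along a segment of length
   [2 * r], so that the constant [M / r] integrated over that cube dominates the
   boundary terms. *)
Lemma integ_by_parts_le (i : 'I_n) (U k m : V -> R) (r1 r2 M1 M2 : R) :
  0 < r1 -> r1 < r2 -> 0 <= M1 -> 0 <= M2 ->
  (forall z, differentiable U z) -> continuous (fun z => 'D_(@Defs.basis R n i) U z) ->
  (forall z, z != 0 -> differentiable k z) -> continuous_off0 m ->
  (forall z, z != 0 -> `|'D_(@Defs.basis R n i) k z| <= m z) ->
  (forall z, enorm z = r1 -> `|U z * k z| <= M1) ->
  (forall z, enorm z = r2 -> `|U z * k z| <= M2) ->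
  integ (shell r1 r2) (fun z => 'D_(@Defs.basis R n i) U z * k z) <=
  integ (shell r1 r2) (fun z => `|U z| * m z)
  + M1 / r1 * (2 * r1) ^+ n + M2 / r2 * (2 * r2) ^+ n.
Proof.
set e := @Defs.basis R n i.
move=> r10 r12 M10 M20 dU cDU dk cm km hM1 hM2.
have r20 : 0 < r2 by exact: lt_trans r12.
pose P z := `|U z| * m z - 'D_e U z * k z.
have cU : continuous_off0 U by move=> z _; exact: differentiable_continuous.
have ck : continuous_off0 k by move=> z z0; apply: differentiable_continuous; exact: dk.
have cUm : continuous_off0 (fun z => `|U z| * m z).
  by apply: continuous_off0M => //; exact: continuous_off0_norm.
have cDk : continuous_off0 (fun z => 'D_e U z * k z).
  by apply: continuous_off0M => //; exact: continuous_off0_cont.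
have cP : continuous_off0 P.
  by apply: continuous_off0D => //; exact: continuous_off0N.
have [M M0 hM] := continuous_off0_bounded r2 cP r10.
pose G1 := (P \o @rvec R n) \_ (shell r1 r2 : set (n.-tuple T)).
pose G r (c : R) (t : n.-tuple T) : R := c * \1_(cube R n r) t.
have c1 : 0 <= M1 / r1 by rewrite divr_ge0// ltW.
have c2 : 0 <= M2 / r2 by rewrite divr_ge0// ltW.
have sub2 : (shell r1 r2 : set (n.-tuple T)) `<=` cube R n r2.
  by apply: radial_sub_cube => s /=; rewrite in_itv => /andP[].
have sub1 : cube R n r1 `<=` cube R n r2.
  by move=> t ht j; exact: lt_trans (ht j) r12.
have mG1 : measurable_fun setT (G1 : n.-tuple T -> T).
  have /measurable_EFinP mP := measurable_int _ (shell_integrable r2 cP r10).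
  by have := (measurable_restrictT (P \o @rvec R n) (measurable_shell r1 r2)).1 mP.
have mG r c : measurable_fun setT (G r c : n.-tuple T -> R).
  apply: measurable_funM; first exact: measurable_cst.
  by apply: measurable_indic; exact: measurable_cube.
have bG1 t : `|G1 t| <= M.
  rewrite /G1 patchE; case: ifPn => [|_]; last by rewrite normr0.
  by rewrite inE => /shell_bounds/andP[h1 h2]; exact: hM.
have bG r c t : 0 <= c -> `|G r c t| <= c.
  move=> c0; rewrite /G indicE normrM ger0_norm// ler_piMr//.
  by case: (_ \in _); rewrite ?normr1 ?normr0.
have zG1 t : ~ cube R n r2 t -> G1 t = 0.
  move=> h; rewrite /G1 patchE ifF//; apply/negbTE; rewrite notin_setE.
  by move=> /sub2.
have zG r c t : cube R n r `<=` cube R n r2 -> ~ cube R n r2 t -> G r c t = 0.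
  by move=> h ht; rewrite /G indicE memNset ?mulr0// => /h.
have iG1 := cube_integrable mG1 bG1 zG1.
have iG r c : 0 <= c -> cube R n r `<=` cube R n r2 -> mu.-integrable setT (EFin \o G r c).
  move=> c0 h; apply: (@cube_integrable R n r2 c _ (mG r c)) => t; first exact: bG.
  exact: zG.
have iGG : mu.-integrable setT (EFin \o (fun t => G1 t + G r1 (M1 / r1) t)).
  have := integrableD measurableT iG1 (iG _ _ c1 sub1).
  by apply: eq_integrable => // t _; rewrite /= EFinD.
have GE r c : 0 < r -> 0 <= c -> cube R n r `<=` cube R n r2 ->
    \int[mu]_t G r c t = c * (2 * r) ^+ n.
  move=> r0 c0 h; rewrite /G.
  have -> : \int[mu]_t (c * \1_(cube R n r) t) = c * \int[mu]_t (\1_(cube R n r) t).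
    apply: RintegralZl => //; have := iG r 1 ler01 h.
    by rewrite (_ : EFin \o G r 1 = EFin \o \1_(cube R n r))//; apply/funext => t; rewrite /= /G mul1r.
  congr (c * _); rewrite /Rintegral integral_indic//; last exact: measurable_cube.
  rewrite setIT; transitivity (fine ((2 * r) ^+ n)%:E) => //.
  by congr fine; exact: lebesgue_measure_cube (ltW r0).
(* The boundary terms are the integrals of the two functions [G], so the claim is the nonnegativity
   of one integral, to be checked on each line. *)
suff H : 0 <= \int[mu]_t (G1 t + G r1 (M1 / r1) t + G r2 (M2 / r2) t).
  move: H; rewrite RintegralD//; last exact: iG.
  rewrite RintegralD//; [|exact: iG].
  rewrite !GE// /G1 -Rintegral_mkcond.
  have -> : \int[mu]_(x in shell r1 r2) (P \o @rvec R n) x =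
     integ (shell r1 r2) (fun z => `|U z| * m z) - integ (shell r1 r2) (fun z => 'D_e U z * k z).
    have iUm := shell_integrable r2 cUm r10; have iDk := shell_integrable r2 cDk r10.
    exact: (RintegralB (measurable_shell r1 r2) iUm iDk).
  by move=> h; rewrite -subr_ge0; apply: le_trans h _; rewrite le_eqVlt; apply/orP; left; apply/eqP; ring.
apply: fine_ge0.
pose C := M + M1 / r1 + M2 / r2.
apply: (@integral_slices_ge0 R n i r2 C).
- by apply: measurable_funD => //; apply: measurable_funD.
- move=> t; apply: le_trans (ler_normD _ _) _; rewrite lerD ?bG//.
  by apply: le_trans (ler_normD _ _) _; rewrite lerD ?bG.
- by move=> t h; rewrite zG1// !zG// !addr0.
move=> t.
have mt := measurable_tupd t i.
have mg1 : measurable_fun setT (fun s : T => G1 (tupd t i s) : T).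
  exact: (measurableT_comp mG1 mt).
have mgc r c : measurable_fun setT (fun s : T => G r c (tupd t i s) : R).
  exact: (measurableT_comp (mG r c) mt).
have out s : r2 <= `|s| -> ~ cube R n r2 (tupd t i s).
  by move=> h /(_ i); rewrite tnth_mktuple eqxx ltNge h.
have ig1 : leb.-integrable setT (EFin \o (fun s => G1 (tupd t i s))).
  by apply: (@bounded_support_integrable _ M r2 mg1) => s; [exact: bG1|move/out; exact: zG1].
have igc r c : 0 <= c -> cube R n r `<=` cube R n r2 ->
    leb.-integrable setT (EFin \o (fun s => G r c (tupd t i s))).
  move=> c0 h; apply: (@bounded_support_integrable _ c r2 (mgc r c)) => s; first exact: bG.
  by move/out; exact: zG.
have ig12 : leb.-integrable setT (EFin \o (fun s => G1 (tupd t i s) + G r1 (M1 / r1) (tupd t i s))).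
  have := integrableD measurableT ig1 (igc _ _ c1 sub1).
  by apply: eq_integrable => // s _; rewrite /= EFinD.
have ig : leb.-integrable setT
    (fun s => (G1 (tupd t i s) + G r1 (M1 / r1) (tupd t i s) + G r2 (M2 / r2) (tupd t i s))%:E).
  have := integrableD measurableT ig12 (igc _ _ c2 (@subset_refl _ _)).
  by apply: eq_integrable => // s _; rewrite /= EFinD.
have fg := integrable_fin_num measurableT ig.
rewrite -[X in (_ <= X)%E]fineK//.
have -> : fine (\int[leb]_s (G1 (tupd t i s) + G r1 (M1 / r1) (tupd t i s) + G r2 (M2 / r2) (tupd t i s))%:E)
   = \int[leb]_s (G1 (tupd t i s)) + \int[leb]_s (G r1 (M1 / r1) (tupd t i s))
     + \int[leb]_s (G r2 (M2 / r2) (tupd t i s)).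
  rewrite -RintegralD//; [|exact: igc].
  rewrite -RintegralD//; exact: igc.
rewrite lee_fin.
have Gge0 r c s : 0 <= c -> 0 <= G r c s by move=> c0; rewrite mulr_ge0.
have I1 : 0 <= \int[leb]_s (G r1 (M1 / r1) (tupd t i s)).
  by apply: Rintegral_ge0 => s _; exact: Gge0.
have I2 : 0 <= \int[leb]_s (G r2 (M2 / r2) (tupd t i s)).
  by apply: Rintegral_ge0 => s _; exact: Gge0.
pose q := \sum_(j | j != i) tnth t j ^+ 2.
have q0 : 0 <= q by apply: sumr_ge0 => j _; exact: sqr_ge0.
have qj r : 0 <= r -> q < r ^+ 2 -> forall j, j != i -> `|tnth t j| < r.
  move=> r0 qr j ji; rewrite -(@ltr_pXn2r _ 2)// ?nnegrE// real_normK ?num_real//.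
  apply: le_lt_trans qr; rewrite /q (bigD1 j)//= lerDl.
  by apply: sumr_ge0 => l _; exact: sqr_ge0.
have GI r c : 0 < r -> 0 <= c -> q < r ^+ 2 -> cube R n r `<=` cube R n r2 ->
    \int[leb]_s (G r (c / r) (tupd t i s)) = 2 * c.
  move=> r0 c0 qr h.
  have -> : \int[leb]_s (G r (c / r) (tupd t i s)) = c / r * \int[leb]_s (\1_(cube R n r) (tupd t i s)).
    apply: RintegralZl => //; have := igc r 1 ler01 h.
    by apply: eq_integrable => // s _; rewrite /= /G mul1r.
  by rewrite (integral_cube_slice (ltW r0) (qj r (ltW r0) qr)); field; rewrite gt_eqF.
have inS s : (tupd t i s \in (shell r1 r2 : set (n.-tuple T))) = (r1 ^+ 2 <= q + s ^+ 2 < r2 ^+ 2).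
  rewrite -enorm_tupd; apply/idP/idP; rewrite inE /shell/radial/= in_itv/=.
    move=> /andP[h1 h2]; rewrite ler_pXn2r ?nnegrE ?enorm_ge0 ?(ltW r10)//=.
    by rewrite h1/= ltr_pXn2r ?nnegrE ?enorm_ge0 ?(ltW r20).
  move=> /andP[h1 h2]; rewrite -(@ler_pXn2r _ 2)// ?nnegrE ?enorm_ge0 ?(ltW r10)// h1/=.
  by rewrite -(@ltr_pXn2r _ 2)// ?nnegrE ?enorm_ge0 ?(ltW r20).
(* A line at distance at least [r2] misses the shell, and only the nonnegative functions [G] remain
   on it. *)
have [qr2|qr2] := leP (r2 ^+ 2) q.
  have -> : \int[leb]_s G1 (tupd t i s) = 0.
    rewrite (@eq_Rintegral _ _ _ _ _ (fun=> 0)); first by rewrite Rintegral_cst// mul0r.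
    move=> s _; rewrite /G1 patchE inS ifF//.
    apply/negbTE; rewrite negb_and -!leNgt; apply/orP; right.
    by apply: le_trans qr2 _; rewrite lerDl sqr_ge0.
  by rewrite add0r addr_ge0.
rewrite (GI r2 M2)//.
have -> : \int[leb]_s G1 (tupd t i s) =
    \int[leb]_(s in [set s | r1 ^+ 2 <= q + s ^+ 2 < r2 ^+ 2]) P (rvec (tupd t i 0) + s *: e).
  rewrite [RHS]Rintegral_mkcond; apply: eq_Rintegral => s _.
  rewrite /G1 !patchE inS; case: ifPn => h.
    by rewrite mem_set//= rvec_tupd.
  by rewrite memNset//; exact/negP.
have := @slice_by_parts (rvec (tupd t i 0)) i U k m P q r1 r2 M1 M2 r10 r12 M10 M20.
have aq s : enorm (rvec (tupd t i 0) + s *: e) ^+ 2 = q + s ^+ 2.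
  by rewrite -rvec_tupd enorm_tupd.
move=> /(_ aq q0 qr2 dU cDU dk cm km hM1 hM2 erefl); rewrite -/e.
(* A line that stays away from the inner ball has no endpoint on its sphere; the integral of
   [G r1 (M1 / r1)] then enters by its sign alone. *)
case: ifPn => [qr1|_] h; last lra.
by move: h; rewrite (GI r1 M1)//; lra.
Qed.

Lemma integ_by_parts (i : 'I_n) (U k m : V -> R) (r1 r2 M1 M2 : R) :
  0 < r1 -> r1 < r2 -> 0 <= M1 -> 0 <= M2 ->
  (forall z, differentiable U z) -> continuous (fun z => 'D_(@Defs.basis R n i) U z) ->
  (forall z, z != 0 -> differentiable k z) -> continuous_off0 m ->
  (forall z, z != 0 -> `|'D_(@Defs.basis R n i) k z| <= m z) ->
  (forall z, enorm z = r1 -> `|U z * k z| <= M1) ->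
  (forall z, enorm z = r2 -> `|U z * k z| <= M2) ->
  `|integ (shell r1 r2) (fun z => 'D_(@Defs.basis R n i) U z * k z)| <=
  integ (shell r1 r2) (fun z => `|U z| * m z)
  + M1 / r1 * (2 * r1) ^+ n + M2 / r2 * (2 * r2) ^+ n.
Proof.
set e := @Defs.basis R n i.
move=> r10 r12 M10 M20 dU cDU dk cm km hM1 hM2.
have DN z : 'D_e (fun z => - U z) z = - 'D_e U z by apply: deriveN; exact: diff_derivable.
have h1 := integ_by_parts_le r10 r12 M10 M20 dU cDU dk cm km hM1 hM2.
have h2 : integ (shell r1 r2) (fun z => 'D_e (fun z => - U z) z * k z) <=
    integ (shell r1 r2) (fun z => `|- U z| * m z) + M1 / r1 * (2 * r1) ^+ n + M2 / r2 * (2 * r2) ^+ n.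
  apply: integ_by_parts_le => //.
  - by move=> z; exact: differentiableN.
  - have -> : 'D_(@Defs.basis R n i) (fun z => - U z) = (fun z => - 'D_e U z) by apply/funext.
    by move=> z; exact: (@continuousN _ _ _ ('D_e U) z (cDU z)).
  - by move=> z zr; rewrite mulNr normrN; exact: hM1.
  - by move=> z zr; rewrite mulNr normrN; exact: hM2.
rewrite ler_norml; apply/andP; split; last exact: h1.
have nE : (fun z => `|- U z| * m z) = (fun z => `|U z| * m z).
  by apply/funext => z; rewrite normrN.
rewrite nE in h2.
have ck : continuous_off0 k by move=> z z0; apply: differentiable_continuous; exact: dk.
have YE : integ (shell r1 r2) (fun z => 'D_e (fun z => - U z) z * k z) =
    - integ (shell r1 r2) (fun z => 'D_e U z * k z).
  rewrite -mulN1r -integ_shellZ//; last by apply: continuous_off0M => //; exact: continuous_off0_cont.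
  by congr integ; apply/funext => z; rewrite DN; ring.
by rewrite lerNl -YE.
Qed.

End parts.

(** * Taylor expansions *)

Section calculus.
Variables (R : realType) (n : nat).
Local Notation V := 'rV[R]_n.
Local Notation bas := (@Defs.basis R n).
Implicit Types (x y z e : V) (f U : V -> R).

Lemma derive_dot f x e : differentiable f x -> 'D_e f x = dot (grad f x) e.
Proof.
move=> df; rewrite deriveE// [in LHS](row_sum_delta e) linear_sum.
apply: eq_bigr => i _; rewrite linearZ /= mxE deriveE// mulrC.
by [].
Qed.

Lemma dotN x z : dot x (- z) = - dot x z.
Proof. by rewrite /dot -sumrN; apply: eq_bigr => i _; rewrite mxE mulrN. Qed.

Lemma dotBl x y z : dot (x - y) z = dot x z - dot y z.
Proof.
by rewrite /dot -sumrN -big_split/=; apply: eq_bigr => i _; rewrite !mxE mulrBl.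
Qed.

Lemma dot_le_sum x z (C : R) : (forall i, `|x 0 i| <= C) -> `|dot x z| <= n%:R * C * enorm z.
Proof.
move=> h; apply: le_trans (ler_norm_sum _ _ _) _.
apply: (@le_trans _ _ (\sum_(i < n) C * enorm z)).
  by apply: ler_sum => i _; rewrite normrM ler_pM// coord_le_enorm.
by rewrite sumr_const card_ord -[leLHS]mulr_natl mulrA.
Qed.

Lemma mean_value f x z : (forall y, differentiable f y) ->
  exists2 t : R, 0 <= t <= 1 & f (x - z) - f x = - dot (grad f (x - t *: z)) z.
Proof.
move=> df; pose g (t : R) := f (x + t *: (- z)).
have dg (t : R) : is_derive t (1 : R) g ('D_(- z) f (x + t *: (- z))).
  by apply: is_derive_line; exact: diff_derivable.
have cg : {within `[0, 1], continuous g}.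
  by apply: derivable_within_continuous => t _; case: (dg t).
have [t] := MVT_segment ler01 (fun t _ => dg t) cg.
rewrite in_itv/= => t01 E; exists t => //.
move: E; rewrite /g scale1r scale0r addr0 subr0 mulr1 => ->.
by rewrite derive_dot// scalerN dotN.
Qed.

Lemma continuousP_enorm f x : {for x, continuous f} ->
  forall c : R, 0 < c -> exists2 d : R, 0 < d & forall z, enorm z <= d -> `|f (x - z) - f x| <= c.
Proof.
move=> cf c c0; move: cf => /cvgrPdist_lt /(_ _ c0) /nbhs_ballP[d /= d0 hd].
exists (d / 2); first by rewrite divr_gt0.
move=> z zd; rewrite distrC; apply/ltW/hd.
rewrite -ball_normE/= opprB addrC subrK.
by apply: le_lt_trans (norm_le_enorm z) _; lra.
Qed.

Lemma enorm_continuousP f x :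
  (forall c : R, 0 < c -> exists2 d : R, 0 < d & forall z, enorm z <= d -> `|f (x - z) - f x| <= c) ->
  {for x, continuous f}.
Proof.
move=> h; have FF := nbhs_filter x; apply/cvgrPdist_le => c c0; have [d d0 hd] := h c c0.
suff : nbhs x (fun t => `|f x - f t| <= c) by [].
apply/nbhs_ballP; exists (d / (n%:R + 1)) => /=.
  by rewrite divr_gt0// ltr_wpDl.
move=> y; rewrite -ball_normE/= => xy.
have := hd (x - y); rewrite (_ : x - (x - y) = y) 1?distrC; last by rewrite opprB addrC subrK.
apply.
have n1 : 0 < n%:R + 1 :> R by rewrite ltr_wpDl.
apply: le_trans (enorm_le_norm _) _.
apply: (@le_trans _ _ ((n%:R + 1) * `|x - y|)); first by rewrite ler_wpM2r// lerDl.
by rewrite mulrC -ler_pdivlMr// ltW.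
Qed.

Lemma holder_modulus (b : R) f x : 0 < b -> holder_loc b f ->
  exists2 C : R, 0 <= C & forall z, enorm z <= 1 -> `|f (x - z) - f x| <= C * enorm z `^ b.
Proof.
move=> b0 /(_ (enorm x + 1))[C hC]; exists `|C| => // z z1.
have e0 := enorm_ge0 z.
apply: le_trans (hC _ _ _ _) _.
- by apply: le_trans (enormD _ _) _; rewrite enormN lerD2l.
- by rewrite lerDl.
- have -> : x - z - x = - z by rewrite addrAC subrr add0r.
  by rewrite enormN ler_wpM2r ?powR_ge0// ler_norm.
Qed.

Lemma Ck_continuous k (b : R) f : 0 < b -> Ck_holder_loc k b f -> continuous f.
Proof.
move=> b0; case: k => [|k] /=; last by case=> df _ x; exact: differentiable_continuous.
move=> hf x; apply: enorm_continuousP => c c0.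
have [C C0 hC] := holder_modulus x b0 hf.
have C1 : 0 < C + 1 by lra.
have cC : 0 < c / (C + 1) by rewrite divr_gt0.
exists (Num.min 1 ((c / (C + 1)) `^ b^-1)); first by rewrite lt_min ltr01 powR_gt0.
move=> z; rewrite le_min => /andP[z1 zc]; apply: le_trans (hC z z1) _.
apply: (@le_trans _ _ (C * (c / (C + 1)))).
  rewrite ler_wpM2l//.
  have := @ge0_ler_powR R b (ltW b0) _ _ _ _ zc.
  rewrite !nnegrE enorm_ge0 powR_ge0 => /(_ isT isT).
  by rewrite -powRrM mulVf ?gt_eqF// powRr1// ltW.
by rewrite mulrA ler_pdivrMr//; nra.
Qed.

Lemma uniform_modulus (F : 'I_n -> V -> R) x (b : R) : 0 <= b ->
  (forall i, exists C d : R, [/\ 0 <= C, 0 < d &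
    forall z, enorm z <= d -> `|F i (x - z) - F i x| <= C * enorm z `^ b]) ->
  exists C d : R, [/\ 0 <= C, 0 < d &
    forall i z, enorm z <= d -> `|F i (x - z) - F i x| <= C * enorm z `^ b].
Proof.
move=> b0 h; have [Cf hCf] := boolp.choice h; have [df hdf] := boolp.choice hCf.
exists (\sum_i Cf i), (\big[Num.min/1]_i df i); split.
- by apply: sumr_ge0 => i _; case: (hdf i).
- by apply/bigmin_gtP; split => // i _; case: (hdf i).
- move=> i z zd; have [C0 d0 hi] := hdf i.
  apply: le_trans (hi z (le_trans zd (bigmin_le _ _ _))) _.
  rewrite ler_wpM2r ?powR_ge0// (bigD1 i)//= lerDl.
  by apply: sumr_ge0 => j _; case: (hdf j).
Qed.

Lemma Ck_modulus k (b : R) f x : 0 < b -> b <= 1 -> Ck_holder_loc k b f ->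
  exists C d : R, [/\ 0 <= C, 0 < d &
    forall z, enorm z <= d -> `|f (x - z) - f x| <= C * enorm z `^ (if k is 0%N then b else 1)].
Proof.
move=> b0 b1; case: k => [|k] /=.
  by move=> /(holder_modulus x b0)[C C0 hC]; exists C, 1; split.
move=> [df hD].
have cD i : continuous (fun y => 'D_(bas i) f y) by exact: Ck_continuous (hD i).
(* The exponent 0 expresses that the increments of the partial derivatives are bounded, which is all
   that a Lipschitz estimate for [f] requires. *)
have [M [d [M0 d0 hM]]] : exists C d : R, [/\ 0 <= C, 0 < d &
    forall i z, enorm z <= d -> `|'D_(bas i) f (x - z) - 'D_(bas i) f x| <= C * enorm z `^ 0].
  apply: (@uniform_modulus (fun i y => 'D_(bas i) f y)) => // i.
  have [d d0 hd] := continuousP_enorm (cD i x) ltr01.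
  by exists 1, d; split => // z /hd; rewrite powRr0 mul1r.
exists (n%:R * (M + enorm (grad f x))), d; split => //.
  by rewrite mulr_ge0// addr_ge0// enorm_ge0.
move=> z zd; have [t /andP[t0 t1] ->] := mean_value x z df.
rewrite normrN powRr1 ?enorm_ge0//; apply: dot_le_sum => i; rewrite mxE.
have := hM i (t *: z); rewrite powRr0 mulr1 => /(_ _) H.
have {}H : `|'D_(bas i) f (x - t *: z) - 'D_(bas i) f x| <= M.
  apply: H; rewrite enormZ ger0_norm//; apply: le_trans zd.
  by rewrite ler_piMl// enorm_ge0.
have := coord_le_enorm (grad f x) i; rewrite mxE => H2.
rewrite -[X in `|X|](subrK ('D_(bas i) f x)).
by apply: le_trans (ler_normD _ _) _; rewrite lerD.
Qed.

Lemma taylor1 f x (b : R) : 0 <= b -> (forall y, differentiable f y) ->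
  (forall i, exists C d : R, [/\ 0 <= C, 0 < d & forall z, enorm z <= d ->
     `|'D_(bas i) f (x - z) - 'D_(bas i) f x| <= C * enorm z `^ b]) ->
  exists C d : R, [/\ 0 <= C, 0 < d & forall z, enorm z <= d ->
     `|f (x - z) - f x + dot (grad f x) z| <= C * enorm z `^ (b + 1)].
Proof.
move=> b0 df /(@uniform_modulus (fun i y => 'D_(bas i) f y) _ _ b0)[C [d [C0 d0 hC]]].
exists (n%:R * C), d; split => //; first by rewrite mulr_ge0.
move=> z zd; have [t /andP[t0 t1] ->] := mean_value x z df.
rewrite -normrN opprD opprK -dotBl.
have [->|z0] := eqVneq z 0.
  rewrite /dot big1 ?normr0 ?mulr_ge0 ?powR_ge0// => i _; by rewrite [(0 : V) 0 i]mxE mulr0.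
have zp : 0 < enorm z by rewrite enorm_gt0.
rewrite powRD; last by apply/implyP => _; rewrite gt_eqF.
rewrite powRr1 ?enorm_ge0// mulrA -(mulrA n%:R); apply: dot_le_sum => i; rewrite !mxE.
have tz : enorm (t *: z) <= enorm z by rewrite enormZ ger0_norm// ler_piMl// enorm_ge0.
apply: le_trans (hC i (t *: z) (le_trans tz zd)) _.
by rewrite ler_wpM2l// ge0_ler_powR ?nnegrE ?enorm_ge0.
Qed.

(** With [a0 = 2 * s], exactly what a principal value needs at [x]: the linear term is odd and drops
    out, and the remainder is of an order greater than [2 * s], hence integrable against the kernel
    near 0. For a function that is merely Holder, [p] may be 0. *)
Definition taylor_at (a0 : R) f x := exists a C d (p : V),
  [/\ a0 < a, 0 <= C, 0 < d & forall z, enorm z <= d ->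
    `|f (x - z) - f x + dot p z| <= C * enorm z `^ a].

(** For [k = 0] the Holder bound is the expansion, with no linear term. Otherwise it is the first
    order one, whose remainder never has an order above 2: hence [a0 < 2], which for [a0 = 2 * s]
    means [s < 1]. *)
Lemma Ck_taylor k (b a0 : R) f x : 0 < b -> b <= 1 -> a0 < k%:R + b -> a0 < 2 ->
  Ck_holder_loc k b f -> taylor_at a0 f x.
Proof.
move=> b0 b1; case: k => [|k] ha h2 hf.
  have [C C0 hC] := holder_modulus x b0 hf.
  exists b, C, 1, 0; split => //; first by rewrite add0r in ha.
  move=> z /hC; have -> : dot 0 z = 0 by rewrite /dot big1// => i _; rewrite mxE mul0r.
  by rewrite addr0.
case: hf => df hD.
have [c [c0 cb hc]] : exists c : R, [/\ 0 <= c, a0 < c + 1 & forall i, exists C d : R, [/\ 0 <= C, 0 < d & forall z, enorm z <= d ->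
     `|'D_(bas i) f (x - z) - 'D_(bas i) f x| <= C * enorm z `^ c]].
  exists (if k is 0%N then b else 1); split.
  - by case: k {ha hD} => [|k] //; exact: ltW.
  - by case: k ha {hD} => [|k] ha; [rewrite addrC|lra].
  - by move=> i; exact: Ck_modulus (hD i).
have [C [d [C0 d0 hC]]] := taylor1 c0 df hc.
by exists (c + 1), C, d, (grad f x).
Qed.

End calculus.

(** * The cutoff *)

Section cutoff.
Variables (R : realType) (n : nat).
Local Notation V := 'rV[R]_n.
Local Notation bas := (@Defs.basis R n).
Implicit Types (x y z e : V) (r : R).

(** One remainder bound gives both differentiability and the value of the derivative; for [sqplus]
    it also settles the point 0. *)
Lemma is_derive_quadratic (f : R -> R) (t d C : R) :
  (forall h, `|f (h + t) - f t - d * h| <= C * h ^+ 2) -> is_derive t (1 : R) f d.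
Proof.
move=> hf.
have C0 : 0 <= C.
  by have := hf 1; rewrite expr1n !mulr1 => H; exact: le_trans (normr_ge0 _) H.
have cv : (fun h : R => h^-1 *: ((f \o shift t) (h *: (1 : R)) - f t)) @ 0^' --> d.
  apply/cvgrPdist_le => c c0; near=> h.
  have h0 : h != 0 by near: h; exact: nbhs_dnbhs_neq.
  have hc : `|h| < c / (C + 1).
    by near: h; apply: dnbhs0_lt; rewrite divr_gt0//; lra.
  rewrite /shift/= /GRing.scale/= mulr1 -(mulfK h0 d) (mulrC (d * h)) -mulrBr normrM distrC.
  apply: le_trans (ler_wpM2l (normr_ge0 _) (hf h)) _.
  rewrite normfV -(real_normK (num_real h)).
  have hp : 0 < `|h| by rewrite normr_gt0.
  have -> : `|h|^-1 * (C * `|h| ^+ 2) = C * `|h| by field; rewrite gt_eqF.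
  move: hc; rewrite ltr_pdivlMr; last lra.
  by nra.
apply: DeriveDef; first by apply/cvg_ex; exists d.
exact/cvg_lim.
Unshelve. all: by end_near. Qed.

Definition sqplus (t : R) : R := Num.max t 0 ^+ 2.

Lemma is_derive_sqplus (t : R) : is_derive t (1 : R) sqplus (2 * Num.max t 0).
Proof.
apply: (@is_derive_quadratic _ _ _ 1) => h; rewrite /sqplus mul1r ler_norml.
by case: (leP t 0) => t0; case: (leP (h + t) 0) => ht; apply/andP; split; nra.
Qed.

Lemma sqplus_ge0 (t : R) : 0 <= sqplus t.
Proof. exact: sqr_ge0. Qed.

Lemma derive_comp_real (h : R -> R) (h' : R) (g : V -> R) z e :
  differentiable g z -> is_derive (g z) (1 : R) h h' ->
  differentiable (h \o g) z /\ 'D_e (h \o g) z = h' * 'D_e g z.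
Proof.
move=> dg [dh <-]; have dh' : differentiable h (g z) by exact/derivable1_diffP.
split; first exact: differentiable_comp.
rewrite !deriveE//; last exact: differentiable_comp.
by rewrite diff_comp//= diff1E//= /GRing.scale/= mul1r mulrC.
Qed.

Lemma differentiable_enorm_sqr z : differentiable (fun z : V => enorm z ^+ 2) z.
Proof.
have -> : (fun z : V => enorm z ^+ 2) = \sum_(i < n) ((fun z : V => z 0 i) ^+ 2).
  by apply/funext => y; rewrite enorm_sqr fct_sumE; apply: eq_bigr => i _; rewrite fctE.
by apply: differentiable_sum => i; apply: differentiableX; exact: differentiable_coord.
Qed.

Lemma enorm_sqr_line z i (h : R) : enorm (z + h *: bas i) ^+ 2 = enorm z ^+ 2 + 2 * h * z 0 i + h ^+ 2.
Proof.
rewrite !enorm_sqr (bigD1 i)//= [in RHS](bigD1 i)//= !mxE !eqxx/= mulr1.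
rewrite (eq_bigr (fun j => z 0 j ^+ 2)); first by ring.
by move=> j ji; rewrite !mxE (negbTE ji) andbF mulr0 addr0.
Qed.

Lemma derive_enorm_sqr z i : 'D_(bas i) (fun z : V => enorm z ^+ 2) z = 2 * z 0 i.
Proof.
have := @is_derive_line R n (fun z : V => enorm z ^+ 2) z (bas i) 0.
rewrite scale0r addr0 => /(_ (diff_derivable (@differentiable_enorm_sqr z))) [_ <-].
suff [_ ->] : is_derive (0 : R) (1 : R) (fun s : R => enorm (z + s *: bas i) ^+ 2) (2 * z 0 i) by [].
apply: (@is_derive_quadratic _ _ _ 1) => h.
rewrite !enorm_sqr_line addr0 mul1r.
rewrite (_ : _ - _ - _ = h ^+ 2); last by ring.
by rewrite ger0_norm ?sqr_ge0.
Qed.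

(** Zero for [|z| <= r] and 1 once [|z|^2 >= 2 r^2]. It is a function of [|z|^2], which is a
    polynomial. It has a corner at [|z| = r], but its square is differentiable, as [sqplus] is. *)
Definition chi (r : R) z : R := Num.max (1 - sqplus (2 - enorm z ^+ 2 / r ^+ 2)) 0.

(* The gradient of a square is controlled by [chi] itself, which lets AM-GM absorb it
   into [psi]. *)
Definition psi (r : R) z : R := chi r z ^+ 2.

Lemma chi_ge0 r z : 0 <= chi r z.
Proof. by rewrite le_max lexx orbT. Qed.

Lemma chi_le1 r z : chi r z <= 1.
Proof. by rewrite ge_max ler01 andbT gerBl sqplus_ge0. Qed.

Lemma psi_ge0 r z : 0 <= psi r z.
Proof. exact: sqr_ge0. Qed.

Lemma psi_le1 r z : psi r z <= 1.
Proof. by rewrite /psi expr_le1 ?chi_ge0 ?chi_le1. Qed.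

Lemma psi_le_chi r z : psi r z <= chi r z.
Proof. by rewrite /psi expr2 ler_piMl ?chi_ge0 ?chi_le1. Qed.

Lemma psiN r z : psi r (- z) = psi r z.
Proof. by rewrite /psi /chi enormN. Qed.

Lemma psi_in r z : 0 < r -> enorm z <= r -> psi r z = 0.
Proof.
move=> r0 zr; rewrite /psi /chi max_r ?expr0n//.
have t1 : enorm z ^+ 2 / r ^+ 2 <= 1.
  by rewrite ler_pdivrMr ?exprn_gt0// mul1r lerXn2r ?nnegrE ?enorm_ge0// ltW.
rewrite /sqplus max_l; last lra.
by nra.
Qed.

Lemma psi_out r z : 0 < r -> 2 * r <= enorm z -> psi r z = 1.
Proof.
move=> r0 zr; have t1 : 2 <= enorm z ^+ 2 / r ^+ 2.
  by rewrite ler_pdivlMr ?exprn_gt0//; nra.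
have m0 : Num.max (2 - enorm z ^+ 2 / r ^+ 2) 0 = 0 by rewrite max_r//; lra.
rewrite /psi /chi /sqplus m0 expr0n/= subr0.
by rewrite max_l ?expr1n.
Qed.

Lemma psi_derive r z i : 0 < r ->
  differentiable (psi r) z /\
  'D_(bas i) (psi r) z =
    2 * chi r z * (2 * Num.max (2 - enorm z ^+ 2 / r ^+ 2) 0 * (2 * z 0 i / r ^+ 2)).
Proof.
move=> r0.
pose q (t : R) := 1 - sqplus (2 - t / r ^+ 2).
have dq (t : R) : is_derive t (1 : R) q (2 * Num.max (2 - t / r ^+ 2) 0 * (r ^+ 2)^-1).
  have h1 : is_derive t (1 : R) (fun t : R => 2 - t / r ^+ 2) (- (r ^+ 2)^-1).
    apply: (@is_derive_quadratic _ _ _ 0) => h.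
    by rewrite (_ : _ - _ - _ = 0) ?normr0 ?mul0r//; ring.
  have h2 := @is_derive1_comp R sqplus (fun t : R => 2 - t / r ^+ 2) t _ _ (is_derive_sqplus _) h1.
  have := is_deriveB (is_derive_cst (1 : R) t (1 : R)) h2.
  by rewrite sub0r mulrN opprK.
have [d1 e1] := @derive_comp_real q _ (fun z : V => enorm z ^+ 2) z (bas i) (differentiable_enorm_sqr z) (dq _).
have [d2 e2] := @derive_comp_real sqplus _ _ z (bas i) d1 (is_derive_sqplus _).
split; first exact: d2.
have -> : psi r = sqplus \o (q \o (fun z : V => enorm z ^+ 2)) by [].
rewrite e2 e1 derive_enorm_sqr /= -/(chi r z) /q.
by rewrite /chi; ring.
Qed.

Lemma psi_differentiable r z : 0 < r -> differentiable (psi r) z.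
Proof.
move=> r0; have -> : psi r = sqplus \o ((fun t => 1 - sqplus (2 - t / r ^+ 2)) \o (fun z : V => enorm z ^+ 2)) by [].
(* [psi_derive] asks for a coordinate; in dimension 0 every function is constant. *)
case: (posnP n) => [n0|n0]; last by have [] := psi_derive z (Ordinal n0) r0.
have E (y : V) : y = z by apply/rowP => i; exfalso; move: i; rewrite n0; case.
have -> : sqplus \o ((fun t => 1 - sqplus (2 - t / r ^+ 2)) \o (fun z : V => enorm z ^+ 2)) = cst (psi r z).
  by apply/funext => y; rewrite (E y).
exact: differentiable_cst.
Qed.

(** Where the derivative does not vanish, the inner positive part is at most 1 and [|z|^2 < 2 r^2],
    so that [|z_i| / r^2 <= 2 / |z|]. Four factors 2 make 16. *)
Lemma psi_grad r z i : 0 < r -> z != 0 ->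
  `|'D_(bas i) (psi r) z| <= 16 * chi r z / enorm z.
Proof.
move=> r0 z0; have [_ ->] := psi_derive z i r0.
have zp : 0 < enorm z by rewrite enorm_gt0.
have rp : 0 < r ^+ 2 by rewrite exprn_gt0.
rewrite !normrM (ger0_norm (chi_ge0 r z)) normfV !normr_nat (ger0_norm (ltW rp)).
have [->|c0] := eqVneq (chi r z) 0; first by rewrite !mulr0 !mul0r.
have cp : 0 < chi r z by rewrite lt_neqAle eq_sym c0 chi_ge0.
set w := Num.max (2 - enorm z ^+ 2 / r ^+ 2) 0.
have w0 : 0 <= w by rewrite le_max lexx orbT.
have w1 : w <= 1.
  move: cp; rewrite /chi lt_max ltxx orbF subr_gt0 /sqplus -/w => w1.
  by rewrite -(@ler_pXn2r _ 2)// ?nnegrE// expr1n ltW.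
rewrite (ger0_norm w0).
have zi := coord_le_enorm z i.
have key : w * (`|z 0 i| / r ^+ 2) <= 2 / enorm z.
  have [->|wn] := eqVneq w 0; first by rewrite mul0r divr_ge0// ltW.
  have wp : 0 < w by rewrite lt_neqAle eq_sym wn.
  move: (wp); rewrite /w lt_max ltxx orbF subr_gt0 ltr_pdivrMr// => z2.
  rewrite -[leRHS]mul1r ler_pM// ?divr_ge0 ?(ltW rp)//.
  rewrite ler_pdivrMr// -mulrA mulrC mulrAC -mulrA.
  rewrite ler_pdivlMl//.
  apply: (@le_trans _ _ (enorm z * enorm z)); first by rewrite ler_pM2l.
  by rewrite -expr2 ltW.
have -> : 2 * chi r z * (2 * w * (2 * `|z 0 i| / r ^+ 2)) = 8 * chi r z * (w * (`|z 0 i| / r ^+ 2)) by ring.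
have -> : 16 * chi r z / enorm z = 8 * chi r z * (2 / enorm z) by ring.
by rewrite ler_wpM2l// mulr_ge0// ltW.
Qed.

Lemma chi_continuous r : 0 < r -> continuous (chi r).
Proof.
move=> r0 z; have c1 : {for z, continuous (fun y : V => 1 - sqplus (2 - enorm y ^+ 2 / r ^+ 2))}.
  apply: (@continuous_comp _ _ _ (fun y : V => enorm y ^+ 2) (fun t => 1 - sqplus (2 - t / r ^+ 2))).
    exact: differentiable_continuous (differentiable_enorm_sqr z).
  apply: (@continuous_comp _ _ _ (fun t : R => 2 - t / r ^+ 2) (fun t => 1 - sqplus t)).
    apply: continuousB; first exact: cst_continuous.
    by apply: continuousM; [exact: cvg_id|exact: cst_continuous].
  apply: continuousB; first exact: cst_continuous.
  apply: differentiable_continuous; apply/derivable1_diffP.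
  by case: (is_derive_sqplus (2 - enorm z ^+ 2 / r ^+ 2)).
apply: (@continuous_comp _ _ _ (fun y : V => 1 - sqplus (2 - enorm y ^+ 2 / r ^+ 2)) (fun t => Num.max t 0)).
  exact: c1.
have -> : (fun t : R => Num.max t 0) = (fun t : R => (t + `|t|) / 2).
  apply/funext => t; case: (leP t 0) => t0; first by rewrite ler0_norm//; lra.
  by rewrite gtr0_norm//; lra.
apply: continuousM; last exact: cst_continuous.
by apply: continuousD; [exact: cvg_id|exact: norm_continuous].
Qed.

Lemma psi_continuous r : 0 < r -> continuous (psi r).
Proof. by move=> r0 z; apply: continuousM; exact: chi_continuous. Qed.

End cutoff.

#[local] Opaque psi.

(** * Convergence of the principal values *)

Section tails.
Variables (R : realType) (n : nat).
Local Notation T := (measurableTypeR R).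
Local Notation V := 'rV[R]_n.
Local Notation bas := (@Defs.basis R n).
Local Notation mu := (lebesgue_measure_tuple R n).
Implicit Types (x y z e p : V) (f g : V -> R) (r t : R).

Lemma tint_shell f r t : continuous_off0 f -> (forall z, enorm z <= r -> f z = 0) ->
  0 < t -> t < r -> r <= t^-1 -> tint f t = integ (shell r t^-1) f.
Proof.
move=> cf f0 t0 tr rt; have r0 : 0 < r by exact: lt_trans tr.
have E : core t = radial `]t, r[ `|` shell r t^-1 :> set (n.-tuple T).
  apply/seteqP; split => y; rewrite /core/shell/radial/= !in_itv/=.
    move=> /andP[h1 h2]; case: (ltP (enorm (rvec y)) r) => h; [left|right].
      by rewrite h1.
    by rewrite h2.
  case=> /andP[h1 h2]; apply/andP; split => //; first exact: lt_le_trans h2 rt.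
  exact: lt_le_trans tr h1.
have mr : measurable (radial `]t, r[ : set (n.-tuple T)).
  by apply: measurable_radial; exact: measurable_itv.
rewrite /tint /integ E Rintegral_setU//.
- rewrite (@eq_Rintegral _ _ _ _ _ (fun=> 0)); last first.
    by move=> y; rewrite inE /radial/= in_itv/= => /andP[_ h]; apply: f0; exact: ltW.
  by rewrite Rintegral_cst// mul0r add0r.
- exact: measurable_shell.
- by rewrite -E; exact: core_integrable.
- apply/disj_setPS => y [] /=; rewrite /shell/radial/= !in_itv/= => /andP[_ h1] /andP[h2 _].
  by move: (lt_le_trans h1 h2); rewrite ltxx.
Qed.

(** Cauchy's criterion: two truncations differ by a shell integral at infinity. The decay is assumed
    of signed integrals, so conditional convergence is covered. *)
Lemma tint_tail_cvg f (r A d : R) : continuous_off0 f ->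
  (forall z, enorm z <= r -> f z = 0) -> 0 < r -> 0 < d -> 0 <= A ->
  (forall r1 r2, r <= r1 -> r1 < r2 -> `|integ (shell r1 r2) f| <= A * r1 `^ (- d)) ->
  exists l : R, tint f t @[t --> 0^'+] --> l.
Proof.
move=> cf f0 r0 d0 A0 hA.
suff : cvg (tint f t @[t --> 0^'+]) by move=> /cvg_ex[l hl]; exists l.
apply/cauchy_cvgP; apply: cauchy_exP => c c0.
have A1 : 0 < A + 1 by lra.
(* Below [t0] the inner edge of the truncation lies in the zero set of [f], the outer one lies
   beyond [r], and the tail bound [A * t0 ^ d] is less than [c]. *)
pose t0 := Num.min (Num.min (r / 2) r^-1) ((c / (A + 1)) `^ d^-1).
have cA : 0 < c / (A + 1) by rewrite divr_gt0.
have t00 : 0 < t0 by rewrite !lt_min divr_gt0//= invr_gt0 r0 powR_gt0.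
have t0r : t0 < r.
  by apply: (@le_lt_trans _ _ (r / 2)); [rewrite !ge_min lexx|lra].
have t0r' : r <= t0^-1.
  by rewrite -[leLHS]invrK lef_pV2 ?posrE ?invr_gt0// !ge_min lexx orbT.
have t0c : A * t0 `^ d < c.
  have h : t0 `^ d <= c / (A + 1).
    have h1 : t0 <= (c / (A + 1)) `^ d^-1 by rewrite ge_min lexx orbT.
    have := @ge0_ler_powR R d (ltW d0) _ _ _ _ h1.
    rewrite !nnegrE powR_ge0 (ltW t00) => /(_ isT isT).
    by rewrite -powRrM mulVf ?gt_eqF// powRr1// ltW.
  apply: le_lt_trans (ler_wpM2l A0 h) _.
  by rewrite mulrA ltr_pdivrMr//; nra.
exists (tint f t0).
suff H : \forall t \near 0^'+, ball (tint f t0) c (tint f t) by exact: H.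
near=> t.
have tp : 0 < t by near: t; exact: nbhs_right_gt.
have tt0 : t < t0 by near: t; exact: nbhs_right_lt.
rewrite -ball_normE/= distrC.
have tV : t0^-1 < t^-1 by rewrite ltf_pV2 ?posrE.
have tr : t < r by exact: lt_trans t0r.
have rt : r <= t^-1 by apply: le_trans t0r' (ltW _).
rewrite (tint_shell cf f0 tp tr rt) (tint_shell cf f0 t00 t0r t0r').
rewrite (@integ_shellU _ _ _ r t0^-1 t^-1)//; last exact: ltW.
rewrite addrAC subrr add0r; apply: le_lt_trans (hA _ _ t0r' tV) _.
have -> : t0^-1 `^ (- d) = t0 `^ d by rewrite -powR_inv1 ?(ltW t00)// -powRrM mulN1r opprK.
by [].
Unshelve. all: by end_near. Qed.

Lemma continuous_off0_sum (I : Type) (q : seq I) (F : I -> V -> R) :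
  (forall i, continuous_off0 (F i)) -> continuous_off0 (fun z => \sum_(i <- q) F i z).
Proof.
move=> cF; elim: q => [|i q IH].
  have -> : (fun z : V => \sum_(i <- [::]) F i z) = (fun=> 0) by apply/funext => z; rewrite big_nil.
  exact: continuous_off0_cst.
have -> : (fun z : V => \sum_(j <- i :: q) F j z) = (fun z => F i z + \sum_(j <- q) F j z).
  by apply/funext => z; rewrite big_cons.
exact: continuous_off0D.
Qed.

Lemma tint_sum_cvg (I : Type) (q : seq I) (F : I -> V -> R) :
  (forall i, continuous_off0 (F i)) ->
  (forall i, exists l : R, tint (F i) t @[t --> 0^'+] --> l) ->
  exists l : R, tint (fun z => \sum_(i <- q) F i z) t @[t --> 0^'+] --> l.
Proof.
move=> cF hF; elim: q => [|i q [l hl]].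
  exists 0; apply: (@cvg_near0_ext _ _ (fun=> 0)); last exact: cvg_cst.
  move=> t t0; under eq_fun do rewrite big_nil.
  by rewrite /tint /integ Rintegral_cst ?mul0r//; exact: measurable_core.
have [m hm] := hF i; exists (m + l).
apply: cvg_near0_ext (cvgD hm hl) => t t0.
under eq_fun do rewrite big_cons.
by rewrite tintD//; exact: continuous_off0_sum.
Qed.

Lemma cvg_tintZ f (c l : R) : continuous_off0 f ->
  tint f t @[t --> 0^'+] --> l -> tint (fun z => c * f z) t @[t --> 0^'+] --> c * l.
Proof.
move=> cf hl; apply: (@cvg_near0_ext _ _ (fun t => c * tint f t)).
  by move=> t t0; exact: tintZ.
by apply: cvgM => //; exact: cvg_cst.
Qed.

Lemma cvg_tintD f g (l m : R) : continuous_off0 f -> continuous_off0 g ->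
  tint f t @[t --> 0^'+] --> l -> tint g t @[t --> 0^'+] --> m ->
  tint (fun z => f z + g z) t @[t --> 0^'+] --> l + m.
Proof.
move=> cf cg hl hm; apply: cvg_near0_ext (cvgD hl hm) => t t0.
by rewrite tintD.
Qed.

(** The conditions behind convergence and integration by parts, for a real-valued kernel. The lower
    bound, on which the absorption rests, is a separate hypothesis later. *)
Definition regular_kernel (s L : R) (k : V -> R) := [/\ forall z, 0 <= k z,
  forall z, z != 0 -> k z <= L * epow (- (2 * s)) z,
  forall z, z != 0 -> differentiable k z &
  forall i z, z != 0 -> `|'D_(bas i) k z| <= L / enorm z * k z].

Variables (s L : R) (k : V -> R).
Hypotheses (s0 : 0 < s) (L0 : 0 <= L) (hk : regular_kernel s L k).

Let k0 z : 0 <= k z. Proof. by case: hk. Qed.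
Let kL z : z != 0 -> k z <= L * epow (- (2 * s)) z. Proof. by case: hk => _ + _ _; exact. Qed.
Let dk z : z != 0 -> differentiable k z. Proof. by case: hk => _ _ + _; exact. Qed.

Lemma kernel_continuous : continuous_off0 k.
Proof. by move=> z z0; apply: differentiable_continuous; exact: dk. Qed.

(* A bound for the partial derivatives of [psi r * k]. *)
Definition weight r z : R := (16 + L) * (chi r z * k z / enorm z).

Lemma weight_ge0 r z : 0 <= weight r z.
Proof.
rewrite /weight mulr_ge0//; first by rewrite addr_ge0.
by rewrite divr_ge0 ?enorm_ge0// mulr_ge0 ?chi_ge0.
Qed.

Lemma continuous_off0_invnorm : continuous_off0 (fun z => (enorm z)^-1).
Proof.
by move=> z z0; apply: continuousV; [rewrite gt_eqF// enorm_gt0|exact: enorm_continuous].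
Qed.

Lemma weight_continuous r : 0 < r -> continuous_off0 (weight r).
Proof.
move=> r0; apply: continuous_off0M; first exact: continuous_off0_cst.
apply: continuous_off0M; last exact: continuous_off0_invnorm.
by apply: continuous_off0M; [exact/continuous_off0_cont/chi_continuous|exact: kernel_continuous].
Qed.

Lemma psik_continuous r : 0 < r -> continuous_off0 (fun z => psi r z * k z).
Proof.
by move=> r0; apply: continuous_off0M; [exact/continuous_off0_cont/psi_continuous|exact: kernel_continuous].
Qed.

(** The product rule gives [L * psi + 16 * chi] times [k / |z|], and [psi <= chi]. *)
Lemma psik_derive r i z : 0 < r -> z != 0 ->
  differentiable (fun z => psi r z * k z) z /\
  `|'D_(bas i) (fun z => psi r z * k z) z| <= weight r z.
Proof.
move=> r0 z0; have dp := @psi_differentiable R n r z r0.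
split; first by apply: differentiableM => //; exact: dk.
have -> : 'D_(bas i) (fun z => psi r z * k z) z =
    psi r z * 'D_(bas i) k z + k z * 'D_(bas i) (psi r) z.
  by apply: deriveM; apply: diff_derivable => //; exact: dk.
have zp : 0 < enorm z by rewrite enorm_gt0.
apply: le_trans (ler_normD _ _) _; rewrite (normrM (psi r z)) (normrM (k z)).
rewrite (ger0_norm (psi_ge0 r z)) (ger0_norm (k0 z)).
have [_ _ _ hD] := hk.
have h1 := ler_wpM2l (psi_ge0 r z) (hD i z z0).
have h2 := ler_wpM2l (k0 z) (psi_grad i r0 z0).
apply: le_trans (lerD h1 h2) _.
rewrite /weight.
have -> : psi r z * (L / enorm z * k z) + k z * (16 * chi r z / enorm z) =
   (L * psi r z + 16 * chi r z) * (k z / enorm z) by ring.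
have -> : (16 + L) * (chi r z * k z / enorm z) = ((16 + L) * chi r z) * (k z / enorm z) by ring.
apply: ler_wpM2r; first by rewrite divr_ge0// ltW.
by have h := psi_le_chi r z; have := ler_wpM2l L0 h; lra.
Qed.

Lemma weight_le r z : z != 0 -> weight r z <= (16 + L) * L * epow (- (2 * s + 1)) z.
Proof.
move=> z0; have zp : 0 < enorm z by rewrite enorm_gt0.
have zn0 : enorm z != 0 by rewrite gt_eqF.
rewrite /weight -[leRHS]mulrA; apply: ler_wpM2l; first by rewrite addr_ge0.
have -> : epow (- (2 * s + 1)) z = epow (- (2 * s)) z / enorm z.
  rewrite /epow -[X in _ / X](powRr1 (ltW zp)) -powRB ?zn0 ?implybT//; congr (_ `^ _); ring.
rewrite mulrA ler_pM2r ?invr_gt0//.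
apply: le_trans (kL z0); rewrite ler_piMl ?chi_le1//.
Qed.

(** The boundary term of [integ_by_parts] on the sphere of radius [r], for a product of size
    [r ^ (d - n)] there. *)
Lemma sphere_power r (d : R) : 0 < r -> r `^ (d - n%:R) / r * (2 * r) ^+ n = 2 ^+ n * r `^ (d - 1).
Proof.
move=> r0; have rn0 : r != 0 by rewrite gt_eqF.
rewrite exprMn mulrCA; congr (_ * _).
rewrite -(powR_mulrn n (ltW r0)) -[X in _ / X](powRr1 (ltW r0)) -powRB ?rn0 ?implybT//.
by rewrite -powRD ?rn0 ?implybT//; congr (_ `^ _); ring.
Qed.

(** The inner boundary term disappears when [r1 = r], because [psi r] vanishes on that sphere. This
    is what makes the bound useful on the whole support of [psi r], and not only in the tail. *)
Lemma far_estimate i (U : V -> R) (B r r1 r2 : R) : 0 < r -> r <= r1 -> r1 < r2 -> 0 <= B ->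
  (forall z, differentiable U z) -> continuous (fun z => 'D_(bas i) U z) ->
  (forall z, `|U z| <= B) ->
  `|integ (shell r1 r2) (fun z => 'D_(bas i) U z * (psi r z * k z))| <=
    integ (shell r1 r2) (fun z => `|U z| * weight r z)
    + (if r < r1 then B * L * 2 ^+ n * r1 `^ (- (2 * s + 1)) else 0)
    + B * L * 2 ^+ n * r2 `^ (- (2 * s + 1)).
Proof.
move=> r0 rr1 r12 B0 dU cDU UB; have r10 : 0 < r1 by exact: lt_le_trans rr1.
have r20 : 0 < r2 by exact: lt_trans r12.
pose M (q : R) := B * (L * q `^ (- (2 * s) - n%:R)).
have M0 q : 0 <= M q by rewrite /M !mulr_ge0// powR_ge0.
have hM q z : 0 < q -> enorm z = q -> `|U z * (psi r z * k z)| <= M q.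
  move=> q0 zq; have z0 : z != 0 by rewrite -enorm_gt0 zq.
  rewrite normrM; apply: ler_pM => //.
  have kk : `|psi r z * k z| <= k z.
    rewrite ger0_norm; last by apply: mulr_ge0; [exact: psi_ge0|exact: k0].
    by apply: ler_piMl; [exact: k0|exact: psi_le1].
  by apply: le_trans kk _; apply: le_trans (kL z0) _; rewrite /epow zq.
have hM' z : enorm z = r1 -> `|U z * (psi r z * k z)| <= if r < r1 then M r1 else 0.
  case: ifPn => [_|]; first exact: hM.
  rewrite -leNgt => h zr; rewrite psi_in ?zr// mul0r mulr0 normr0.
  by [].
have M0' : 0 <= if r < r1 then M r1 else 0 by case: ifP.
have := @integ_by_parts R n i U (fun z => psi r z * k z) (weight r) r1 r2 _ _ r10 r12 M0' (M0 r2)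
  dU cDU _ (weight_continuous r0) _ hM' (fun z => hM r2 z r20).
move=> H; apply: le_trans (H _ _) _.
- by move=> z z0; have [] := psik_derive i r0 z0.
- by move=> z z0; have [] := psik_derive i r0 z0.
have E q : 0 < q -> M q / q * (2 * q) ^+ n = B * L * 2 ^+ n * q `^ (- (2 * s + 1)).
  move=> q0; have := sphere_power (- (2 * s)) q0 => E.
  rewrite /M -(mulrA _ (2 ^+ n)) (_ : - (2 * s + 1) = - (2 * s) - 1); last by ring.
  by rewrite -E; ring.
rewrite E// lerD2r lerD2l; case: ifP => _; first by rewrite E.
by rewrite !mul0r.
Qed.

(* Although ['D_i U] may grow, its integral against [psi * k] converges conditionally. *)
Lemma far_cvg i (U : V -> R) (B r : R) : 0 < r -> 0 <= B ->
  (forall z, differentiable U z) -> continuous (fun z => 'D_(bas i) U z) ->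
  (forall z, `|U z| <= B) ->
  exists l : R, tint (fun z => 'D_(bas i) U z * (psi r z * k z)) t @[t --> 0^'+] --> l.
Proof.
move=> r0 B0 dU cDU UB.
have d0 : 0 < 2 * s + 1 by have := s0; lra.
have [C C0 hC] := integ_epow_far n d0.
have cU : continuous_off0 U by move=> z _; exact: differentiable_continuous.
pose A := B * ((16 + L) * L) * C + B * L * 2 ^+ n + B * L * 2 ^+ n.
have BL0 : 0 <= B * L * 2 ^+ n by rewrite !mulr_ge0// exprn_ge0.
have BL1 : 0 <= B * ((16 + L) * L) by rewrite !mulr_ge0// addr_ge0.
apply: (@tint_tail_cvg _ r A (2 * s + 1)) => //.
- by apply: continuous_off0M; [exact: continuous_off0_cont|exact: psik_continuous].
- by move=> z zr; rewrite psi_in// mul0r mulr0.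
- by rewrite !addr_ge0// mulr_ge0.
move=> r1 r2 rr1 r12; have r10 : 0 < r1 by exact: lt_le_trans rr1.
have p0 : 0 <= r1 `^ (- (2 * s + 1)) by exact: powR_ge0.
apply: le_trans (far_estimate r0 rr1 r12 B0 dU cDU UB) _.
have h1 : integ (shell r1 r2) (fun z => `|U z| * weight r z) <= B * ((16 + L) * L) * (C * r1 `^ (- (2 * s + 1))).
  apply: le_trans (ler_wpM2l BL1 (hC r1 r2 r10 (ltW r12))).
  rewrite -integ_shellZ//; last exact: epow_continuous.
  apply: (@integ_le _ _ _ _ _ r1 r2) => //.
  - by apply: continuous_off0M; [exact: continuous_off0_norm|exact: weight_continuous].
  - by apply: continuous_off0M; [exact: continuous_off0_cst|exact: epow_continuous].
  - exact: measurable_shell.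
  - by move=> y; exact: shell_bounds.
  - move=> z h _; have z0 : z != 0 by rewrite -enorm_gt0; exact: lt_le_trans h.
    by rewrite -mulrA; apply: ler_pM => //; [exact: weight_ge0|exact: weight_le].
have h2 : (if r < r1 then B * L * 2 ^+ n * r1 `^ (- (2 * s + 1)) else 0) <= B * L * 2 ^+ n * r1 `^ (- (2 * s + 1)).
  by case: ifP => // _; exact: mulr_ge0.
have h3 : B * L * 2 ^+ n * r2 `^ (- (2 * s + 1)) <= B * L * 2 ^+ n * r1 `^ (- (2 * s + 1)).
  by rewrite ler_wpM2l// ler_powRn// ?(ltW r12)// oppr_le0 ltW.
rewrite /A; lra.
Qed.

(** [far_estimate] between the radii [r] and [1 / t]: only the outer sphere contributes, by a term
    that tends to 0 with [t]. *)
Lemma far_tint i (U : V -> R) (B r : R) : 0 < r -> 0 <= B ->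
  (forall z, differentiable U z) -> continuous (fun z => 'D_(bas i) U z) ->
  (forall z, `|U z| <= B) ->
  forall t, 0 < t -> t < r -> r < t^-1 ->
  `|tint (fun z => 'D_(bas i) U z * (psi r z * k z)) t| <=
   tint (fun z => `|U z| * weight r z) t + B * L * 2 ^+ n * t `^ (2 * s + 1).
Proof.
move=> r0 B0 dU cDU UB t t0 tr rt.
have cU : continuous_off0 U by move=> z _; exact: differentiable_continuous.
rewrite !(@tint_shell _ r) ?(ltW rt)//.
- apply: le_trans (far_estimate r0 (lexx r) rt B0 dU cDU UB) _.
  rewrite ltxx addr0 lerD2l; have -> : t^-1 `^ (- (2 * s + 1)) = t `^ (2 * s + 1); last by [].
  by rewrite -powR_inv1 ?(ltW t0)// -powRrM mulN1r opprK.
- by apply: continuous_off0M; [exact: continuous_off0_norm|exact: weight_continuous].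
- move=> z zr; rewrite /weight (_ : chi r z = 0) ?mul0r ?mulr0//.
  by apply/eqP; rewrite -sqrf_eq0; apply/eqP; exact: psi_in.
- by apply: continuous_off0M; [exact: continuous_off0_cont|exact: psik_continuous].
- by move=> z zr; rewrite psi_in// mul0r mulr0.
Qed.

Hypothesis kN : forall z, k (- z) = k z.

Lemma shift_continuous f x : continuous f -> continuous (fun z => f (x - z)).
Proof.
move=> cf z; apply: (@continuous_comp _ _ _ (fun z => x - z) f); last exact: cf.
by apply: continuousB; [exact: cst_continuous|exact: cvg_id].
Qed.

(** The Taylor expansion handles the singularity; convergence at infinity is left to the hypothesis,
    since it may be absolute (for [v]) or conditional (for [d_e v]). *)
Lemma difference_cvg f x : continuous f -> taylor_at (2 * s) f x ->
  (forall r, 0 < r -> exists l : R, tint (fun z => f (x - z) * (psi r z * k z)) t @[t --> 0^'+] --> l) ->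
  exists l : R, tint (fun z => (f x - f (x - z)) * k z) t @[t --> 0^'+] --> l.
Proof.
move=> cf [a [C [d [p [sa C0 d0 hC]]]]] far.
(* [1 - psi r] then vanishes beyond [d], so the expansion is used only where it holds. *)
pose r := d / 2; have r0 : 0 < r by rewrite divr_gt0.
have [l1 hl1] := far r r0.
have cfx := continuous_off0_cont (@shift_continuous f x cf).
have cpk := psik_continuous r0.
have c1p : continuous_off0 (fun z => 1 - psi r z).
  apply: continuous_off0D; first exact: continuous_off0_cst.
  by apply: continuous_off0N; apply: continuous_off0_cont; exact: psi_continuous.
have ck := kernel_continuous.
have cdot : continuous_off0 (dot p) by apply: continuous_off0_cont; exact: dot_continuous.
(* The integrand is [h + o - f (x - z) * (psi r z * k z)], with [h] absolutely integrable and the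
   function [o] below odd. *)
pose h z := (1 - psi r z) * ((f x - f (x - z) - dot p z) * k z) + f x * (psi r z * k z).
have ch : continuous_off0 h.
  apply: continuous_off0D; apply: continuous_off0M => //; last exact: continuous_off0_cst.
  apply: continuous_off0M => //; apply: continuous_off0D; last exact: continuous_off0N.
  by apply: continuous_off0D; [exact: continuous_off0_cst|exact: continuous_off0N].
have near z : z != 0 -> enorm z <= d -> `|(f x - f (x - z) - dot p z) * k z| <= C * L * epow (a - 2 * s) z.
  move=> z0 zd; have zp : 0 < enorm z by rewrite enorm_gt0.
  rewrite normrM (ger0_norm (k0 z)).
  have -> : C * L * epow (a - 2 * s) z = (C * enorm z `^ a) * (L * epow (- (2 * s)) z).
    rewrite /epow (_ : a - 2 * s - n%:R = a + (- (2 * s) - n%:R)); last by ring.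
    by rewrite powRD ?(gt_eqF zp) ?implybT//; ring.
  apply: ler_pM => //; last exact: kL.
  by rewrite -normrN; apply: le_trans (hC z zd); rewrite le_eqVlt; apply/orP; left; apply/eqP; congr `|_|; ring.
have [l2 hl2] : exists l : R, tint h t @[t --> 0^'+] --> l.
  have as0 : 0 < a - 2 * s by lra.
  have s20 : 0 < 2 * s by have := s0; lra.
  have [D D0 hD] := tint_bound n as0 s20.
  have q0 : 0 <= (C * d `^ a + `|f x|) * L.
    by rewrite mulr_ge0// addr_ge0// mulr_ge0// powR_ge0.
  apply: (tint_abs_cvg ch (hD h (C * L) ((C * d `^ a + `|f x|) * L) r r0 (mulr_ge0 C0 L0) q0 ch _ _)).
    move=> z z0 zr; rewrite /h psi_in// subr0 mul1r mul0r mulr0 addr0.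
    by apply: near => //; apply: le_trans zr _; rewrite /r; lra.
  move=> z rz; have zp : 0 < enorm z by exact: lt_le_trans rz.
  have z0 : z != 0 by rewrite -enorm_gt0.
  have E0 := epow_ge0 (- (2 * s)) z.
  have P1 := psi_le1 r z; have P0 := psi_ge0 r z.
  rewrite /h; apply: le_trans (ler_normD _ _) _.
  have -> : (C * d `^ a + `|f x|) * L * epow (- (2 * s)) z =
    C * d `^ a * (L * epow (- (2 * s)) z) + `|f x| * (L * epow (- (2 * s)) z) by ring.
  apply: lerD.
    have [zd|zd] := leP (enorm z) d.
      rewrite normrM -[leRHS]mul1r ler_pM//; first by rewrite ger0_norm; lra.
      apply: le_trans (near z z0 zd) _.
      have -> : C * L * epow (a - 2 * s) z = (C * enorm z `^ a) * (L * epow (- (2 * s)) z).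
        rewrite /epow (_ : a - 2 * s - n%:R = a + (- (2 * s) - n%:R)); last by ring.
        by rewrite powRD ?(gt_eqF zp) ?implybT//; ring.
      have a0 : 0 <= a by have := s0; lra.
      apply: ler_wpM2r; first exact: mulr_ge0.
      apply: ler_wpM2l => //; apply: ge0_ler_powR => //; rewrite nnegrE; exact: ltW.
    rewrite psi_out//; last by rewrite /r; lra.
    by rewrite subrr mul0r normr0 !mulr_ge0// powR_ge0.
  rewrite normrM ler_wpM2l// ger0_norm; last by apply: mulr_ge0; [exact: psi_ge0|exact: k0].
  by apply: le_trans (kL z0); rewrite ler_piMl.
pose o z := (1 - psi r z) * (dot p z * k z).
have co : continuous_off0 o by do 2!apply: continuous_off0M => //.
have cfp : continuous_off0 (fun z => f (x - z) * (psi r z * k z)) by exact: continuous_off0M.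
exists (l2 - l1).
apply: (@cvg_near0_ext _ _ (fun t => tint h t - tint (fun z => f (x - z) * (psi r z * k z)) t)); last exact: cvgB.
move=> t t0.
have o0 : tint o t = 0.
  by apply: tint_odd => // z; rewrite /o psiN kN dotN; ring.
rewrite -[tint h t]addr0 -[X in _ + X - _]o0 -tintD// -tintN// -tintD//.
- by apply: tint_eq => // z z0; rewrite /h /o; ring.
- exact: continuous_off0D.
- exact: continuous_off0N.
Qed.

End tails.

(** * The error term *)

Section error_term.
Variables (R : realType) (n : nat).
Local Notation V := 'rV[R]_n.
Local Notation bas := (@Defs.basis R n).
Implicit Types (x y z e p : V) (f g : V -> R) (r t : R).

(** The integral of [N] may be infinite, and the limit is then [-oo]. As the existence of the limit
    comes from [Q] and [N], the upper bound [D] only has to decide its sign. *)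
Lemma tint_cvg_le0 g N (Q D : R -> R) (l : R) : continuous_off0 N ->
  (forall z, z != 0 -> 0 <= N z) -> Q t @[t --> 0^'+] --> l -> D t @[t --> 0^'+] --> (0 : R) ->
  (forall t, 0 < t -> tint g t = Q t - tint N t) ->
  (\forall t \near 0^'+, tint g t <= D t) ->
  exists2 E : \bar R, (E <= 0)%E & (tint g t)%:E @[t --> 0^'+] --> E.
Proof.
move=> cN N0 hQ hD gE gD; have [L L0 hL] := tint_ge0_cvg cN N0.
have hE : (tint g t)%:E @[t --> 0^'+] --> (l%:E - L)%E.
  have H : ((Q t)%:E - (tint N t)%:E)%E @[t --> 0^'+] --> (l%:E - L)%E.
    apply: cvgeB => //; last by apply: cvg_EFin; [near=> t|].
  apply: cvg_trans H; apply: near_eq_cvg; near=> t.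
  by rewrite gE// EFinB.
exists (l%:E - L)%E => //.
have hD' : (D t)%:E @[t --> 0^'+] --> (0%:E : \bar R) by apply: cvg_EFin; [near=> t|].
rewrite -(cvg_lim (@ereal_hausdorff R) hE) -[leRHS](cvg_lim (@ereal_hausdorff R) hD').
apply: lee_lim; [by apply/cvg_ex; eexists; exact: hE|by apply/cvg_ex; eexists; exact: hD'|].
by near=> t; rewrite lee_fin; near: t.
Unshelve. all: by end_near. Qed.

Lemma sqplus_continuous : continuous (@sqplus R).
Proof.
by move=> t; apply: differentiable_continuous; apply/derivable1_diffP; have [] := is_derive_sqplus t.
Qed.

(* Completing the square in [y]: the maximum of the left-hand side is
   [a ^ 2 * e0 ^ 2 * (e0 ^ 2 / (e0 - d) ^ 2 - 1)]. *)
Lemma quadratic_defect (e0 d a y : R) : 0 <= e0 -> 0 <= a -> `|d| * 8 <= e0 ->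
  - (e0 ^+ 2 * a ^+ 2) - (e0 - d) ^+ 2 * sqplus y + 2 * e0 ^+ 2 * a * y <=
  a ^+ 2 * (2 * e0 * d + 5 * d ^+ 2).
Proof.
move=> e00 a0; rewrite -ler_pdivlMr// ler_norml => /andP[d1 d2].
have dd : d ^+ 2 <= (e0 / 8) ^+ 2 by nra.
(* The expansion of [e0^4 / (e0 - d)^2 - e0^2] begins with [2 e0 d + 3 d^2]; the coefficient 5
   leaves room for the higher orders when [|d| <= e0 / 8]. *)
have key : e0 ^+ 4 <= (e0 - d) ^+ 2 * (e0 ^+ 2 + 2 * e0 * d + 5 * d ^+ 2).
  have -> : (e0 - d) ^+ 2 * (e0 ^+ 2 + 2 * e0 * d + 5 * d ^+ 2) =
     e0 ^+ 4 + d ^+ 2 * (2 * e0 ^+ 2 - 8 * e0 * d + 5 * d ^+ 2) by ring.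
  by rewrite lerDl mulr_ge0 ?sqr_ge0//; nra.
have key2 : 0 <= e0 ^+ 2 + 2 * e0 * d + 5 * d ^+ 2 by nra.
have [e01|e01] := ltP 0 e0; last first.
  have e0E : e0 = 0 by lra.
  have dE : d = 0 by rewrite e0E in d1 d2; lra.
  by rewrite e0E dE !(expr0n, mulr0, mul0r, subr0, oppr0, addr0)//.
have h0 : 0 < (e0 - d) ^+ 2 by rewrite exprn_gt0//; lra.
rewrite /sqplus; have [yp|yn] := leP y 0.
  rewrite expr0n/= mulr0 subr0.
  have y1 : 2 * e0 ^+ 2 * a * y <= 0 by rewrite mulr_ge0_le0// !mulr_ge0// exprn_ge0.
  have : 0 <= a ^+ 2 * (e0 ^+ 2 + 2 * e0 * d + 5 * d ^+ 2) by rewrite mulr_ge0// sqr_ge0.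
  lra.
rewrite -subr_ge0 -(pmulr_rge0 _ h0).
have -> : (e0 - d) ^+ 2 * (a ^+ 2 * (2 * e0 * d + 5 * d ^+ 2) -
   (- (e0 ^+ 2 * a ^+ 2) - (e0 - d) ^+ 2 * y ^+ 2 + 2 * e0 ^+ 2 * a * y)) =
  ((e0 - d) ^+ 2 * y - e0 ^+ 2 * a) ^+ 2 +
  a ^+ 2 * ((e0 - d) ^+ 2 * (e0 ^+ 2 + 2 * e0 * d + 5 * d ^+ 2) - e0 ^+ 4) by ring.
by rewrite addr_ge0 ?sqr_ge0// mulr_ge0 ?sqr_ge0// subr_ge0.
Qed.

Lemma tint_sum (I : Type) (q : seq I) (F : I -> V -> R) t :
  (forall i, continuous_off0 (F i)) -> 0 < t ->
  tint (fun z => \sum_(i <- q) F i z) t = \sum_(i <- q) tint (F i) t.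
Proof.
move=> cF t0; elim: q => [|i q IH].
  under eq_fun do rewrite big_nil.
  by rewrite big_nil /tint /integ Rintegral_cst ?mul0r//; exact: measurable_core.
under eq_fun do rewrite big_cons.
by rewrite big_cons tintD//= ?IH//; exact: continuous_off0_sum.
Qed.

Variables (s L lam rho M c cl Ch : R) (k : V -> R).
Hypotheses (n0 : (0 < n)%N) (s0 : 0 < s) (lam0 : 0 < lam) (L0 : 0 <= L).
Hypotheses (Lrho : L = rho * lam) (hk : regular_kernel s L k) (kN : forall z, k (- z) = k z).
Hypothesis klow : forall z, z != 0 -> lam * epow (- (2 * s)) z <= k z.
Hypothesis hcl : forall r : R, 0 < r ->
  cl * r `^ (- (2 * s)) <= integ (shell r (3 * n%:R * r)) (@epow R n (- (2 * s))).
Hypothesis hCh : forall (g : V -> R) (A B a : R), 0 < a -> 0 <= A -> 0 <= B -> continuous_off0 g ->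
  (forall z, z != 0 -> enorm z <= a -> `|g z| <= A * epow (2 - 2 * s) z) ->
  (forall z, a <= enorm z -> `|g z| <= B * epow (- (2 * s)) z) ->
  forall r, 0 < r -> tint (fun z => `|g z|) r <= Ch * (A * a `^ (2 - 2 * s) + B * a `^ (- (2 * s))).
(** [cM] keeps [|h z - e0| <= e0 / 8] for [|z| <= 2 c e0], as [quadratic_defect] requires. In [hc],
    [56 = 7 * 4 * 2]: the 7 of [defect_near], the square of the radius [2 c e0], and the half of the
    negative term that is spent. *)
Hypotheses (M0 : 0 <= M) (c0 : 0 < c) (cM : 16 * (c * M) <= 1)
  (hc : 56 * M ^+ 2 * Ch * rho * c ^+ 2 <= cl).

Let k0 z : 0 <= k z. Proof. by case: hk. Qed.
Let ck : continuous_off0 k. Proof. exact: kernel_continuous hk. Qed.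

Variables (h b U : V -> R) (p : V) (a e0 sigma B : R) (w : 'I_n -> R).
Hypotheses (ch : continuous h) (cb : continuous b) (dU : forall z, differentiable U z)
  (cDU : forall i, continuous (fun z => 'D_(bas i) U z)).
Hypotheses (UB : forall z, `|U z| <= B) (B0 : 0 <= B) (w1 : forall i, `|w i| <= 1)
  (bE : forall z, b z = \sum_i w i * 'D_(bas i) U z).
Hypotheses (a0 : 0 <= a) (e00 : 0 <= e0) (e0M : e0 <= M)
  (h1 : forall z, `|h z - e0| <= M * enorm z)
  (h2 : forall z, `|h z - e0 + dot p z| <= M * enorm z ^+ 2).
(** What AM-GM leaves for [sigma] to absorb, once [|z| > c * e0] has removed [e0]; the factor [n]
    comes from the sum over the coordinates. *)
Hypothesis hsigma : 2 * n%:R ^+ 2 * (16 + L) ^+ 2 <= sigma * c ^+ 2.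

(* [e0], [a], [h z] and [b z] stand for [eta x], [(d_e v)_+ x], [eta (x - z)] and
   [d_e v (x - z)]; [U z] is [v (x - z) - v x]. *)
Definition defect z : R :=
  - (e0 ^+ 2 * a ^+ 2) - h z ^+ 2 * sqplus (b z) + 2 * e0 ^+ 2 * a * b z.

Lemma sigma_ge0 : 0 <= sigma.
Proof.
have cc : 0 < c ^+ 2 by rewrite exprn_gt0.
rewrite -(pmulr_lge0 _ cc); apply: le_trans hsigma.
by rewrite !mulr_ge0 ?exprn_ge0// addr_ge0.
Qed.

Lemma defect_far z : defect z <= - (e0 ^+ 2 * a ^+ 2) + 2 * e0 ^+ 2 * a * b z.
Proof.
rewrite /defect lerD2r lerBlDr lerDl mulr_ge0 ?sqr_ge0//.
Qed.

(** [7 = 5 + 2]: the 5 of [quadratic_defect], and the second order error in replacing [e0 - h z] by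
    [dot p z], where [e0 <= M]. *)
Lemma defect_near z : enorm z <= 2 * (c * e0) ->
  defect z <= a ^+ 2 * (2 * e0 * dot p z + 7 * M ^+ 2 * enorm z ^+ 2).
Proof.
move=> hz; pose d := e0 - h z.
have z0 := enorm_ge0 z.
have dM : `|d| <= M * enorm z by rewrite /d distrC.
have d8 : `|d| * 8 <= e0.
  have : M * enorm z <= M * (2 * (c * e0)) by rewrite ler_wpM2l.
  have : 16 * (c * M) * e0 <= 1 * e0 by rewrite ler_wpM2r.
  lra.
have dq : d <= dot p z + M * enorm z ^+ 2.
  by have := h2 z; rewrite ler_norml /d => /andP[]; lra.
have d2 : d ^+ 2 <= M ^+ 2 * enorm z ^+ 2.
  by rewrite -exprMn -(real_normK (num_real d)) ler_pXn2r// nnegrE// mulr_ge0.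
have := quadratic_defect (b z) e00 a0 d8.
rewrite {1}/d opprB addrCA subrr addr0 => H; apply: le_trans H _.
apply: ler_wpM2l; first exact: sqr_ge0.
have : 2 * e0 * d <= 2 * e0 * (dot p z + M * enorm z ^+ 2) by rewrite ler_wpM2l// mulr_ge0.
have : e0 * M * enorm z ^+ 2 <= M * M * enorm z ^+ 2 by rewrite ler_wpM2r ?sqr_ge0// ler_wpM2r.
rewrite -expr2; lra.
Qed.

Let cs : continuous_off0 (fun z => sqplus (b z)).
Proof.
by apply: continuous_off0_cont => z; apply: (@continuous_comp _ _ _ b (@sqplus R)); [exact: cb|exact: sqplus_continuous].
Qed.

Let cU2 : continuous_off0 (fun z => U z ^+ 2).
Proof.
move=> z _; have cU : {for z, continuous U} by exact: differentiable_continuous.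
exact: (continuousM cU cU).
Qed.

Lemma defect_continuous : continuous_off0 defect.
Proof.
have ch2 : continuous_off0 (fun z => h z ^+ 2).
  move=> z _; have cz : {for z, continuous h} by exact: ch.
  exact: (continuousM cz cz).
apply: continuous_off0D; first apply: continuous_off0D.
- exact: continuous_off0_cst.
- by apply: continuous_off0N; apply: continuous_off0M.
- by apply: continuous_off0M; [exact: continuous_off0_cst|exact: continuous_off0_cont].
Qed.

Definition error z : R := (defect z - sigma * U z ^+ 2) * k z.

Lemma error_continuous : continuous_off0 error.
Proof.
apply: continuous_off0M => //; apply: continuous_off0D; first exact: defect_continuous.
apply: continuous_off0N; apply: continuous_off0M; last exact: cU2.
exact: continuous_off0_cst.
Qed.

(** Without the term linear in [b] the integrand is nonpositive pointwise. The case stands apart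
    because the general argument uses [c * e0] as a radius and so needs it positive. *)
Lemma error_cvg_degenerate : e0 * a = 0 ->
  exists2 E : \bar R, (E <= 0)%E & (tint error t)%:E @[t --> 0^'+] --> E.
Proof.
move=> ea.
have e2a : e0 ^+ 2 * a = 0 by rewrite expr2 -mulrA ea mulr0.
have e2a2 : e0 ^+ 2 * a ^+ 2 = 0 by rewrite (expr2 a) mulrA e2a mul0r.
have F0 z : defect z <= 0.
  by have := defect_far z; rewrite e2a2 -(mulrA 2) e2a mulr0 mul0r addr0 oppr0.
have er0 z : 0 <= - error z.
  rewrite /error -mulNr mulr_ge0// oppr_ge0.
  have := mulr_ge0 sigma_ge0 (sqr_ge0 (U z)); have := F0 z; lra.
apply: (@tint_cvg_le0 error (fun z => - error z) (fun=> 0) (fun=> 0) 0) => //.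
- exact/continuous_off0N/error_continuous.
- exact: cvg_cst.
- exact: cvg_cst.
- by move=> t t0; rewrite tintN// ?sub0r ?opprK//; exact: error_continuous.
near=> t; rewrite -oppr_ge0 -tintN//; last exact: error_continuous.
exact: tint_ge0.
Unshelve. all: by end_near. Qed.

Lemma error_cvg : exists2 E : \bar R, (E <= 0)%E & (tint error t)%:E @[t --> 0^'+] --> E.
Proof.
have [ea|ea] := eqVneq (e0 * a) 0; first exact: error_cvg_degenerate.
have e0p : 0 < e0 by rewrite lt_def e00 andbT; apply: contraNneq ea => ->; rewrite mul0r.
have ap : 0 < a by rewrite lt_def a0 andbT; apply: contraNneq ea => ->; rewrite mulr0.
pose r := c * e0; have r0 : 0 < r by rewrite mulr_gt0.
pose C := 7 * M ^+ 2.
have C0 : 0 <= C by rewrite mulr_ge0// sqr_ge0.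
pose q1 z := (1 - psi r z) * (enorm z ^+ 2 * k z).
pose q2 z := psi r z * k z.
pose q3 z := b z * (psi r z * k z).
pose q4 z := (1 - psi r z) * (dot p z * k z).
(* The slack of the two pointwise bounds, glued by [psi], plus the [sigma] term. The error is then a
   combination of [q1], ..., [q4] minus [N]: [q1] and [q2] are absolutely integrable, [q3]
   conditionally, and [q4] is odd. *)
pose N z := ((1 - psi r z) * (a ^+ 2 * (2 * e0 * dot p z + C * enorm z ^+ 2)) +
  psi r z * (- (e0 ^+ 2 * a ^+ 2) + 2 * e0 ^+ 2 * a * b z) - defect z + sigma * U z ^+ 2) * k z.
have cpsi : continuous_off0 (@psi R n r) by apply: continuous_off0_cont; exact: psi_continuous.
have c1p : continuous_off0 (fun z => 1 - psi r z).
  by apply: continuous_off0D; [exact: continuous_off0_cst|exact: continuous_off0N].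
have cen : continuous_off0 (fun z : V => enorm z ^+ 2).
  by move=> z _; apply: differentiable_continuous; exact: differentiable_enorm_sqr.
have cdot : continuous_off0 (dot p) by apply: continuous_off0_cont; exact: dot_continuous.
have cb' := continuous_off0_cont cb.
have cq1 : continuous_off0 q1 by do 2!apply: continuous_off0M => //.
have cq2 : continuous_off0 q2 by apply: continuous_off0M => //.
have cq3 : continuous_off0 q3 by do 2!apply: continuous_off0M => //.
have cq4 : continuous_off0 q4 by do 2!apply: continuous_off0M => //.
have cst := @continuous_off0_cst R n.
have cN : continuous_off0 N.
  apply: continuous_off0M => //; apply: continuous_off0D; last exact: continuous_off0M.
  apply: continuous_off0D; last exact/continuous_off0N/defect_continuous.
  apply: continuous_off0D; apply: continuous_off0M => //.
    by apply: continuous_off0M => //; apply: continuous_off0D; apply: continuous_off0M.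
  by apply: continuous_off0D => //; apply: continuous_off0M.
(* The far bound of the defect holds everywhere and the near one for [|z| <= 2 r], so both are
   available wherever [psi] mixes them. *)
have NU z : sigma * (U z ^+ 2 * k z) <= N z.
  rewrite mulrA; apply: ler_wpM2r => //; rewrite lerDr subr_ge0; have P1 := psi_le1 r z; have P0 := psi_ge0 r z.
  have far := defect_far z.
  have [zr|zr] := leP (enorm z) (2 * r); last first.
    by rewrite psi_out ?(ltW zr)// subrr mul0r add0r mul1r.
  have near := defect_near zr.
  have -> : defect z = (1 - psi r z) * defect z + psi r z * defect z by ring.
  by apply: lerD; apply: ler_wpM2l => //; rewrite subr_ge0.
have N0 z : z != 0 -> 0 <= N z.
  move=> _; apply: le_trans (NU z); apply: mulr_ge0; first exact: sigma_ge0.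
  by apply: mulr_ge0 => //; exact: sqr_ge0.
have q2L z : z != 0 -> `|q2 z| <= L * epow (- (2 * s)) z.
  move=> z0; rewrite ger0_norm; last by apply: mulr_ge0; [exact: psi_ge0|].
  have [_ kL _ _] := hk; apply: le_trans (kL z z0).
  by apply: ler_piMl => //; exact: psi_le1.
have hq1 t : 0 < t -> tint (fun z => `|q1 z|) t <= Ch * (L * (2 * r) `^ (2 - 2 * s) + 0 * (2 * r) `^ (- (2 * s))).
  apply: hCh => //; first by rewrite mulr_gt0.
    move=> z z0 _; have zp : 0 < enorm z by rewrite enorm_gt0.
    have P1 := psi_le1 r z; have P0 := psi_ge0 r z.
    have zk : 0 <= enorm z ^+ 2 * k z by apply: mulr_ge0 => //; exact: sqr_ge0.
    rewrite ger0_norm; last by apply: mulr_ge0 => //; rewrite subr_ge0.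
    apply: (@le_trans _ _ (enorm z ^+ 2 * k z)).
      by apply: ler_piMl => //; rewrite gerBl.
    have -> : epow (2 - 2 * s) z = enorm z ^+ 2 * epow (- (2 * s)) z.
      rewrite /epow -(powR_mulrn 2 (ltW zp)) -powRD ?(gt_eqF zp) ?implybT//.
      by congr (_ `^ _); ring.
    rewrite mulrCA ler_wpM2l ?sqr_ge0//.
    by have [_ kL _ _] := hk; exact: kL.
  move=> z rz; rewrite mul0r /q1 psi_out// subrr mul0r normr0.
  by [].
have [l1 hl1] : exists l : R, tint q1 t @[t --> 0^'+] --> l by exact: tint_abs_cvg cq1 hq1.
have [l2 hl2] : exists l : R, tint q2 t @[t --> 0^'+] --> l.
  have s20 : 0 < 2 * s by have := s0; lra.
  have [D D0 hD] := tint_bound n s20 s20.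
  apply: (tint_abs_cvg cq2 (hD q2 0 L r r0 (lexx 0) L0 cq2 _ _)).
    by move=> z z0 zr; rewrite /q2 psi_in// mul0r normr0 mul0r.
  by move=> z rz; apply: q2L; rewrite -enorm_gt0; exact: lt_le_trans rz.
pose G i z := 'D_(bas i) U z * (psi r z * k z).
have cG i : continuous_off0 (G i).
  by apply: continuous_off0M => //; exact: continuous_off0_cont.
have q3E z : q3 z = \sum_i w i * G i z.
  by rewrite /q3 bE mulr_suml; apply: eq_bigr => i _; rewrite -mulrA.
have cwG i : continuous_off0 (fun z => w i * G i z) by exact: continuous_off0M.
have [l3 hl3] : exists l : R, tint q3 t @[t --> 0^'+] --> l.
  rewrite (funext q3E); apply: tint_sum_cvg => // i.
  have [l hl] := far_cvg s0 L0 hk (i := i) r0 B0 dU (@cDU i) UB.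
  by exists (w i * l); exact: cvg_tintZ.
pose Q t := C * a ^+ 2 * tint q1 t - e0 ^+ 2 * a ^+ 2 * tint q2 t + 2 * e0 ^+ 2 * a * tint q3 t.
have q40 t : 0 < t -> tint q4 t = 0.
  by move=> t0; apply: tint_odd => // z; rewrite /q4 psiN kN dotN; ring.
have erE t : 0 < t -> tint error t = Q t - tint N t.
  move=> t0.
  have cT1 : continuous_off0 (fun z => C * a ^+ 2 * q1 z + - (e0 ^+ 2 * a ^+ 2) * q2 z).
    by apply: continuous_off0D; exact: continuous_off0M.
  have cT2 : continuous_off0 (fun z => 2 * e0 ^+ 2 * a * q3 z + 2 * e0 * a ^+ 2 * q4 z).
    by apply: continuous_off0D; exact: continuous_off0M.
  have cT := continuous_off0D cT1 cT2.
  have -> : Q t = tint (fun z => (C * a ^+ 2 * q1 z + - (e0 ^+ 2 * a ^+ 2) * q2 z) +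
      (2 * e0 ^+ 2 * a * q3 z + 2 * e0 * a ^+ 2 * q4 z)) t.
    rewrite tintD// tintD//; try exact: continuous_off0M.
    rewrite tintD//; try exact: continuous_off0M.
    by rewrite !tintZ// (q40 t t0) mulr0 addr0 mulNr.
  rewrite -tintN// -tintD//; last exact: continuous_off0N.
  by apply: tint_eq => // z z0; rewrite /error/N/q1/q2/q3/q4; ring.
have hQ : Q t @[t --> 0^'+] --> C * a ^+ 2 * l1 - e0 ^+ 2 * a ^+ 2 * l2 + 2 * e0 ^+ 2 * a * l3.
  by apply: cvgD; [apply: cvgB|]; apply: cvgM => //; exact: cvg_cst.
(* The boundary terms of the [n] integrations by parts on the sphere of radius [1 / t]. *)
pose D t := 2 * e0 ^+ 2 * a * (n%:R * (B * L * 2 ^+ n)) * t `^ (2 * s + 1).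
have hD : D t @[t --> 0^'+] --> (0 : R).
  rewrite -[X in _ --> X](mulr0 (2 * e0 ^+ 2 * a * (n%:R * (B * L * 2 ^+ n)))).
  apply: cvgM; first exact: cvg_cst.
  by apply: powR_cvg0; have := s0; lra.
apply: (tint_cvg_le0 cN N0 hQ hD erE).
have r3 : 0 < 2 * r * (3 * n%:R) by rewrite !mulr_gt0// ltr0n.
near=> t.
have t0 : 0 < t by near: t; exact: nbhs_right_gt.
have tr : t < r by near: t; exact: nbhs_right_lt.
(* The truncated domain then contains the shell from [2 r] to [6 n r], where [q2] is bounded
   below. *)
have tr3 : t < (2 * r * (3 * n%:R))^-1 by near: t; apply: nbhs_right_lt; rewrite invr_gt0.
have rt3 : 2 * r * (3 * n%:R) < t^-1.
  by rewrite -[ltLHS]invrK ltf_pV2 ?posrE// invr_gt0.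
have n1 : 1 <= n%:R :> R by rewrite ler1n.
have rt : r < t^-1 by apply: le_lt_trans rt3; nra.
(* [2 a n |U| (16 + L) chi / |z|] is split by AM-GM into a part absorbed by [psi]
   and a part absorbed by [sigma U^2]; on the support of [chi], [|z|] exceeds [c e0] *)
have H3 : 2 * e0 ^+ 2 * a * tint q3 t <=
    e0 ^+ 2 * a ^+ 2 / 2 * tint q2 t + sigma * tint (fun z => U z ^+ 2 * k z) t + D t.
  have q3t : tint q3 t <= n%:R * (tint (fun z => `|U z| * weight L k r z) t + B * L * 2 ^+ n * t `^ (2 * s + 1)).
    rewrite (funext q3E) tint_sum//; apply: le_trans (ler_norm _) _.
    apply: le_trans (ler_norm_sum _ _ _) _.
    have -> : n%:R * (tint (fun z => `|U z| * weight L k r z) t + B * L * 2 ^+ n * t `^ (2 * s + 1)) =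
       \sum_(i < n) (tint (fun z => `|U z| * weight L k r z) t + B * L * 2 ^+ n * t `^ (2 * s + 1)).
      by rewrite sumr_const card_ord mulr_natl.
    apply: ler_sum => i _; rewrite tintZ// normrM.
    apply: le_trans (far_tint L0 hk r0 B0 dU (@cDU i) UB t0 tr rt).
    by rewrite ler_piMl.
  have cUk : continuous_off0 (fun z => U z ^+ 2 * k z) by exact: continuous_off0M.
  have cUw : continuous_off0 (fun z => `|U z| * weight L k r z).
    apply: continuous_off0M; last exact: weight_continuous hk _ r0.
    by apply: continuous_off0_norm => z _; exact: differentiable_continuous.
  have AG : tint (fun z => 2 * e0 ^+ 2 * a * n%:R * (`|U z| * weight L k r z)) t <=
      tint (fun z => e0 ^+ 2 * a ^+ 2 / 2 * q2 z + sigma * (U z ^+ 2 * k z)) t.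
    apply: tint_le => //; first exact: continuous_off0M.
      by apply: continuous_off0D; exact: continuous_off0M.
    move=> z z0; have zp : 0 < enorm z by rewrite enorm_gt0.
    have Uk0 : 0 <= sigma * (U z ^+ 2 * k z).
      by apply: mulr_ge0; [exact: sigma_ge0|apply: mulr_ge0 => //; exact: sqr_ge0].
    have [zr|zr] := leP (enorm z) r.
      have chi0 : chi r z = 0 by apply/eqP; rewrite -sqrf_eq0; apply/eqP; exact: psi_in.
      by rewrite /q2 psi_in// /weight chi0 !(mul0r, mulr0) add0r.
    pose X := a * chi r z; pose Y := 2 * n%:R * (16 + L) * `|U z| / enorm z.
    have -> : 2 * e0 ^+ 2 * a * n%:R * (`|U z| * weight L k r z) = e0 ^+ 2 * (X * Y) * k z.
      by rewrite /weight /X /Y; field; rewrite gt_eqF.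
    have -> : e0 ^+ 2 * a ^+ 2 / 2 * q2 z + sigma * (U z ^+ 2 * k z) =
       (e0 ^+ 2 * (X ^+ 2 / 2) + sigma * U z ^+ 2) * k z.
      by rewrite /q2 /X -[psi r z]/(chi r z ^+ 2); field.
    apply: ler_wpM2r => //.
    have XY : X * Y <= X ^+ 2 / 2 + Y ^+ 2 / 2 by have := sqr_ge0 (X - Y); nra.
    have YU : e0 ^+ 2 * (Y ^+ 2 / 2) <= sigma * U z ^+ 2.
      have -> : e0 ^+ 2 * (Y ^+ 2 / 2) =
          e0 ^+ 2 * (2 * n%:R ^+ 2 * (16 + L) ^+ 2) * U z ^+ 2 / enorm z ^+ 2.
        by rewrite /Y -(real_normK (num_real (U z))); field; rewrite gt_eqF.
      rewrite ler_pdivrMr ?exprn_gt0// [leRHS]mulrAC; apply: ler_wpM2r; first exact: sqr_ge0.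
      apply: (@le_trans _ _ (sigma * r ^+ 2)).
        have -> : sigma * r ^+ 2 = e0 ^+ 2 * (sigma * c ^+ 2) by rewrite /r; ring.
        exact: (ler_wpM2l (sqr_ge0 e0) hsigma).
      apply: ler_wpM2l; first exact: sigma_ge0.
      by rewrite ler_pXn2r ?nnegrE// ltW.
    have := ler_wpM2l (sqr_ge0 e0) XY; lra.
  move: AG; rewrite tintD ?tintZ//; try exact: continuous_off0M.
  have ea0 : 0 <= 2 * e0 ^+ 2 * a by rewrite !mulr_ge0// exprn_ge0.
  have := ler_wpM2l ea0 q3t; rewrite /D; lra.
(* Half of the negative term is spent here and half in [H3]. Compared with the lower bound of [q2],
   that of [q1] has the extra factor [(2 r)^2 = 4 c^2 e0^2], which supplies both the missing [e0^2]
   and the smallness. *)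
have H1 : C * a ^+ 2 * tint q1 t <= e0 ^+ 2 * a ^+ 2 / 2 * tint q2 t.
  have r20 : 0 < 2 * r by lra.
  have J2 : lam * (cl * (2 * r) `^ (- (2 * s))) <= tint q2 t.
    apply: le_trans (ler_wpM2l (ltW lam0) (hcl r20)) _.
    rewrite -integ_shellZ//; last exact: epow_continuous.
    apply: (@le_trans _ _ (integ (shell (2 * r) (3 * n%:R * (2 * r))) q2)).
      apply: (@integ_le _ _ _ _ _ (2 * r) (3 * n%:R * (2 * r))) => //.
      - by apply: continuous_off0M => //; exact: epow_continuous.
      - exact: measurable_shell.
      - by move=> y; exact: shell_bounds.
      - move=> z hz _; have z0 : z != 0 by rewrite -enorm_gt0; exact: lt_le_trans hz.
        by rewrite /q2 psi_out// mul1r; exact: klow.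
    apply: (@integ_subset _ _ _ _ _ t t^-1) => //.
    - exact: measurable_shell.
    - exact: measurable_core.
    - move=> y; rewrite /shell/core/radial/= !in_itv/= => /andP[g1 g2].
      apply/andP; split; first by apply: lt_le_trans g1; lra.
      by apply: lt_trans g2 _; rewrite mulrC.
    - by move=> y; exact: core_bounds.
    - by move=> z _; apply: mulr_ge0 => //; exact: psi_ge0.
  have J1 : tint q1 t <= Ch * (L * (2 * r) `^ (2 - 2 * s)).
    apply: le_trans (ler_norm _) _; apply: le_trans (tint_norm cq1 t0) _.
    by have := hq1 t t0; rewrite mul0r addr0.
  have E2 : (2 * r) `^ (2 - 2 * s) = (2 * r) ^+ 2 * (2 * r) `^ (- (2 * s)).
    by rewrite -(powR_mulrn 2 (ltW r20)) -powRD ?(gt_eqF r20) ?implybT.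
  have Ca0 : 0 <= C * a ^+ 2 by rewrite mulr_ge0// sqr_ge0.
  apply: le_trans (ler_wpM2l Ca0 J1) _.
  have ea0 : 0 <= e0 ^+ 2 * a ^+ 2 / 2 by rewrite divr_ge0// mulr_ge0 ?sqr_ge0.
  apply: le_trans (ler_wpM2l ea0 J2).
  rewrite E2 Lrho /C /r; set P := _ `^ _.
  have P0 : 0 <= e0 ^+ 2 * a ^+ 2 / 2 * lam * P by rewrite mulr_ge0 ?powR_ge0// mulr_ge0// ltW.
  have := ler_wpM2l P0 hc; lra.
have HN : sigma * tint (fun z => U z ^+ 2 * k z) t <= tint N t.
  rewrite -tintZ//; last exact: continuous_off0M.
  by apply: tint_le => //; apply: continuous_off0M => //; exact: continuous_off0M.
(* [H1] and [H3] use up the [q2] term and [HN] the [sigma] term; [D t] is left. *)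
rewrite erE// /Q; lra.
Unshelve. all: by end_near. Qed.

End error_term.

(** * The data *)

Section data.
Variables (R : realType) (n : nat).
Local Notation T := (measurableTypeR R).
Local Notation V := 'rV[R]_n.
Local Notation bas := (@Defs.basis R n).
Local Notation mu := (lebesgue_measure_tuple R n).
Implicit Types (x y z e p : V) (f g : V -> R) (r t : R).

Lemma kernel_class_regular (s lam Lam : R) (K : V -> \bar R) : kernel_class s lam Lam K ->
  [/\ regular_kernel s Lam (fine \o K), forall z, fine (K (- z)) = fine (K z),
      forall z, z != 0 -> K z = (fine (K z))%:E &
      forall z, z != 0 -> lam * epow (- (2 * s)) z <= fine (K z)].
Proof.
move=> [K0 KN Kb Kd].
have E z : enorm z `^ (- n%:R - 2 * s) = epow (- (2 * s)) z.
  by rewrite /epow; congr (_ `^ _); ring.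
have Kfin z : z != 0 -> K z = (fine (K z))%:E.
  move=> z0; rewrite fineK//; have [_ h2] := Kb z z0.
  by rewrite ge0_fin_numE//; apply: le_lt_trans h2 _; rewrite ltry.
split => //.
- split.
  + by move=> z; apply: fine_ge0.
  + by move=> z z0; have [_] := Kb z z0; rewrite Kfin// lee_fin E.
  + by move=> z z0; have [] := Kd z z0.
  + move=> i z z0; have [_ h] := Kd z z0; apply: le_trans h.
    by have := coord_le_enorm (grad (fine \o K) z) i; rewrite mxE.
- by move=> z; rewrite KN.
- by move=> z z0; have [] := Kb z z0; rewrite Kfin// lee_fin E.
Qed.

(** The substitution [y = x - z]. The extended kernel agrees with the real one off 0, and the annuli
    avoid 0. *)
Lemma nonlocal_cvg (K : V -> \bar R) k f x (E : \bar R) : continuous f -> continuous_off0 k ->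
  (forall z, z != 0 -> K z = (k z)%:E) ->
  (tint (fun z => (f x - f (x - z)) * k z) r)%:E @[r --> 0^'+] --> E ->
  nonlocal K f x = E.
Proof.
move=> cf ck KE hE; apply: (cvg_lim (@ereal_hausdorff R)).
apply: cvg_trans hE; apply: near_eq_cvg; near=> r.
have r0 : 0 < r by near: r; exact: nbhs_right_gt.
pose c : n.-tuple T := [tuple x 0 i | i < n].
have cx : rvec c = x by apply/rowP => i; rewrite mxE tnth_mktuple.
have aE : annulus x r = treflect c @^-1` core r.
  by apply/seteqP; split => t; rewrite /annulus/core/radial/= in_itv/= rvec_treflect cx.
pose g z := (f x - f (x - z)) * k z.
have cg : continuous_off0 g.
  apply: continuous_off0M => //; apply: continuous_off0D; first exact: continuous_off0_cst.
  by apply: continuous_off0N; apply: continuous_off0_cont; exact: shift_continuous.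
have mc := @measurable_core R n r.
have mr := @measurable_treflect R n c.
have ma : measurable (treflect c @^-1` core r).
  by rewrite -[X in measurable X]setTI; exact: mr.
have ig := core_integrable cg r0.
have [B B0 hB] := continuous_off0_bounded r^-1 cg r0.
have muc : (mu (core r) < +oo)%E.
  apply: (@le_lt_trans _ _ (mu (cube R n r^-1))).
    apply: le_measure; rewrite ?inE//; first exact: measurable_cube.
    apply: radial_sub_cube => q /=; rewrite in_itv/= => /andP[_].
    by [].
  by rewrite lebesgue_measure_cube ?ltry// invr_ge0 ltW.
have ig' : mu.-integrable (treflect c @^-1` core r) ((EFin \o (g \o @rvec R n)) \o treflect c).
  apply: (@measurable_bounded_integrable _ _ _ mu ((g \o @rvec R n) \o treflect c)) => //.
  - exact: (eq_ind_r (fun q => (q < +oo)%E) muc (lebesgue_measure_treflect c mc)).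
  - apply: (measurable_comp mc) => //; [by move=> _ [q hq <-]| |exact: measurable_funTS].
    by apply/measurable_EFinP; exact: measurable_int ig.
  - exists B; split; first exact: num_real.
    move=> q Bq t /core_bounds/andP[h1 h2] /=; apply: le_trans (ltW Bq); exact: hB.
transitivity (\int[mu]_(t in core r) (g (rvec t))%:E)%E.
  rewrite /tint /integ /Rintegral fineK//; exact: integrable_fin_num.
rewrite (@integral_treflect R n c)// aE; apply: eq_integral => t; rewrite inE => /core_bounds/andP[h _].
have := rvec_neq0 r0 h; rewrite rvec_treflect cx /g => z0.
by rewrite opprB addrCA subrr addr0 KE// EFinM.
Unshelve. all: by end_near. Qed.

(** By continuity, a value above the essential supremum would persist on a box, which has positive
    measure. *)
Lemma Linfty_bounded f : continuous f -> Linfty f ->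
  exists2 B : R, 0 <= B & forall y, `|f y| <= B.
Proof.
move=> cf /sub_Lfun_finLfun; rewrite inE /finite_norm unlock /=.
pose c y : n.-tuple T := [tuple y 0 i | i < n].
have boxpos (y : V) (d : R) : 0 < d ->
    (0 < mu (treflect (c y) @^-1` cube R n d))%E.
  move=> d0; rewrite lebesgue_measure_treflect; last exact: measurable_cube.
  by rewrite lebesgue_measure_cube ?ltW// lte_fin exprn_gt0// mulr_gt0.
(* The norm with exponent [+oo] is defined by cases on this inequality. *)
have muT : (0 < mu setT)%E.
  apply: lt_le_trans (boxpos 0 1 ltr01) _; apply: le_measure; rewrite ?inE//.
  rewrite -[X in measurable X]setTI; apply: measurable_treflect => //.
  exact: measurable_cube.
rewrite muT => hs; pose S := ess_sup_inf.ess_sup mu (abse \o (EFin \o (f \o @rvec R n))).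
have hS := @ess_sup_inf.ess_sup_ge _ _ R mu (abse \o (EFin \o (f \o @rvec R n))).
have S0 : (0 <= S)%E.
  by apply: ess_sup_inf.ess_sup_gee => //; apply/nearW => t /=.
have SE : S = (fine S)%:E by rewrite fineK// ge0_fin_numE.
exists (fine S); first exact: fine_ge0.
move=> y; rewrite leNgt; apply/negP => hy.
pose dl := (`|f y| - fine S) / 2; have dl0 : 0 < dl by rewrite divr_gt0// subr_gt0.
have [d d0 hd] := continuousP_enorm (cf y) dl0.
(* A box of half-side [d'] lies in the Euclidean ball of radius [d]; the [+ 1] keeps the quotient
   meaningful for [n = 0]. *)
pose d' := d / (n%:R + 1); have d'0 : 0 < d' by rewrite divr_gt0// ltr_wpDl.
have := boxpos y d' d'0; apply/negP; rewrite -leNgt.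
move: hS => [N [mN N0 hN]]; rewrite -N0.
have mb : measurable (treflect (c y) @^-1` cube R n d').
  rewrite -[X in measurable X]setTI; apply: measurable_treflect => //.
  exact: measurable_cube.
apply: le_measure; rewrite ?inE//; apply: subset_trans hN => t ht /=.
apply/negP; rewrite -ltNge -/S SE lte_fin.
have -> : rvec t = y - (y - rvec t) by rewrite opprB addrCA subrr addr0.
have h : enorm (y - rvec t) <= d.
  apply: le_trans (@enorm_le_coord R n _ d' _ (ltW d'0)) _.
    by move=> i; have := ht i; rewrite tnth_mktuple /= !mxE tnth_mktuple => /ltW.
  by rewrite /d' mulrC -mulrA ler_piMr ?(ltW d0)// mulrC ler_pdivrMr ?mul1r ?lerDl// ltr_wpDl.
have := hd _ h; have := ler_dist_dist (f y) (f (y - (y - rvec t))).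
rewrite distrC [X in X <= _ -> _]distrC /dl ler_norml => /andP[g1 g2] g3; lra.
Qed.

Lemma C11_bounds eta (M : R) : C11_norm eta = M%:E ->
  [/\ 0 <= M, forall x, `|eta x| <= M, forall x, enorm (grad eta x) <= M &
      forall x y, enorm (grad eta x - grad eta y) <= M * enorm (x - y)].
Proof.
rewrite /C11_norm; set A := ereal_sup _; set B := ereal_sup _; set C := ereal_sup _ => hM.
have hA x : (`|eta x|%:E <= A)%E by apply: ereal_sup_ubound; exists x.
have hB x : ((enorm (grad eta x))%:E <= B)%E by apply: ereal_sup_ubound; exists x.
have hC x y : ((enorm (grad eta x - grad eta y) / enorm (x - y))%:E <= C)%E.
  by apply: ereal_sup_ubound; exists (x, y).
have A0 : (0 <= A)%E by apply: le_trans (hA 0); rewrite lee_fin.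
have B0 : (0 <= B)%E by apply: le_trans (hB 0); rewrite lee_fin enorm_ge0.
have C0 : (0 <= C)%E by apply: le_trans (hC 0 0); rewrite lee_fin divr_ge0 ?enorm_ge0.
have AM : (A <= M%:E)%E by rewrite -hM -addeA leeDl// adde_ge0.
have BM : (B <= M%:E)%E by rewrite -hM (addeC A) -addeA leeDl// adde_ge0.
have CM : (C <= M%:E)%E by rewrite -hM leeDr// adde_ge0.
split.
- by rewrite -lee_fin; exact: le_trans AM.
- by move=> x; rewrite -lee_fin; exact: le_trans (hA x) AM.
- by move=> x; rewrite -lee_fin; exact: le_trans (hB x) BM.
move=> x y; have [->|xy] := eqVneq x y; first by rewrite !subrr enorm0 mulr0.
rewrite -ler_pdivrMr ?enorm_gt0 ?subr_eq0//.
by rewrite -lee_fin; exact: le_trans (hC x y) CM.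
Qed.

Lemma C11_expansion eta (M : R) x z : (forall y, differentiable eta y) -> C11_norm eta = M%:E ->
  `|eta (x - z) - eta x| <= M * enorm z /\
  `|eta (x - z) - eta x + dot (grad eta x) z| <= M * enorm z ^+ 2.
Proof.
move=> de /C11_bounds[M0 _ gM gL]; have [t /andP[t0 t1] ->] := mean_value x z de.
split.
  by rewrite normrN; apply: le_trans (cauchy_schwarz _ _) _; rewrite ler_wpM2r ?enorm_ge0.
rewrite addrC -dotBl; apply: le_trans (cauchy_schwarz _ _) _.
rewrite expr2 mulrA ler_wpM2r ?enorm_ge0//; apply: le_trans (gL _ _) _.
rewrite ler_wpM2l// opprB addrCA subrr addr0 enormZ ger0_norm//.
by rewrite ler_piMl ?enorm_ge0.
Qed.

End data.

(** * Expansions and convergence at a given point *)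

Section pointwise.
Variables (R : realType) (n : nat).
Local Notation V := 'rV[R]_n.
Local Notation bas := (@Defs.basis R n).
Implicit Types (x y z e p : V) (f g : V -> R) (r t : R).

Lemma ler_powR_small (u a b : R) : 0 <= u -> u <= 1 -> 0 < a -> a <= b -> u `^ b <= u `^ a.
Proof.
move=> u0 u1 a0 ab; have b0 : 0 < b by exact: lt_le_trans ab.
have [->|un0] := eqVneq u 0; first by rewrite !powR0// gt_eqF.
have -> : b = a + (b - a) by ring.
rewrite powRD ?un0 ?implybT//; apply: ler_piMr; first exact: powR_ge0.
have ba : 0 <= b - a by rewrite subr_ge0.
have := @ge0_ler_powR R (b - a) ba u 1; rewrite powR1; apply => //.
by rewrite nnegrE.
Qed.

Lemma dotNl x z : dot (- x) z = - dot x z.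
Proof. by rewrite /dot -sumrN; apply: eq_bigr => i _; rewrite mxE mulNr. Qed.

Lemma taylor_atD (a0 : R) f g x : 0 <= a0 -> taylor_at a0 f x -> taylor_at a0 g x ->
  taylor_at a0 (fun y => f y + g y) x.
Proof.
move=> a00 [a [C [d [p [aa C0 d0 hf]]]]] [a' [C' [d' [p' [aa' C0' d0' hg]]]]].
(* The radius is capped at 1 because a power of [|z|] decreases in its exponent only for
   [|z| <= 1]. *)
exists (Num.min a a'), (C + C'), (Num.min 1 (Num.min d d')), (p + p'); split.
- by rewrite lt_min aa.
- exact: addr_ge0.
- by rewrite !lt_min ltr01 d0.
move=> z; rewrite !le_min => /and3P[z1 zd zd'].
have -> : f (x - z) + g (x - z) - (f x + g x) + dot (p + p') z =
    (f (x - z) - f x + dot p z) + (g (x - z) - g x + dot p' z).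
  by rewrite -[p' in LHS]opprK dotBl dotNl; ring.
apply: le_trans (ler_normD _ _) _; rewrite mulrDl; have z0 := enorm_ge0 z.
have m0 : 0 < Num.min a a' by rewrite lt_min !(le_lt_trans a00).
apply: lerD.
  apply: le_trans (hf z zd) _; apply: ler_wpM2l => //.
  by apply: ler_powR_small => //; rewrite ge_min lexx.
apply: le_trans (hg z zd') _; apply: ler_wpM2l => //.
by apply: ler_powR_small => //; rewrite ge_min lexx orbT.
Qed.

Lemma taylor_atZ (a0 c : R) f x : taylor_at a0 f x -> taylor_at a0 (fun y => c * f y) x.
Proof.
move=> [a [C [d [p [aa C0 d0 hf]]]]].
exists a, (`|c| * C), d, (c *: p); split => //; first exact: mulr_ge0.
move=> z zd; have -> : c * f (x - z) - c * f x + dot (c *: p) z = c * (f (x - z) - f x + dot p z).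
  rewrite mulrDr mulrBr; congr (_ + _); rewrite /dot mulr_sumr.
  by apply: eq_bigr => i _; rewrite mxE mulrA.
by rewrite normrM -mulrA ler_wpM2l// hf.
Qed.

Lemma taylor_at_sum (I : Type) (q : seq I) (F : I -> V -> R) (a0 : R) x : 0 <= a0 ->
  (forall i, taylor_at a0 (F i) x) -> taylor_at a0 (fun y => \sum_(i <- q) F i y) x.
Proof.
move=> a00 hF; elim: q => [|i q IH].
  exists (a0 + 1), 0, 1, 0; split => //; first by lra.
  move=> z _; rewrite !big_nil subr0 add0r mul0r /dot.
  by rewrite big1 ?normr0// => i _; rewrite mxE mul0r.
have -> : (fun y => \sum_(j <- i :: q) F j y) = (fun y => F i y + \sum_(j <- q) F j y).
  by apply/funext => y; rewrite big_cons.
exact: taylor_atD.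
Qed.

Lemma derive_reflected f x z e : (forall y, differentiable f y) ->
  differentiable (fun z => f (x - z)) z /\
  'D_e (fun z => f (x - z)) z = - 'D_e f (x - z).
Proof.
move=> df; have dg : differentiable (fun z : V => x - z) z by exact: differentiableB.
split; first by apply: (differentiable_comp dg); exact: df.
transitivity ('D_(- e) f (x - z)); last by rewrite !deriveE// linearN.
rewrite /derive; set F := (fun h : R => _); set G := (fun h : R => _ : R).
have -> // : F = G.
apply/funext => h; rewrite /F /G /=; congr (_ *: (f _ - _)).
by rewrite scalerN opprD addrCA.
Qed.

Variables (s L : R) (k : V -> R).
Hypotheses (s0 : 0 < s) (L0 : 0 <= L).
Hypotheses (hk : regular_kernel s L k) (kN : forall z, k (- z) = k z).

(** For [L v]: a bounded function is absolutely integrable against the kernel away from 0. *)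
Lemma bounded_difference_cvg f x (B : R) : continuous f -> taylor_at (2 * s) f x ->
  0 <= B -> (forall y, `|f y| <= B) ->
  exists l : R, tint (fun z => (f x - f (x - z)) * k z) t @[t --> 0^'+] --> l.
Proof.
move=> cf tf B0 fB; apply: (difference_cvg s0 L0 hk kN cf tf) => r r0.
have s20 : 0 < 2 * s by have := s0; lra.
have cq : continuous_off0 (fun z => f (x - z) * (psi r z * k z)).
  apply: continuous_off0M; last exact: psik_continuous hk _ r0.
  by apply: continuous_off0_cont; exact: shift_continuous.
have [D D0 hD] := tint_bound n s20 s20.
apply: (tint_abs_cvg cq (hD _ 0 (B * L) r r0 (lexx 0) (mulr_ge0 B0 L0) cq _ _)).
  by move=> z z0 zr; rewrite psi_in// mul0r mulr0 normr0 mul0r.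
move=> z rz; have z0 : z != 0 by rewrite -enorm_gt0; exact: lt_le_trans rz.
have [k0 kL _ _] := hk.
rewrite normrM -mulrA; apply: ler_pM => //.
rewrite ger0_norm; last by apply: mulr_ge0; [exact: psi_ge0|].
by apply: le_trans (kL z z0); apply: ler_piMl => //; exact: psi_le1.
Qed.

(** For [L (d_e v)]: the tail converges because the integrand is a combination of derivatives of a
    bounded function, even if these are unbounded. Passing to [z |-> f (x - z)] changes the sign of
    the weights. *)
Lemma derivative_difference_cvg f x (w : 'I_n -> R) (B : R) :
  (forall y, differentiable f y) -> (forall i, continuous (fun y => 'D_(bas i) f y)) ->
  taylor_at (2 * s) (fun y => \sum_i w i * 'D_(bas i) f y) x ->
  0 <= B -> (forall y, `|f y| <= B) ->
  exists l : R, tint (fun z => (\sum_i w i * 'D_(bas i) f x -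
    \sum_i w i * 'D_(bas i) f (x - z)) * k z) t @[t --> 0^'+] --> l.
Proof.
move=> df cD tf B0 fB.
have cf : continuous (fun y => \sum_i w i * 'D_(bas i) f y).
  move=> y; apply: sumr_continuous => i; apply: continuousM; first exact: cst_continuous.
  exact: cD.
apply: (difference_cvg s0 L0 hk kN cf tf) => r r0.
pose U z := f (x - z).
have dU z : differentiable U z by have [] := derive_reflected x z 0 df.
have DU i z : 'D_(bas i) U z = - 'D_(bas i) f (x - z) by have [] := derive_reflected x z (bas i) df.
have cDU i : continuous (fun z => 'D_(bas i) U z).
  rewrite (funext (DU i)) => z.
  have cS : {for z, continuous (fun z => 'D_(bas i) f (x - z))}.
    exact: (@shift_continuous R n _ x (cD i)).
  exact: (continuousN cS).
have -> : (fun z => (\sum_i w i * 'D_(bas i) f (x - z)) * (psi r z * k z)) =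
   (fun z => \sum_i (- w i) * ('D_(bas i) U z * (psi r z * k z))).
  apply/funext => z; rewrite mulr_suml; apply: eq_bigr => i _.
  by rewrite DU; ring.
have cG i : continuous_off0 (fun z => 'D_(bas i) U z * (psi r z * k z)).
  apply: continuous_off0M; last exact: psik_continuous hk _ r0.
  by apply: continuous_off0_cont; exact: cDU.
apply: tint_sum_cvg => i.
  by apply: continuous_off0M; [exact: continuous_off0_cst|exact: cG].
have [l hl] := far_cvg s0 L0 hk r0 B0 dU (@cDU i) (fun z => fB (x - z)).
by exists (- w i * l); exact: cvg_tintZ.
Qed.

End pointwise.

(** * The inequality *)

Section caccioppoli.
Variables (R : realType) (n : nat).
Local Notation V := 'rV[R]_n.
Local Notation bas := (@Defs.basis R n).
Implicit Types (x y z e p : V) (f g : V -> R) (r t : R).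

(** Nothing is assumed on the convergence for [f]: its value is obtained as the sum of the two real
    limits and of [E], and may be [-oo]. *)
Lemma sum_error_le (K : V -> \bar R) (k f g v : V -> R) x (a b a' : R) er :
  continuous f -> continuous g -> continuous v -> continuous_off0 k -> continuous_off0 er ->
  (forall z, z != 0 -> K z = (k z)%:E) ->
  (exists l : R, tint (fun z => (g x - g (x - z)) * k z) t @[t --> 0^'+] --> l) ->
  (exists l : R, tint (fun z => (v x - v (x - z)) * k z) t @[t --> 0^'+] --> l) ->
  (exists2 E : \bar R, (E <= 0)%E & (tint er t)%:E @[t --> 0^'+] --> E) ->
  (forall z, (f x - f (x - z)) * k z = a * a' * ((g x - g (x - z)) * k z) +
     b * v x * ((v x - v (x - z)) * k z) + er z) ->
  (nonlocal K f x <= a%:E * nonlocal K g x * a'%:E + b%:E * nonlocal K v x * (v x)%:E)%E.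
Proof.
move=> cf cg cv ck cer KE [lg hg] [lv hv] [E E0 hE] dec.
have cdiff (h : V -> R) : continuous h -> continuous_off0 (fun z => (h x - h (x - z)) * k z).
  move=> ch; apply: continuous_off0M => //; apply: continuous_off0D; first exact: continuous_off0_cst.
  by apply: continuous_off0N; apply: continuous_off0_cont; exact: shift_continuous.
have lim (h : V -> R) (l : R) : continuous h -> tint (fun z => (h x - h (x - z)) * k z) t @[t --> 0^'+] --> l ->
    nonlocal K h x = l%:E.
  move=> ch hl; apply: (nonlocal_cvg ch ck KE).
  by apply: cvg_EFin; [near=> t|].
rewrite (lim g lg)// (lim v lv)//.
have cq := continuous_off0_cst (n := n).
have c1 := cdiff g cg; have c2 := cdiff v cv.
have cA : continuous_off0 (fun z => a * a' * ((g x - g (x - z)) * k z)) by exact: continuous_off0M.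
have cB : continuous_off0 (fun z => b * v x * ((v x - v (x - z)) * k z)) by exact: continuous_off0M.
have hA := cvg_tintZ (c := a * a') c1 hg.
have hB := cvg_tintZ (c := b * v x) c2 hv.
have hAB := cvg_tintD cA cB hA hB.
rewrite (@nonlocal_cvg _ _ K k f x ((a * a' * lg + b * v x * lv)%:E + E)%E)//.
  apply: (@le_trans _ _ (a * a' * lg + b * v x * lv)%:E); first exact: geeDl.
  by rewrite -!EFinM -EFinD lee_fin le_eqVlt; apply/orP; left; apply/eqP; ring.
have hABE : (tint (fun z => a * a' * ((g x - g (x - z)) * k z) + b * v x * ((v x - v (x - z)) * k z)) t)%:E
    @[t --> 0^'+] --> (a * a' * lg + b * v x * lv)%:E.
  by apply: cvg_EFin; [near=> t|].
have ad : ((a * a' * lg + b * v x * lv)%:E +? E)%E by move: E0; clear; case: E.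
apply: cvg_trans (cvgeD ad hABE hE); apply: near_eq_cvg; near=> t.
have t0 : 0 < t by near: t; exact: nbhs_right_gt.
rewrite -EFinD -tintD//; last exact: continuous_off0D.
by rewrite (funext dec).
Unshelve. all: by end_near. Qed.

End caccioppoli.

(** Absolute values, because [M] and [rho] are chosen before the data that force them to be
    nonnegative. Having [c <= 1] makes [c ^+ 2 <= c], so a linear condition on [c] is enough. *)
Lemma small_constant (R : realType) (M Ch rho cl : R) : 0 <= Ch -> 0 < cl ->
  exists c : R, [/\ 0 < c, 16 * (c * `|M|) <= 1 & 56 * M ^+ 2 * Ch * `|rho| * c ^+ 2 <= cl].
Proof.
move=> Ch0 cl0; pose X := 56 * M ^+ 2 * Ch * `|rho|.
have X0 : 0 <= X by rewrite mulr_ge0// mulr_ge0// mulr_ge0// sqr_ge0.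
pose c := Num.min (Num.min 1 (cl / (X + 1))) ((16 * (`|M| + 1))^-1).
have M1 : 0 < `|M| + 1 by rewrite ltr_wpDl.
have X1 : 0 < X + 1 by lra.
have c0 : 0 < c by rewrite !lt_min ltr01 divr_gt0//= invr_gt0 mulr_gt0.
have c1 : c <= 1 by rewrite !ge_min lexx.
have c2 : c <= cl / (X + 1) by rewrite !ge_min lexx orbT.
have c3 : c <= (16 * (`|M| + 1))^-1 by rewrite ge_min lexx orbT.
exists c; split => //.
  have := c3; rewrite -(ler_pM2r (_ : 0 < 16 * (`|M| + 1))) ?mulr_gt0// mulVf ?gt_eqF ?mulr_gt0//.
  have := normr_ge0 M; nra.
rewrite -/X; move: c2; rewrite ler_pdivlMr// => c2.
apply: le_trans c2; rewrite mulrC expr2 -mulrA ler_wpM2l// ?(ltW c0)//; nra.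
Qed.

(* rho is the ratio Lambda / lambda, and M the C^{1,1} norm of eta.  Lambda0 is
   an arbitrary upper bound for Lambda: the bound |grad K| <= Lambda |y|^-1 K is
   invariant under K -> c K while Lambda is not, so a threshold sigma0 uniform
   over all Lambda with a given ratio Lambda / lambda does not exist in general. *)
Theorem theorem1p8 (R : realType) (n : nat) (s rho M Lambda0 : R) :
  (0 < n)%N ->
  exists2 sigma0 : R, 0 < sigma0 &
  forall (s0 lambda Lambda : R),
    0 < s0 -> s0 < s -> s < 1 ->
    0 < lambda -> lambda <= Lambda ->
    Lambda / lambda = rho -> Lambda <= Lambda0 ->
  forall K : 'rV[R]_n -> \bar R, kernel_class s lambda Lambda K ->
  forall eta : 'rV[R]_n -> R,
    C11 eta -> (forall x, 0 <= eta x) -> C11_norm eta = M%:E ->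
  forall (e : 'rV[R]_n) (eps sigma : R) (v : 'rV[R]_n -> R),
    enorm e = 1 -> 0 < eps -> sigma0 <= sigma ->
    C_loc (1 + 2 * s + eps) v -> Linfty v ->
  let dv : 'rV[R]_n -> R := fun y => 'D_e v y in
  forall x : 'rV[R]_n,
    (nonlocal K (fun y => eta y ^+ 2 * pos_part dv y ^+ 2 + sigma * v y ^+ 2)%R x
     <= (2 * eta x ^+ 2)%:E * nonlocal K dv x * (pos_part dv x)%:E
        + (2 * sigma)%:E * nonlocal K v x * (v x)%:E)%E.
Proof.
(* The sign of [s] is known only after [sigma0] has been given; outside []0, 1[] the conclusion is
   vacuous. *)
move=> n0; have [/andP[s0 s1]|ns] := boolP ((0 < s) && (s < 1)); last first.
  exists 1 => // s' lam Lam s'0 s's s1; move: ns.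
  by rewrite (lt_trans s'0 s's) s1.
have d0 : 0 < 2 - 2 * s by lra.
have d'0 : 0 < 2 * s by lra.
have [cl cl0 hcl] := @integ_epow_lower R n _ n0 d'0.
have [Ch Ch0 hCh] := tint_bound n d0 d'0.
have [c [c0 cM hc]] := small_constant M rho Ch0 cl0.
(* The value demanded by [hsigma], with [Lambda] replaced by its upper bound; adding 1 makes it
   positive. *)
exists (2 * n%:R ^+ 2 * (16 + `|Lambda0|) ^+ 2 / c ^+ 2 + 1).
  by rewrite ltr_wpDl// divr_ge0 ?sqr_ge0// mulr_ge0 ?sqr_ge0// mulr_ge0// sqr_ge0.
move=> s' lam Lam _ _ _ lam0 lamLam rhoE LamLam0 K hK eta [deta _] eta0 etaM e eps sigma v e1 eps0
  hsig [k' [bt [bt0 bt1 abt hv]]] vinf dv x.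
have Lam0 : 0 <= Lam by apply: le_trans lamLam; exact: ltW.
have [hk kN KE klow] := kernel_class_regular hK.
set k := fine \o K in hk KE klow *.
have ck : continuous_off0 k by exact: kernel_continuous hk.
have [M0 etaB _ _] := C11_bounds etaM.
rewrite (ger0_norm M0) in cM.
have rho0 : 0 <= rho by rewrite -rhoE divr_ge0// ltW.
rewrite (ger0_norm rho0) in hc.
have LamE : Lam = rho * lam by rewrite -rhoE divfK// gt_eqF.
have cv : continuous v by exact: Ck_continuous bt0 hv.
have [B B0 vB] := Linfty_bounded cv vinf.
have tv : taylor_at (2 * s) v x by apply: Ck_taylor hv => //; lra.
(* Order zero is impossible: [1 + 2 * s + eps > 1] while [bt <= 1]. *)
case: k' abt hv => [|k'] abt hv; first by exfalso; lra.
have [dfv Dv] := hv.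
have cDv i : continuous (fun y => 'D_(@Defs.basis R n i) v y) by exact: Ck_continuous bt0 (Dv i).
(* The derivatives of [v] have regularity [2 * s + eps]; here [eps] provides the strict inequality
   that makes the remainder integrable. *)
have tDv i : taylor_at (2 * s) (fun y => 'D_(@Defs.basis R n i) v y) x.
  by apply: Ck_taylor (Dv i) => //; [move: abt; rewrite -natr1|]; lra.
have dvE : dv = fun y => \sum_i e 0 i * 'D_(@Defs.basis R n i) v y.
  by apply/funext => y; rewrite /dv derive_dot// /dot; apply: eq_bigr => i _; rewrite mxE mulrC.
have tdv : taylor_at (2 * s) (fun y => \sum_i e 0 i * 'D_(@Defs.basis R n i) v y) x.
  by apply: taylor_at_sum => [|i]; [exact: ltW|exact: taylor_atZ].
have cdv : continuous dv.
  rewrite dvE => y; apply: sumr_continuous => i; apply: continuousM; first exact: cst_continuous.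
  exact: cDv.
have ceta : continuous eta by move=> y; exact: differentiable_continuous.
pose U (z : 'rV[R]_n) := v (x - z) - v x.
have dU z : differentiable U z.
  by apply: differentiableB => //; have [] := @derive_reflected R n v x z 0 dfv.
have DU i (z : 'rV[R]_n) : 'D_(@Defs.basis R n i) U z = - 'D_(@Defs.basis R n i) v (x - z).
  have [dsh <-] := @derive_reflected R n v x z (@Defs.basis R n i) dfv.
  by rewrite deriveB// ?derive_cst ?subr0//; exact: diff_derivable.
have cDU i : continuous (fun z : 'rV[R]_n => 'D_(@Defs.basis R n i) U z).
  rewrite (funext (DU i)) => z.
  have cS : {for z, continuous (fun z : 'rV[R]_n => 'D_(@Defs.basis R n i) v (x - z))}.
    exact: (@shift_continuous R n _ x (cDv i)).
  exact: (continuousN cS).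
have UB z : `|U z| <= B + B by apply: le_trans (ler_normB _ _) _; exact: lerD.
have w1 i : `|- e 0 i| <= 1 by rewrite normrN -e1; exact: coord_le_enorm.
have bE (z : 'rV[R]_n) : dv (x - z) = \sum_i - e 0 i * 'D_(@Defs.basis R n i) U z.
  by rewrite dvE; apply: eq_bigr => i _; rewrite DU mulrNN.
have a0 : 0 <= pos_part dv x by rewrite /pos_part le_max lexx orbT.
have hsigma : 2 * n%:R ^+ 2 * (16 + Lam) ^+ 2 <= sigma * c ^+ 2.
  have cc : 0 < c ^+ 2 by rewrite exprn_gt0.
  rewrite -ler_pdivrMr//; apply: le_trans hsig.
  apply: (@le_trans _ _ (2 * n%:R ^+ 2 * (16 + `|Lambda0|) ^+ 2 / c ^+ 2)); last by lra.
  rewrite ler_pM2r ?invr_gt0//; apply: ler_wpM2l; first by rewrite mulr_ge0// sqr_ge0.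
  have := ler_norm Lambda0; rewrite ler_pXn2r ?nnegrE//; lra.
have h1 (z : 'rV[R]_n) : `|eta (x - z) - eta x| <= M * enorm z by have [] := C11_expansion x z deta etaM.
have h2 (z : 'rV[R]_n) : `|eta (x - z) - eta x + dot (grad eta x) z| <= M * enorm z ^+ 2.
  by have [] := C11_expansion x z deta etaM.
have ceta' : continuous (fun z : 'rV[R]_n => eta (x - z)) by exact: shift_continuous.
have cdv' : continuous (fun z : 'rV[R]_n => dv (x - z)) by exact: shift_continuous.
have e0M : eta x <= M by apply: le_trans (etaB x); exact: ler_norm.
have BB0 : 0 <= B + B by exact: addr_ge0.
apply: (@sum_error_le _ _ K k _ dv v x (2 * eta x ^+ 2) (2 * sigma) (pos_part dv x)
  (error k (fun z => eta (x - z)) (fun z => dv (x - z)) U (pos_part dv x) (eta x) sigma)) => //.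
- move=> y.
  have ey : {for y, continuous eta} := ceta y.
  have vy : {for y, continuous v} := cv y.
  have py : {for y, continuous (fun y => pos_part dv y ^+ 2)}.
    by apply: (@continuous_comp _ _ _ dv (@sqplus R)); [exact: cdv|exact: sqplus_continuous].
  have sy : {for y, continuous (fun _ : 'rV[R]_n => sigma)} by exact: cst_continuous.
  exact: (continuousD (continuousM (continuousM ey ey) py) (continuousM sy (continuousM vy vy))).
- exact: (error_continuous hk ceta' cdv' dU).
- by rewrite dvE; apply: (derivative_difference_cvg s0 Lam0 hk kN dfv cDv tdv B0 vB).
- by apply: (bounded_difference_cvg s0 Lam0 hk kN cv tv B0 vB).
- exact: (error_cvg n0 s0 lam0 Lam0 LamE hk kN klow hcl hCh M0 c0 cM hc ceta' cdv' dU cDU UB BB0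
     w1 bE a0 (eta0 x) e0M h1 h2 hsigma).
move=> z; rewrite /error /defect /U /sqplus /pos_part.
(* Multiplied by the positive part at [x], [dv x] becomes a square; this turns the term of
   [L (d_e v)] into those of [defect]. *)
have aa : Num.max (dv x) 0 * dv x = Num.max (dv x) 0 ^+ 2.
  by case: leP => _; rewrite ?mul0r ?expr0n// expr2.
set a := Num.max (dv x) 0 in aa *.
have -> : 2 * eta x ^+ 2 * a * ((dv x - dv (x - z)) * k z) =
  2 * eta x ^+ 2 * (a * dv x - a * dv (x - z)) * k z by ring.
by rewrite aa; ring.
Qed.
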